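(* Let $\lambda_0\in(0,1/e)$, let $\beta_{\lambda_0}$ be the repelling real fixed point of $E_{\lambda_0}$ and let $\Phi_{\lambda_0}:[\beta_{\lambda_0},\infty)\to\mathbb{R}$ be the associated (real, extended) Koenigs function. Let $K_{\lambda_0}:=\frac{\log 2}{\log\beta_{\lambda_0}}$ and let $h(t)=t^2g(t)$ be a gauge function. (a) If $$\liminf_{t\to0}\frac{\log g(t)}{\log\Phi_{\lambda_0}(1/t)}>K_{\lambda_0},$$ then $\mathcal{H}^h(\mathcal{J}(E_\lambda))=\infty$ for every $\lambda\in\mathbb{C}\setminus\{0\}$; moreover, the measure $\mathcal{H}^h$ is not even $\sigma$-finite on $\mathcal{J}(E_\lambda)$. (b) If $$\limsup_{t\to0}\frac{\log g(t)}{\log\Phi_{\lambda_0}(1/t)}<K_{\lambda_0},$$ then $\mathcal{H}^h(\mathcal{J}(E_\lambda))=0$ for every $\lambda\in(0,1/e)$.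
   Context: For $\lambda\in\mathbb{C}\setminus\{0\}$, $E_\lambda(z):=\lambda e^z$, and $E_\lambda^n$ is its $n$-th iterate. The Fatou set $\mathcal{F}(E_\lambda)$ is the set of points of $\mathbb{C}$ having a neighborhood on which the iterates $E_\lambda^n$ form a normal family (in the sense of Montel); the Julia set is $\mathcal{J}(E_\lambda)=\mathbb{C}\setminus\mathcal{F}(E_\lambda)$. A gauge function is a monotonically increasing function $h:[0,\varepsilon)\to\mathbb{R}_{\ge0}$ (for some $\varepsilon>0$) which is continuous from the right and satisfies $h(0)=0$. The Hausdorff measure of $A\subset\mathbb{C}$ with respect to $h$ is $$\mathcal{H}^h(A):=\lim_{\delta\to0}\inf\Big\{\sum_{i=1}^\infty h(\operatorname{diam}A_i)\ \Big|\ \bigcup_{i=1}^\infty A_i\supset A,\ \operatorname{diam}A_i<\delta\text{ for every }i\Big\}.$$ For $0<\lambda<1/e$, $E_\lambda$ has exactly two real fixed points $\alpha_\lambda<\beta_\lambda$, with $\alpha_\lambda$ attracting ($E_\lambda'(\alpha_\lambda)<1$) and $\beta_\lambda$ repelling ($E_\lambda'(\beta_\lambda)=\beta_\lambda>1$). By Koenigs' theorem there is a holomorphic function $\Phi_\lambda$ on a neighborhood $V$ of $\beta_\lambda$ with $\Phi_\lambda(\beta_\lambda)=0$, $\Phi_\lambda'(\beta_\lambda)=1$ and $\Phi_\lambda(E_\lambda(z))=\beta_\lambda\Phi_\lambda(z)$ whenever $z,E_\lambda(z)\in V$. It is real on the real axis, and via this functional equation it is continued to a real-valued function $\Phi_\lambda$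 on $[\beta_\lambda,\infty)$ satisfying $\Phi_\lambda(E_\lambda(x))=\beta_\lambda\Phi_\lambda(x)$ for all $x\ge\beta_\lambda$; one has $\Phi_\lambda(x)\to\infty$ as $x\to\infty$. *)

(* Defs.v *)
From mathcomp Require Import all_boot all_order all_algebra.
From mathcomp Require Import complex.
From mathcomp Require Import all_classical all_reals all_analysis.
Set Implicit Arguments.
Unset Strict Implicit.
Unset Printing Implicit Defensive.
Import Order.TTheory GRing.Theory Num.Theory.
Import numFieldNormedType.Exports.
Import Normc.

Local Open Scope classical_set_scope.
Local Open Scope ring_scope.
Local Open Scope complex_scope.

(* The regular module R[i]^o, rather than R[i] itself, carries the topology of
   the complex plane and makes [derivable f z 1] complex differentiability. *)
Notation cplane R := (R[i]^o).

Section ComplexExponential.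
Context {R : realType}.

Definition cexp (z : cplane R) : cplane R :=
  (expR (complex.Re z) * cos (complex.Im z)) +i*
  (expR (complex.Re z) * sin (complex.Im z)).

Definition Eexp (lam : cplane R) (z : cplane R) : cplane R := lam * cexp z.

End ComplexExponential.

Section FatouJulia.
Context {R : realType}.
Local Notation C := (cplane R).

(* A subsequence may also diverge to infinity: normality is that of maps into
   the Riemann sphere.  The two alternatives are those of Montel; they agree
   with local uniform convergence in the spherical metric on connected U, hence
   yield the same Fatou set. *)
Definition normal_on (U : set C) (F : set (C -> C)) : Prop :=
  forall f : nat -> C -> C, (forall k, F (f k)) ->
  exists s : nat -> nat, {homo s : m n / (m < n)%N} /\
    ((exists g : C -> C, forall K : set C, compact K -> K `<=` U ->
        {uniform K, f \o s @ \oo --> g})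
     \/ (forall K : set C, compact K -> K `<=` U ->
        forall M : R, \forall k \near \oo, forall z, K z ->
          M < normc (f (s k) z))).

Definition fatou (f : C -> C) : set C :=
  [set z | exists2 U : set C, open_nbhs z U &
     normal_on U (range (fun n : nat => iter n f))].

Definition julia (f : C -> C) : set C := ~` fatou f.

End FatouJulia.

Section HausdorffMeasure.
Context {R : realType}.
Local Notation C := (cplane R).

(* Only the values of h on [0, eps[ matter. *)
Definition gauge_function (h : R -> R) : Prop :=
  exists2 eps : R, 0 < eps &
    [/\ h 0 = 0,
        forall t, 0 <= t < eps -> 0 <= h t,
        forall s t, 0 <= s -> s <= t -> t < eps -> h s <= h t &
        forall t, 0 <= t < eps -> h x @[x --> t^'+] --> h t].

(* The added point 0 makes the diameter of the empty set 0 instead of -oo. *)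
Definition diam (A : set C) : \bar R :=
  ereal_sup (0%E |` [set (normc (x - y))%:E | x in A & y in A]).

Definition hausdorff_content (h : R -> R) (A : set C) (delta : R) : \bar R :=
  ereal_inf [set (\sum_(0 <= i <oo) (h (fine (diam (D i))))%:E)%E
    | D in [set D : nat -> set C | A `<=` \bigcup_i D i /\
                                   forall i, (diam (D i) < delta%:E)%E]].

Definition hausdorff_measure (h : R -> R) (A : set C) : \bar R :=
  lim (hausdorff_content h A delta @[delta --> 0^'+]).

Definition hausdorff_sigma_finite (h : R -> R) (A : set C) : Prop :=
  exists F : nat -> set C, A `<=` \bigcup_n F n /\
    forall n, (hausdorff_measure h (F n) < +oo)%E.

End HausdorffMeasure.

Section Koenigs.
Context {R : realType}.
Local Notation C := (cplane R).

Definition real_repelling_fixpoint (f : C -> C) (b : R) : Prop :=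
  f b%:C = b%:C /\ 1 < normc (derive1 f b%:C).

(* phi is the local Koenigs linearization; its germ at b is unique, and the
   functional equation then determines Phi on [b, +oo[.  The values of Phi
   to the left of b are unconstrained. *)
Definition koenigs (lam b : R) (Phi : R -> R) : Prop :=
  (exists (V : set C) (phi : C -> C),
    [/\ open_nbhs (b%:C : C) V,
        forall z, V z -> derivable phi z 1,
        phi b%:C = 0 /\ derive1 phi b%:C = 1,
        forall z, V z -> V (Eexp lam%:C z) ->
          phi (Eexp lam%:C z) = b%:C * phi z &
        forall x : R, b <= x -> V x%:C -> phi x%:C = (Phi x)%:C]) /\
  (forall x : R, b <= x -> Phi (lam * expR x) = b * Phi x).

(* [lne 0 = -oo]; for small t > 0 the denominator is positive. *)
Definition log_ratio (g Phi : R -> R) (t : R) : \bar R :=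
  (lne (g t)%:E / (ln (Phi (1 / t)))%:E)%E.

End Koenigs.

(* Main.v *)
(* Where an iterate E^(n+1) is nearly affine on a square Q and expands it a lot,
   the real part of E^(n+2) is positive on about half of Q.  Both bounds count
   the cells of a fine grid on Q that meet this half.

   Upper bound: for real lam < 1/e, orbits in the Julia set never leave a right
   half plane.  So about half of the cells of size comparable to 1/|(E^(n+1))'|
   suffice to cover the part of the Julia set in Q, whereas passing from Q to a
   cell multiplies the gauge Phi(1/t)^s by at most about beta^s < 2, because
   1/t grows at most exponentially.  At bounded scales, a hole in the Julia set
   gives the gain instead.  Iteration yields covers of arbitrarily small weight.

   Lower bound: keep the cells with Re E^(n+2) >= (sin d) |E^(n+2)|.  Along the
   resulting tree |E^n| dominates Y_n, a multiple of a real orbit X_n of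
   lam0 * exp, for which Phi(X_n) = beta^n Phi(X_0), and cells of generation n
   are smaller than 1/Y_n.  A square of size t between 1/Y_(N+1) and 1/Y_N thus
   carries relative mass about 2^N t^2 << t^2 Phi(1/t)^s' as soon as
   beta^s' > 2, and squares of small total t^2 Phi(1/t)^s' miss a branch.  Its
   limit point escapes while every neighbourhood contains points w with some
   |E^(n+3) w| <= |lam|, so it lies in the Julia set.  Finally
   t^2 Phi(1/t)^s' = o(h(t)) when s' < s, which excludes sigma-finiteness. *)
Require Import Defs.
From mathcomp Require Import all_boot all_order all_algebra.
From mathcomp Require Import complex.
From mathcomp Require Import all_classical all_reals all_analysis.
From mathcomp Require Import ring lra.
Import Order.TTheory GRing.Theory Num.Theory.
Import numFieldNormedType.Exports.
Import Normc.
Local Open Scope classical_set_scope.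
Local Open Scope ring_scope.
Local Open Scope complex_scope.
Set Implicit Arguments.
Unset Strict Implicit.
Unset Printing Implicit Defensive.

(** Distortion is obtained without Koebe's theorem: along an expanding orbit the step errors form a
    geometric series dominated by its last term, so E^(n+1) is nearly affine once |(E^n)'| times the
    radius is small. The obstacle in the upper bound is a gap of scales. At the last m for which
    |(E^m)'| r is small, |(E^(m+1))'| r may be huge, and then about half of the square is lost; or
    it is bounded, and nothing is gained directly. In the second case the square is cut into
    boundedly many pieces that are small for (E^(m+1))'. In a piece the next orbit point is either
    large, so that halving works one iterate later, or bounded, and then uniform continuity gives a
    hole of definite relative size. All cases share one factor t < 1. The lower bound builds no
    measure. A grid averages relative area exactly, so a branch can be chosen along which the
    potentials of all squares to be avoided keep a sum below 1; they end as 0-1 indicators, so each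
    one vanishes. Countably many squares are avoided at once, which is what a sigma-finite
    decomposition requires. *)

Section ComplexModulus.
Context {R : realType}.
Implicit Types z w : R[i].

Lemma normc_triangle z w : normc (z + w) <= normc z + normc w.
Proof. exact: le_normcD. Qed.

Lemma normc_opp z : normc (- z) = normc z.
Proof. exact: normcN. Qed.

Lemma normc_distC z w : normc (z - w) = normc (w - z).
Proof. by rewrite -normc_opp opprB. Qed.

Lemma normc_ge0 z : 0 <= normc z.
Proof. by case: z => x y; exact: sqrtr_ge0. Qed.

Lemma normc_gt0 z : (0 < normc z) = (z != 0).
Proof.
rewrite lt_neqAle normc_ge0 andbT eq_sym; congr (~~ _).
by apply/eqP/eqP => [/eq0_normc//|->]; rewrite normc0.
Qed.

Lemma normc_sqr z : normc z ^+ 2 = complex.Re z ^+ 2 + complex.Im z ^+ 2.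
Proof. by case: z => x y /=; rewrite sqr_sqrtr// addr_ge0// sqr_ge0. Qed.

Lemma ler_Re_normc z : `|complex.Re z| <= normc z.
Proof.
by rewrite -ler_sqr ?nnegrE ?normc_ge0// normc_sqr real_normK ?num_real// lerDl sqr_ge0.
Qed.

Lemma ler_Im_normc z : `|complex.Im z| <= normc z.
Proof.
by rewrite -ler_sqr ?nnegrE ?normc_ge0// normc_sqr real_normK ?num_real// lerDr sqr_ge0.
Qed.

Lemma normc_leD z : normc z <= `|complex.Re z| + `|complex.Im z|.
Proof.
rewrite -ler_sqr ?nnegrE ?normc_ge0 ?addr_ge0//.
by rewrite normc_sqr sqrrD !real_normK ?num_real// lerD2r lerDl mulrn_wge0// mulr_ge0.
Qed.

Lemma normc_real (x : R) : normc x%:C = `|x|.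
Proof. by rewrite /= expr0n addr0 sqrtr_sqr. Qed.

Lemma normc_triangleB z w : normc (z - w) <= normc z + normc w.
Proof. by rewrite -(normc_opp w); exact: normc_triangle. Qed.

Lemma ler_normcB z w : normc z - normc w <= normc (z - w).
Proof. by rewrite lerBlDr -{1}(subrK w z) normc_triangle. Qed.

Lemma normc_distD z w v : normc (z - v) <= normc (z - w) + normc (w - v).
Proof. by rewrite -{1}(subrK w z) -addrA normc_triangle. Qed.

Lemma ReD z w : complex.Re (z + w) = complex.Re z + complex.Re w.
Proof. by case: z; case: w. Qed.
Lemma ImD z w : complex.Im (z + w) = complex.Im z + complex.Im w.
Proof. by case: z; case: w. Qed.
Lemma ReN z : complex.Re (- z) = - complex.Re z.
Proof. by case: z. Qed.
Lemma ImN z : complex.Im (- z) = - complex.Im z.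
Proof. by case: z. Qed.
Lemma ReB z w : complex.Re (z - w) = complex.Re z - complex.Re w.
Proof. by rewrite ReD ReN. Qed.
Lemma ImB z w : complex.Im (z - w) = complex.Im z - complex.Im w.
Proof. by rewrite ImD ImN. Qed.

End ComplexModulus.

Section RealEstimates.
Context {R : realType}.
Implicit Types x y : R.

(** The upper bound compares e^x (1 - x) <= 1, a form of e^(-x) >= 1 - x, with (1 + x + 2x^2)(1 - x)
    >= 1. *)
Lemma expR_le_quad x : `|x| <= 1 / 2 -> `|expR x - 1 - x| <= 2 * x ^+ 2.
Proof.
move=> hx; have h1 := expR_ge1Dx x; have h2 := expR_ge1Dx (- x).
have : -(1/2) <= x <= 1/2 by rewrite -ler_norml.
move=> /andP[hl hu].
rewrite ger0_norm; last by lra.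
have e0 := expR_gt0 x.
have h3 : expR x * (1 - x) <= 1.
  by have := expRxMexpNx_1 x; nra.
have h4 : 1 <= (1 + x + 2 * x ^+ 2) * (1 - x).
  rewrite (_ : _ * _ = 1 + x ^+ 2 * (1 - 2 * x)); last by ring.
  by rewrite lerDl mulr_ge0 ?sqr_ge0//; lra.
have : expR x <= 1 + x + 2 * x ^+ 2.
  have : expR x * (1 - x) <= (1 + x + 2 * x ^+ 2) * (1 - x) by apply: le_trans h3 h4.
  by rewrite ler_pM2r//; lra.
by lra.
Qed.

Lemma sin_diff x y : `|sin x - sin y| <= `|x - y|.
Proof.
wlog : x y / y <= x => [H|hyx].
  by case: (leP y x) => [|/ltW] /H// h; rewrite distrC (distrC x).
have [c _ ->] := @MVT_segment R sin cos y x hyx (fun z _ => is_derive_sin z)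
  (continuous_subspaceT (@continuous_sin R)).
by rewrite normrM ler_piMl// cos_max.
Qed.

Lemma cos_diff x y : `|cos x - cos y| <= `|x - y|.
Proof.
by rewrite -!(sinDpihalf) (le_trans (sin_diff _ _))// opprD addrACA subrr addr0.
Qed.

Lemma cos_sub1 y : `|cos y - 1| <= y ^+ 2.
Proof.
have -> : cos y - 1 = - (2 * sin (y / 2) ^+ 2).
  by rewrite {1}(_ : y = y / 2 *+ 2) ?cos_mulr2n ?cos2sin2 ?mulr2n; [ring|field].
rewrite normrN ger0_norm; last by rewrite pmulr_rge0 ?sqr_ge0.
have := sin_diff (y / 2) 0; rewrite sin0 !subr0 => h.
have : `|sin (y / 2)| ^+ 2 <= `|y / 2| ^+ 2 by rewrite ler_sqr ?nnegrE.
rewrite !real_normK ?num_real// => h2.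
have := sqr_ge0 y; rewrite exprMn in h2; lra.
Qed.

Lemma sin_subx y : `|y| <= 1 -> `|sin y - y| <= y ^+ 2.
Proof.
wlog y0 : y / 0 <= y => [H|] hy.
  case: (leP 0 y) => [/H->//|/ltW y0].
  have := H (- y); rewrite oppr_ge0 normrN sinN sqrrN => /(_ y0 hy).
  by rewrite -opprD normrN.
pose f := (fun z : R => sin z - z); pose df := (fun z : R => cos z - 1).
have fd (z : R) : is_derive z 1 f (df z).
  by rewrite /f /df; apply: is_deriveB.
have fc : continuous f.
  move=> z; apply: differentiable_continuous; apply/derivable1_diffP.
  exact: ex_derive.
have [c hc] := MVT_segment y0 (fun z _ => fd z) (continuous_subspaceT fc).
rewrite /f sin0 !subr0 => ->.
rewrite normrM expr2 (ger0_norm y0) ler_wpM2r//.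
apply: le_trans (cos_sub1 _) _.
move: hc; rewrite in_itv/= => /andP[c0 cy]; move: hy; rewrite ger0_norm// => y1; nra.
Qed.

Lemma sin_ge_half (d : R) : 0 <= d <= 1 / 2 -> d / 2 <= sin d.
Proof.
move=> /andP[d0 d1]; have := @sin_subx d; rewrite ger0_norm// => h.
have : `|sin d - d| <= d ^+ 2 by apply: h; lra.
rewrite ler_norml => /andP[h1 _]; nra.
Qed.

(** By Bernoulli's inequality b^n >= n (b - 1). *)
Lemma expr_unbounded (A b : R) : 1 < b -> exists n, A <= b ^+ n.
Proof.
move=> b1; have b10 : 0 < b - 1 by rewrite subr_gt0.
have Nb n : n%:R * (b - 1) <= b ^+ n.
  elim: n => [|n IH]; first by rewrite mul0r expr0.
  have b1' : 1 <= b ^+ n by rewrite exprn_ege1// ltW.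
  rewrite -natr1 exprS mulrDl mul1r.
  by have := ler_wpM2r (ltW b10) b1'; lra.
exists (Num.truncn (A / (b - 1))).+1; apply: le_trans (Nb _).
by rewrite -ler_pdivrMr// ltW// truncnS_gt.
Qed.

End RealEstimates.

(** * The complex exponential: local expansion, inverse branch, polar form *)

Section ComplexExponentialTheory.
Context {R : realType}.
Implicit Types z w d : R[i].

Lemma cexpD z w : cexp (z + w) = cexp z * cexp w :> R[i].
Proof.
case: z => x y; case: w => u v; rewrite /cexp /= expRD cosD sinD.
by congr (_ +i* _); ring.
Qed.

Lemma cexp0 : cexp 0 = 1 :> R[i].
Proof. by rewrite /cexp /= expR0 cos0 sin0 mulr1 mulr0. Qed.

Lemma normc_cexp z : normc (cexp z) = expR (complex.Re z).
Proof.
by rewrite /cexp /= !exprMn -mulrDr cos2Dsin2 mulr1 sqrtr_sqr ger0_norm.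
Qed.

Lemma Re_cexp z : complex.Re (cexp z) = expR (complex.Re z) * cos (complex.Im z).
Proof. by []. Qed.

Lemma cexp_neq0 z : cexp z != 0 :> R[i].
Proof. by rewrite -normc_gt0 normc_cexp expR_gt0. Qed.

Lemma expR_half_le2 (x : R) : `|x| <= 1 / 2 -> expR x <= 2.
Proof.
move=> hx; have := expR_le_quad hx; rewrite ler_norml => /andP[_ h].
move: hx; rewrite ler_norml => /andP[h1 h2]; nra.
Qed.

Lemma cexp_quad d : normc d <= 1 / 2 -> normc (cexp d - 1 - d) <= 5 * normc d ^+ 2.
Proof.
move=> hd; have hx := le_trans (ler_Re_normc d) hd.
have hy := le_trans (ler_Im_normc d) hd.
apply: le_trans (normc_leD _) _; rewrite normc_sqr.
rewrite !ReB !ImB Re_cexp /=.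
set x := complex.Re d in hx *; set y := complex.Im d in hy *.
have e2 := expR_half_le2 hx; have e0 := expR_ge0 x.
have q := expR_le_quad hx; have c1 := cos_sub1 y.
have s1 : `|sin y - y| <= y ^+ 2 by apply: sin_subx; lra.
have -> : expR x * cos y - 1 - x = (expR x - 1 - x) + expR x * (cos y - 1) by ring.
have -> : expR x * sin y - 0 - y = expR x * (sin y - y) + (expR x - 1 - x) * y + x * y by ring.
have A1 : `|expR x * (cos y - 1)| <= 2 * y ^+ 2.
  by rewrite normrM (ger0_norm e0) ler_pM.
have A2 : `|expR x * (sin y - y)| <= 2 * y ^+ 2.
  by rewrite normrM (ger0_norm e0) ler_pM.
have A3 : `|(expR x - 1 - x) * y| <= x ^+ 2.
  have -> : x ^+ 2 = 2 * x ^+ 2 * (1 / 2) by field.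
  by rewrite normrM ler_pM.
have A4 : `|x * y| <= (x ^+ 2 + y ^+ 2) / 2.
  rewrite ler_norml; apply/andP; split.
    by have := sqr_ge0 (x + y); nra.
  by have := sqr_ge0 (x - y); nra.
have := ler_normD (expR x - 1 - x) (expR x * (cos y - 1)).
have := ler_normD (expR x * (sin y - y) + (expR x - 1 - x) * y) (x * y).
have := ler_normD (expR x * (sin y - y)) ((expR x - 1 - x) * y).
have := sqr_ge0 x; have := sqr_ge0 y; lra.
Qed.

Lemma cexp_sub1_le d : normc d <= 1 / 2 -> normc (cexp d - 1) <= 4 * normc d.
Proof.
move=> hd; have := cexp_quad hd; have := normc_triangle (cexp d - 1 - d) d.
rewrite subrK; have := normc_ge0 d; nra.
Qed.

(** The difference sin z - z cos z vanishes at 0 and has derivative z sin z >= 0. *)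
Lemma mulx_cos_le_sin (x : R) : 0 <= x <= pi / 2 -> x * cos x <= sin x.
Proof.
move=> /andP[x0 xpi].
pose f := (fun z : R => sin z - z * cos z); pose df := (fun z : R => z * sin z).
have fd (z : R) : is_derive z 1 f (df z).
  rewrite /f /df; apply: is_derive_eq.
  by rewrite /GRing.scale /=; ring.
have fc : continuous f.
  move=> z; apply: differentiable_continuous; apply/derivable1_diffP.
  exact: ex_derive.
have [c] := MVT_segment x0 (fun t _ => fd t) (continuous_subspaceT fc).
rewrite in_itv/= => /andP[c0 cx].
rewrite /f /df sin0 mul0r !subr0 => h.
rewrite -subr_ge0 h !mulr_ge0// sin_ge0_pi// c0 /=.
by have := @pi_ge0 R; lra.
Qed.

Lemma sqr_mulx_cos_le (x : R) : `|x| <= pi / 2 -> x ^+ 2 * cos x ^+ 2 <= sin x ^+ 2.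
Proof.
wlog x0 : x / 0 <= x => [H|] hx.
  case: (leP 0 x) => [/H->//|/ltW x0].
  by have := H (- x); rewrite oppr_ge0 normrN !sqrrN cosN sinN sqrrN; apply.
rewrite ger0_norm// in hx.
have h0 : 0 <= cos x by apply: cos_ge0_pihalf; lra.
have h1 : x * cos x <= sin x by apply: mulx_cos_le_sin; rewrite x0.
have h2 : 0 <= x * cos x by rewrite mulr_ge0.
by rewrite -exprMn ler_sqr ?nnegrE// (le_trans h2 h1).
Qed.

(** The law of cosines, with 1 - cos written as a half-angle square. Bounded from below it yields
    [cexp_expanding], bounded from above [cexp_lipschitz]. *)
Lemma normc_sqr_cexpB z w :
  normc (cexp z - cexp w) ^+ 2 = (expR (complex.Re z) - expR (complex.Re w)) ^+ 2 +
    4 * (expR (complex.Re z) * expR (complex.Re w)) *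
    sin ((complex.Im z - complex.Im w) / 2) ^+ 2.
Proof.
case: z => x y; case: w => u v; rewrite normc_sqr /cexp /=.
rewrite sin2cos2 (_ : cos ((y - v) / 2) ^+ 2 = (1 + cos (y - v)) / 2); last first.
  by rewrite [in RHS](_ : y - v = (y - v) / 2 *+ 2) ?cos_mulr2n ?mulr2n; field.
rewrite cosB; have := cos2Dsin2 y; have := cos2Dsin2 v => E1 E2.
have -> : (expR x * cos y - expR u * cos v) ^+ 2 + (expR x * sin y - expR u * sin v) ^+ 2
  = expR x ^+ 2 * (cos y ^+ 2 + sin y ^+ 2) + expR u ^+ 2 * (cos v ^+ 2 + sin v ^+ 2)
    - 2 * expR x * expR u * (cos y * cos v + sin y * sin v) by ring.
by rewrite E1 E2; field.
Qed.

(* With h half the difference of the imaginary parts y and v,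
   c^2 <= e^(x + u) cos y cos v <= e^(x + u) cos^2 h. *)
Lemma cexp_expanding (c : R) z w : 0 < c ->
  `|complex.Im z| < pi / 2 -> `|complex.Im w| < pi / 2 ->
  c <= complex.Re (cexp z) -> c <= complex.Re (cexp w) ->
  c * normc (z - w) <= normc (cexp z - cexp w).
Proof.
move=> c0 hy hv cy cv; rewrite -(@ler_pXn2r _ 2)//; last 2 first.
- by rewrite nnegrE mulr_ge0 ?normc_ge0// ltW.
- by rewrite nnegrE normc_ge0.
rewrite exprMn normc_sqr_cexpB normc_sqr.
case: z w hy hv cy cv => [x y] [u v] /= hy hv cy cv.
have e1 := expR_gt0 x; have e2 := expR_gt0 u.
have y0 : 0 < cos y by apply: cos_gt0_pihalf; rewrite -ltr_norml.
have v0 : 0 < cos v by apply: cos_gt0_pihalf; rewrite -ltr_norml.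
have cx : c <= expR x by apply: le_trans cy _; rewrite ger_pMr// cos_le1.
have cu : c <= expR u by apply: le_trans cv _; rewrite ger_pMr// cos_le1.
set h := (y - v) / 2; set k := (y + v) / 2.
have Ey : y = k + h by rewrite /h /k; field.
have Ev : v = k - h by rewrite /h /k; field.
have H1 : (c * (x - u)) ^+ 2 <= (expR x - expR u) ^+ 2.
  wlog xu : x u {cy cv} e1 e2 cx cu / u <= x => [H|].
    case: (leP u x) => [/H->//|/ltW /H HH].
    by rewrite -sqrrN -(sqrrN (expR _ - _)) -mulrN !opprB HH.
  have := expR_ge1Dx (x - u); have : expR x = expR u * expR (x - u).
    by rewrite -expRD addrC subrK.
  move=> E HE; have A : c * (x - u) <= expR x - expR u by rewrite E; nra.
  have A0 : 0 <= c * (x - u) by rewrite mulr_ge0 ?subr_ge0// ltW.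
  by rewrite ler_sqr// nnegrE (le_trans A0 A).
have H2 : c ^+ 2 <= expR x * expR u * cos h ^+ 2.
  have : c * c <= (expR x * cos y) * (expR u * cos v) by rewrite ler_pM// ltW.
  have : cos y * cos v <= cos h ^+ 2.
    rewrite Ey Ev cosD cosB; have := cos2Dsin2 k; have := sqr_ge0 (sin k).
    have := cos2Dsin2 h; set a := cos k; set b := cos h; set e := sin k; set f := sin h.
    move=> E1 E2 E3.
    have -> : (a * b - e * f) * (a * b + e * f) = a ^+ 2 * b ^+ 2 - e ^+ 2 * f ^+ 2 by ring.
    have -> : a ^+ 2 = 1 - e ^+ 2 by lra.
    have -> : f ^+ 2 = 1 - b ^+ 2 by lra.
    by rewrite -subr_ge0 (_ : _ - _ = e ^+ 2)//; ring.
  rewrite -(ler_pM2l (mulr_gt0 e1 e2)) => hA hB.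
  apply: le_trans hA; rewrite expr2; apply: le_trans hB _.
  by rewrite le_eqVlt; apply/orP; left; apply/eqP; ring.
have H3 : h ^+ 2 * cos h ^+ 2 <= sin h ^+ 2.
  apply: sqr_mulx_cos_le; rewrite /h normrM (ger0_norm (_ : 0 <= 2^-1))//.
  by rewrite ler_pM2r// (le_trans (ler_normB _ _))//; lra.
rewrite mulrDr -exprMn lerD//.
have -> : y - v = 2 * h by rewrite /h; field.
have h20 := sqr_ge0 h.
have X1 : c ^+ 2 * h ^+ 2 <= expR x * expR u * (h ^+ 2 * cos h ^+ 2).
  by rewrite [leRHS]mulrCA [leRHS]mulrC ler_wpM2r.
have X2 : expR x * expR u * (h ^+ 2 * cos h ^+ 2) <= expR x * expR u * sin h ^+ 2.
  by rewrite ler_pM2l// mulr_gt0.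
rewrite exprMn; lra.
Qed.

(** The principal logarithm; as Re w > 0, its argument is the arcsine of Im w / |w|. *)
Lemma clog_exists w : 0 < complex.Re w ->
  exists2 a : R[i], `|complex.Im a| < pi / 2 & cexp a = w.
Proof.
case: w => u v /= u0.
set r := Num.sqrt (u ^+ 2 + v ^+ 2).
have r2 : r ^+ 2 = u ^+ 2 + v ^+ 2 by rewrite sqr_sqrtr// addr_ge0 ?sqr_ge0.
have r0 : 0 < r by rewrite sqrtr_gt0; have := sqr_ge0 v; nra.
have v1 : `|v / r| < 1.
  rewrite normrM normfV (gtr0_norm r0) ltr_pdivrMr// mul1r.
  by rewrite -(@ltr_pXn2r _ 2)// ?nnegrE ?ltW// real_normK ?num_real// r2; nra.
have /andP[v2 v3] : -1 < v / r < 1 by rewrite -ltr_norml.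
have v4 : -1 <= v / r <= 1 by rewrite !ltW.
exists (ln r +i* asin (v / r)).
  rewrite /= ltr_norml asin_ltpi2 ?asin_gtNpi2 ?v2 ?v3 ?ltW//.
rewrite /cexp /= lnK ?posrE// cos_asin// asinK ?in_itv//=.
congr (_ +i* _); last by field; rewrite gt_eqF.
have -> : 1 - (v / r) ^+ 2 = (u / r) ^+ 2.
  rewrite !exprMn exprVn; apply: (mulIf (x := r ^+ 2)); rewrite ?sqrf_eq0 ?gt_eqF//.
  rewrite mulrBl !mulfVK ?sqrf_eq0 ?gt_eqF// r2; ring.
rewrite sqrtr_sqr ger0_norm ?divr_ge0 ?ltW//; field; by rewrite gt_eqF.
Qed.

Lemma polar_form z : z != 0 ->
  exists2 t : R, `|t| <= pi & z = (normc z)%:C * cexp (0 +i* t).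
Proof.
move=> z0; have n0 : 0 < normc z by rewrite normc_gt0.
have n2 := normc_sqr z.
have h : -1 <= complex.Re z / normc z <= 1.
  by rewrite -ler_norml normrM normfV (gtr0_norm n0) ler_pdivrMr// mul1r ler_Re_normc.
(* The arc cosine only reaches arguments in [0, pi]; the sign [s] reflects it into the lower half
   plane. *)
pose s : R := if 0 <= complex.Im z then 1 else -1.
have s2 : s ^+ 2 = 1 by rewrite /s; case: ifP => _; rewrite ?sqrrN expr1n.
exists (s * acos (complex.Re z / normc z)).
  have s1 : `|s| = 1 by rewrite /s; case: ifP; rewrite ?normrN normr1.
  by rewrite normrM s1 mul1r ger0_norm ?acos_ge0 ?acos_lepi.
rewrite /cexp /= expR0 !mul1r.
have -> : cos (s * acos (complex.Re z / normc z)) = complex.Re z / normc z.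
  rewrite /s; case: ifP => _; rewrite ?mulN1r ?cosN ?mul1r acosK ?in_itv//.
have -> : sin (s * acos (complex.Re z / normc z)) = complex.Im z / normc z.
  have -> : sin (s * acos (complex.Re z / normc z)) = s * sin (acos (complex.Re z / normc z)).
    by rewrite /s; case: ifP => _; rewrite ?mulN1r ?sinN ?mul1r.
  rewrite sin_acos//.
  have -> : 1 - (complex.Re z / normc z) ^+ 2 = (complex.Im z / normc z) ^+ 2.
    rewrite !exprMn exprVn; apply: (mulIf (x := normc z ^+ 2)); rewrite ?sqrf_eq0 ?gt_eqF//.
    rewrite mulrBl !mulfVK ?sqrf_eq0 ?gt_eqF// n2; ring.
  rewrite sqrtr_sqr normrM normfV (gtr0_norm n0) mulrA; congr (_ / _).
  rewrite /s; case: ifP => [i0|]; first by rewrite mul1r ger0_norm.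
  by move=> /negbT; rewrite -ltNge => i0; rewrite mulN1r ltr0_norm// opprK.
case: z z0 n0 {n2 h s s2} => x y z0 n0.
set r := normc _ in n0 *; rewrite /real_complex_def.
by congr (_ +i* _) => /=; field; rewrite gt_eqF.
Qed.

End ComplexExponentialTheory.

(** * Derivatives along orbits and bounded distortion *)

Section Orbits.
Context {R : realType}.
Variable lam : R[i].
Implicit Types z w d : R[i].

(** Convertible to [Eexp], but typed in [R[i]] rather than in its regular module, so that the ring
    structure is found directly. *)
Definition cE z : R[i] := lam * cexp z.

Local Notation orb z n := (iter n cE z).

(* By the chain rule this is the derivative of the [n]-th iterate. *)
Definition iter_deriv z n : R[i] := \prod_(j < n) orb z j.+1.

Local Notation D := iter_deriv.

Lemma normc_cE z : normc (cE z) = normc lam * expR (complex.Re z).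
Proof. by rewrite /cE normcM normc_cexp. Qed.

Lemma cED z d : cE (z + d) = cE z * cexp d.
Proof. by rewrite /cE cexpD mulrA. Qed.

Lemma iter_deriv0 z : D z 0 = 1.
Proof. by rewrite /D big_ord0. Qed.

Lemma iter_derivS z n : D z n.+1 = D z n * orb z n.+1.
Proof. by rewrite /D big_ord_recr. Qed.

Lemma normc_iter_derivS z n : normc (D z n.+1) = normc (D z n) * normc (orb z n.+1).
Proof. by rewrite iter_derivS normcM. Qed.

(** The orbit points of index 1 to n are exactly the factors of [iter_deriv z n]; the starting point
    itself is left free. *)
Definition expanding_upto (b : R) z n :=
  forall j, (1 <= j <= n)%N -> b <= normc (orb z j).

Lemma expanding_uptoW b z n m : (m <= n)%N -> expanding_upto b z n -> expanding_upto b z m.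
Proof. by move=> mn h j /andP[j1 jm]; apply: h; rewrite j1 (leq_trans jm mn). Qed.

Lemma iter_deriv_ge (b : R) z m k : 0 <= b -> expanding_upto b z (m + k) ->
  b ^+ k * normc (D z m) <= normc (D z (m + k)).
Proof.
move=> b0; elim: k => [|k IH] h; first by rewrite expr0 mul1r addn0.
rewrite addnS normc_iter_derivS exprS -mulrA mulrC.
rewrite ler_pM ?mulr_ge0 ?exprn_ge0 ?normc_ge0//; last first.
  by apply: h; rewrite addnS leqnn.
by rewrite IH//; apply: expanding_uptoW h; rewrite addnS.
Qed.

Lemma iter_deriv_gt0 (b : R) z n : 0 < b -> expanding_upto b z n -> 0 < normc (D z n).
Proof.
move=> b0 h; have := @iter_deriv_ge b z 0 n (ltW b0) h.
by rewrite add0n iter_deriv0 normc1 mulr1; apply: lt_le_trans; rewrite exprn_gt0.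
Qed.

Lemma iter_deriv_mono (b : R) z m n : 1 <= b -> (m <= n)%N -> expanding_upto b z n ->
  normc (D z m) <= normc (D z n).
Proof.
move=> b1 /subnKC <- h; have b0 : 0 <= b by rewrite (le_trans _ b1).
apply: le_trans (iter_deriv_ge b0 h).
by rewrite ler_peMl ?normc_ge0// exprn_ege1.
Qed.

(** Errors measured as e^a - 1 add in the exponent when factors are multiplied, which keeps the
    distortion recursion linear. *)
Lemma normc_mulB1 (u v : R[i]) (a b : R) :
  normc (u - 1) <= expR a - 1 -> normc (v - 1) <= expR b - 1 ->
  normc (u * v - 1) <= expR (a + b) - 1.
Proof.
move=> hu hv; have -> : u * v - 1 = ((u - 1) * (v - 1) + (u - 1)) + (v - 1) by ring.
apply: le_trans (normc_triangle _ _) _.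
apply: le_trans (lerD (normc_triangle _ _) (lexx _)) _.
rewrite normcM expRD; have := normc_ge0 (u - 1); have := normc_ge0 (v - 1); nra.
Qed.

(** The two-point form, with the derivative taken at [z0]: the counting arguments need increments
    between neighbouring grid points, not only increments from the centre. *)
Definition affine_on z0 (r S : R) n :=
  forall z w, normc (z - z0) <= r -> normc (w - z0) <= r ->
  exists2 u, normc (u - 1) <= S & orb z n - orb w n = D z0 n * (z - w) * u.

(** Put x = |D_n| r. The new increment is E^(n+1)(z0) e^e (e^d - 1) with |d| <= 4x and |e| <= 2x.
    Here (e^d - 1)/d is within 5|d| <= 20x of 1 and e^e within 4|e| <= 8x, whence 28 = 20 + 8; x <=
    1/8 makes |d| <= 1/2, as the expansions require. *)
Lemma affine_on_step z0 r S n : expR S - 1 <= 1 -> normc (D z0 n) * r <= 1 / 8 ->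
  affine_on z0 r (expR S - 1) n ->
  affine_on z0 r (expR (S + 28 * (normc (D z0 n) * r)) - 1) n.+1.
Proof.
move=> S1 hr H z w hz hw.
have r0 : 0 <= r by apply: le_trans hz; exact: normc_ge0.
have [u hu Eu] := H z w hz hw.
have h0 : normc (z0 - z0) <= r by rewrite subrr normc0.
have [v hv Ev] := H w z0 hw h0.
set d := orb z n - orb w n in Eu.
set e := orb w n - orb z0 n in Ev.
have dn : normc d <= 4 * (normc (D z0 n) * r).
  rewrite Eu !normcM; have : normc u <= 2.
    by have := ler_normcB u 1; rewrite normc1; lra.
  have : normc (z - w) <= 2 * r.
    by apply: le_trans (normc_distD z z0 w) _; rewrite (normc_distC z0); lra.
  have := normc_ge0 (D z0 n); have := normc_ge0 (z - w); have := normc_ge0 u.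
  move=> u0 zw0 D0 zw2 u2; rewrite -mulrA.
  rewrite (_ : 4 * _ = normc (D z0 n) * (2 * r * 2)); last by ring.
  by rewrite ler_wpM2l// ler_pM.
have en : normc e <= 2 * (normc (D z0 n) * r).
  rewrite Ev !normcM; have : normc v <= 2.
    by have := ler_normcB v 1; rewrite normc1; lra.
  have := normc_ge0 (D z0 n); have := normc_ge0 (w - z0); have := normc_ge0 v.
  move=> v0 zw0 D0 v2; rewrite -mulrA.
  rewrite (_ : 2 * _ = normc (D z0 n) * (r * 2)); last by ring.
  by rewrite ler_wpM2l// ler_pM.
set x := normc (D z0 n) * r in hr dn en *.
have x0 : 0 <= x by rewrite mulr_ge0 ?normc_ge0.
have [v' hv' Ev'] : exists2 v', normc (v' - 1) <= expR (20 * x) - 1 & cexp d - 1 = d * v'.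
  have [d0|d0] := eqVneq d 0.
    exists 1; last by rewrite d0 cexp0 mulr1 subrr.
    by rewrite subrr normc0; have := expR_ge1Dx (20 * x); lra.
  exists ((cexp d - 1) / d); last by rewrite mulrC divfK.
  have -> : (cexp d - 1) / d - 1 = (cexp d - 1 - d) / d by field.
  rewrite normcM normcV ler_pdivrMr ?normc_gt0//.
  have := expR_ge1Dx (20 * x); have := @cexp_quad _ d.
  have := normc_ge0 d; nra.
exists (u * v' * cexp e).
  have -> : S + 28 * x = S + 20 * x + 8 * x by ring.
  apply: normc_mulB1; first exact: normc_mulB1.
  apply: le_trans (cexp_sub1_le _) _; first by lra.
  by have := expR_ge1Dx (8 * x); lra.
rewrite !iterS.
have -> : orb z n = orb w n + d by rewrite /d; ring.
have -> : orb w n = orb z0 n + e by rewrite /e; ring.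
rewrite !cED -{2}(mulr1 (cE _ * _)) -mulrBr Ev' Eu iter_derivS iterS; ring.
Qed.

End Orbits.

Section Distortion.
Context {R : realType}.

(** Smallness is asked of |D_n| r, yet near-affinity holds for the iterate n + 1: the last
    application of E only needs the image under the n-th iterate to be small. The counting arguments
    live on this extra iterate, whose image is large. *)
Theorem distortion (b kap : R) : 1 < b -> 0 < kap -> exists2 eps : R, 0 < eps &
  forall (lam z0 : R[i]) (r : R) n, 0 <= r -> expanding_upto lam b z0 n ->
    normc (iter_deriv lam z0 n) * r <= eps ->
    forall j, (j <= n)%N -> affine_on lam z0 r kap j.+1.
Proof.
move=> b1 k0.
(* The solution of c = c / b + 28. As |D_(j+1)| >= b |D_j|, the exponent c |D_j| r plus the
   increment 28 |D_(j+1)| r is at most c |D_(j+1)| r. *)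
pose c := 28 * b / (b - 1).
have c0 : 28 < c by rewrite /c ltr_pdivlMr; lra.
pose l := ln (1 + Num.min kap 1).
have m0 : 0 < Num.min kap 1 by rewrite lt_min k0 ltr01.
have l0 : 0 < l by rewrite ln_gt0// ltrDl.
have el : expR l = 1 + Num.min kap 1 by rewrite lnK// posrE; lra.
(* The bound 1/8 is what [affine_on_step] asks for; l / c keeps the error e^(c |D_n| r) - 1 below
   both [kap] and 1. *)
exists (Num.min (1/8) (l / c)).
  by rewrite lt_min divr_gt0// divr_gt0//; lra.
move=> lam z0 r n r0 hb; rewrite le_min => /andP[h1 h2].
have mono j : (j <= n)%N -> normc (iter_deriv lam z0 j) * r <= normc (iter_deriv lam z0 n) * r.
  by move=> jn; rewrite ler_wpM2r// (iter_deriv_mono (ltW b1) jn).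
have small j : (j <= n)%N -> c * (normc (iter_deriv lam z0 j) * r) <= l.
  move=> /mono h; move: h2; rewrite ler_pdivlMr; last by lra.
  by move=> h3; rewrite mulrC; apply: le_trans h3; rewrite ler_wpM2r//; lra.
have le2 j : (j <= n)%N -> expR (c * (normc (iter_deriv lam z0 j) * r)) - 1 <= Num.min kap 1.
  by move=> /small; rewrite -ler_expR el; lra.
have main j : (j <= n)%N ->
    affine_on lam z0 r (expR (c * (normc (iter_deriv lam z0 j) * r)) - 1) j.+1.
  elim: j => [|j IH] jn.
    have := @affine_on_step _ lam z0 r 0 0; rewrite expR0 subrr iter_deriv0 normc1 !mul1r.
    move=> /(_ ler01); have r8 : r <= 8^-1.
      apply: le_trans (_ : 1 / 8 <= _); last by rewrite mul1r.
      by apply: le_trans h1; rewrite -[leLHS]mul1r -(normc1 R) -(iter_deriv0 lam z0) mono.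
    move=> /(_ r8) H z w hz hw.
    have [|//|//|u hu E] := H _ z w.
      by move=> z' w' _ _; exists 1; rewrite ?subrr ?normc0// iter_deriv0 !mul1r mulr1.
    by exists u => //; apply: le_trans hu _; rewrite lerD2r ler_expR; nra.
  have IHj := IH (ltnW jn).
  have h8 := le_trans (mono _ jn) h1.
  move=> z w hz hw.
  have S1 : expR (c * (normc (iter_deriv lam z0 j) * r)) - 1 <= 1.
    by apply: le_trans (le2 _ (ltnW jn)) _; rewrite ge_min lexx orbT.
  have [u hu E] := affine_on_step S1 h8 IHj hz hw.
  exists u => //; apply: le_trans hu _; rewrite lerD2r ler_expR.
  have : b * normc (iter_deriv lam z0 j) <= normc (iter_deriv lam z0 j.+1).
    rewrite normc_iter_derivS mulrC ler_wpM2l ?normc_ge0//.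
    by apply: hb; rewrite jn.
  move=> /(ler_wpM2r r0); set x := normc _ * r; set y := normc _ in h8 *.
  rewrite -mulrA => hx.
  have -> : c = (c / b) * b by field; lra.
  have cE : c / b * b = c / b + 28 by rewrite /c; field; apply/andP; split; lra.
  have cb : 0 <= c / b by rewrite divr_ge0; lra.
  have := ler_wpM2l cb hx; rewrite -/x mulrA.
  move=> h3.
  by rewrite [leRHS](_ : _ = c / b * (y * r) + 28 * (y * r)) ?lerD2r// cE mulrDl.
move=> j jn z w hz hw; have [u hu E] := main _ jn z w hz hw.
exists u => //; apply: le_trans hu (le_trans (le2 _ jn) _).
by rewrite ge_min lexx.
Qed.
End Distortion.

(** * Counting grid cells on which a cosine is not very negative *)

Section CountingOnALine.
Context {R : realType}.
Implicit Types x y u t : R.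

Lemma cosD2piz x (k : int) : cos (x + pi *+ 2 * k%:~R) = cos x.
Proof.
have H n y : cos (y + pi *+ 2 * n%:R) = cos y by rewrite mulr_natr (periodicn (@cosD2pi R)).
case: k => n; first exact: H.
by rewrite NegzE mulrNz mulrN -(H n.+1 (x - _)) subrK.
Qed.

Lemma cos_lt_outside (s g : R) : 0 <= s <= pi / 2 ->
  pi / 2 + s < g < 3 * pi / 2 - s -> cos g < - sin s.
Proof.
move=> /andP[s0 s1] /andP[g1 g2].
rewrite -(subrK pi g) cosDpi ltrN2 -cos_norm -cosBpihalf -(cosN (s - _)) opprB.
have g3 : `|g - pi| < pi / 2 - s by rewrite ltr_norml; apply/andP; split; lra.
have pi0 := @pi_gt0 R.
by rewrite ltr_cos// in_itv/=; apply/andP; split; rewrite ?normr_ge0//; lra.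
Qed.

Definition floor_period (P x : R) : R := (Num.floor (x / P))%:~R.

Lemma floor_periodP (P x : R) : 0 < P ->
  P * floor_period P x <= x < P * floor_period P x + P.
Proof.
move=> P0; have /andP[h1 h2] := floor_itv (x / P).
rewrite /floor_period mulrC -ler_pdivlMr// h1 /=.
by move: h2; rewrite intrD ltr_pdivrMr// mulrDl mul1r.
Qed.

Lemma floor_period_le (P x y : R) : 0 < P -> x <= y -> floor_period P x <= floor_period P y.
Proof. by move=> P0 xy; rewrite ler_int le_floor// ler_pM2r ?invr_gt0. Qed.

Lemma floor_period_lt (P x y : R) : floor_period P x < floor_period P y ->
  floor_period P x + 1 <= floor_period P y.
Proof. by rewrite /floor_period ltr_int -lezD1 -(ler_int R) intrD. Qed.

(* A primitive of the indicator of [0, w] + P Z. *)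
Definition window (P w x : R) : R :=
  w * floor_period P x + Num.min (x - P * floor_period P x) w.

Lemma window_le (P w x y : R) : 0 < w -> 0 < P -> x <= y -> window P w x <= window P w y.
Proof.
move=> w0 P0 xy; have := floor_period_le P0 xy; rewrite le_eqVlt => /orP[/eqP|] h.
  by rewrite /window h lerD2l le_min2// lerD2r.
have h1 := floor_period_lt h; have /andP[h2 _] := floor_periodP y P0.
apply: (@le_trans _ _ (w * (floor_period P x + 1))).
  by rewrite /window mulrDr mulr1 lerD2l ge_min lexx orbT.
apply: (@le_trans _ _ (w * floor_period P y)); first by rewrite ler_pM2l.
by rewrite /window lerDl le_min subr_ge0 h2 ltW.
Qed.

Lemma window_bounds (P w x : R) : 0 < w -> w < P ->
  w / P * x <= window P w x <= w / P * x + w.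
Proof.
move=> w0 wP; have P0 := lt_trans w0 wP.
have /andP[h1 h2] := floor_periodP x P0.
have Ex : w / P * x = w * floor_period P x + w / P * (x - P * floor_period P x).
  by field; rewrite gt_eqF.
rewrite Ex /window -addrA !lerD2l; set f := x - _ in h1 *.
have f0 : 0 <= f by rewrite subr_ge0.
have fP : f <= P by rewrite /f; lra.
have q0 : 0 <= w / P by rewrite divr_ge0 ?ltW.
have q1 : w / P <= 1 by rewrite ler_pdivrMr// mul1r ltW.
rewrite le_min ler_piMl//= ; apply/andP; split.
  by rewrite -[leRHS](divfK (lt0r_neq0 P0)) ler_wpM2l.
by rewrite ge_min lerDr mulr_ge0// orbT.
Qed.

(** A step of length at most a that starts in the window of width w stays in the window of width w +
    a, so the primitive of the wider window records the whole step. *)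
Lemma window_local (P w a x d : R) : 0 < w -> 0 <= d <= a -> w + a < P ->
  x - P * floor_period P x <= w -> d <= window P (w + a) (x + d) - window P (w + a) x.
Proof.
move=> w0 /andP[d0 da] waP hx; have P0 : 0 < P by lra.
have /andP[h1 h2] := floor_periodP x P0.
have /andP[h3 h4] := floor_periodP (x + d) P0.
have := floor_period_le P0 (_ : x <= x + d); rewrite lerDl => /(_ d0).
rewrite le_eqVlt => /orP[/eqP|] h.
  rewrite /window -h !min_l; lra.
have := floor_period_lt h; rewrite -(ler_pM2l P0) mulrDr mulr1; lra.
Qed.

(** Only indices below M - 1 are counted, since the last one has no successor to produce an
    increment. *)
Lemma count_le_telescope (F u : nat -> R) (p : pred nat) (a : R) M :
  (forall i, (i.+1 < M)%N -> p i -> a <= F i.+1 - F i) ->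
  (forall i, (i.+1 < M)%N -> F i <= F i.+1) ->
  a * (count p (iota 0 M.-1))%:R <= F M.-1 - F 0.
Proof.
case: M => [|M] h1 h2 /=; first by rewrite mulr0 subrr.
have : forall m, (m <= M)%N -> a * (count p (iota 0 m))%:R <= F m - F 0.
  elim=> [|m IH] mM; first by rewrite mulr0 subrr.
  rewrite -addn1 iotaD count_cat natrD mulrDr /= add0n addn0 addn1.
  have := IH (ltnW mM); case: (boolP (p m)) => hp; last first.
    by rewrite mulr0; have := h2 m mM; lra.
  by rewrite mulr1; have := h1 m mM hp; lra.
exact.
Qed.

End CountingOnALine.

Section HalfCount.
Context {R : realType}.

(** Modulo 2 pi, the phase shifted by pi/2 + d must lie in [0, pi + 2d]. Each such index moves the
    window primitive by at least (1 - d) a, while this primitive has mean slope w / P <= 1/2 + 2d.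
    The condition 17 / d <= a M provides enough periods for the boundary term w to be negligible; 13
    d absorbs all errors. *)
Lemma count_half_line (d : R) : 0 < d <= 1 / 16 ->
  forall (u : nat -> R) (t a : R) M, 0 < a <= d -> 17 / d <= a * M%:R ->
    (forall i, (i.+1 < M)%N -> (1 - d) * a <= u i.+1 - u i <= (1 + d) * a) ->
    (count (fun i => - sin d <= cos (u i + t)) (iota 0 M))%:R <= (1 / 2 + 13 * d) * M%:R.
Proof.
move=> /andP[d0 d1] u t a M /andP[a0 ad] hM hu.
have pi2 := @pi_ge2 R; have pi4 : pi < 4 :> R by have := @pihalf_lt2 R; lra.
have M0 : (0 < M)%N.
  case: M hM {hu} => // h; exfalso; move: h; rewrite mulr0 leNgt divr_gt0//.
pose P : R := pi *+ 2; have EP : P = 2 * pi by rewrite /P mulr2n; ring.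
pose w0 : R := pi + 2 * d; pose w : R := w0 + (1 + d) * a.
have wb : w <= pi + 4 * d by rewrite /w /w0; nra.
have wa : 0 < (1 + d) * a by rewrite mulr_gt0//; lra.
have w00 : 0 < w0 by rewrite /w0; lra.
have w1 : 0 < w by rewrite addr_gt0.
have wP : w < P by rewrite EP; lra.
have P0 : 0 < P by lra.
pose x i := u i + t + pi / 2 + d.
set p := fun i => _.
have step i : (i.+1 < M)%N -> p i -> (1 - d) * a <= window P w (x i.+1) - window P w (x i).
  move=> iM hp; have /andP[h1 h2] := hu i iM.
  have -> : x i.+1 = x i + (u i.+1 - u i) by rewrite /x; ring.
  apply: le_trans h1 _; apply: window_local => //.
    by rewrite h2 andbT; have := hu i iM; nra.
  have /andP[h3 h4] := floor_periodP (x i) P0.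
  rewrite leNgt; apply/negP => h5.
  have : cos (x i - P * floor_period P (x i) - pi / 2 - d) < - sin d.
    apply: cos_lt_outside; first by apply/andP; split; lra.
    rewrite /w0 in h5; rewrite EP in h4 h5 *; apply/andP; split; lra.
  have -> : x i - P * floor_period P (x i) - pi / 2 - d =
            (u i + t) + pi *+ 2 * (- Num.floor (x i / P))%:~R.
    by rewrite /floor_period mulrNz -/P {1}/x; ring.
  by rewrite cosD2piz ltNge; move: hp; rewrite /p => ->.
have mono i : (i.+1 < M)%N -> window P w (x i) <= window P w (x i.+1).
  move=> iM; apply: window_le => //; rewrite /x !lerD2r.
  have da0 : 0 <= (1 - d) * a by rewrite mulr_ge0//; lra.
  by have /andP[h1 _] := hu i iM; lra.
have := @count_le_telescope _ (fun i => window P w (x i)) x p ((1 - d) * a) M step mono.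
have lin m : (m < M)%N -> x m - x 0 <= (1 + d) * a * m%:R.
  elim: m => [|m IH] mM; first by rewrite subrr mulr0.
  rewrite -addn1 natrD mulrDr mulr1; have := IH (ltnW mM).
  have /andP[_ h2] := hu m mM; rewrite addn1 /x; lra.
have MM : M.-1.+1 = M by rewrite prednK.
have := lin M.-1; rewrite MM leqnn => /(_ isT) hl.
have /andP[b1 _] := window_bounds (x 0) w1 wP.
have /andP[_ b2] := window_bounds (x M.-1) w1 wP.
(* The last index, missed by the telescoping sum, costs at most 1. *)
have cM : (count p (iota 0 M) <= count p (iota 0 M.-1) + 1)%N.
  by rewrite -{1}MM -addn1 iotaD count_cat leq_add2l /= addn0; case: (p _).
move: cM; rewrite -(ler_nat R) natrD => cM h.
apply: le_trans cM _.
set c := (count p _)%:R in h *.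
have q0 : 0 <= w / P by rewrite divr_ge0 ?ltW.
have qb : w / P <= 1 / 2 + 2 * d by rewrite ler_pdivrMr// EP; nra.
have M1 : (M.-1%:R : R) <= M%:R by rewrite ler_nat leq_pred.
have h6 : (1 - d) * a * c <= w / P * ((1 + d) * a * M%:R) + w.
  apply: le_trans h _.
  have : w / P * (x M.-1 - x 0) <= w / P * ((1 + d) * a * M%:R).
    by rewrite ler_wpM2l// (le_trans hl)// ler_wpM2l// ltW.
  lra.
have Mr0 : 0 < M%:R :> R by rewrite ltr0n.
have h7 : 17 <= d * a * M%:R by move: hM; rewrite ler_pdivrMr//; nra.
have h8 : w + (1 - d) * a <= d * a * M%:R * (1/2).
  by apply: le_trans (_ : 17/2 <= _); nra.
rewrite -(@ler_pM2l _ ((1 - d) * a)); last by rewrite mulr_gt0//; lra.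
rewrite mulrDr mulr1.
have aM : 0 < a * M%:R by rewrite mulr_gt0.
have h9 : w / P * ((1 + d) * a * M%:R) <= (1 / 2 + 2 * d) * ((1 + d) * (a * M%:R)).
  by rewrite -(mulrA (1 + d)) ler_wpM2r// mulr_ge0 ?ltW//; lra.
set y := a * M%:R in aM h9; rewrite -!(mulrA _ a) -/y in h6 h8 h9.
apply: (@le_trans _ _ ((1 / 2 + 2 * d) * ((1 + d) * y) + d * y * (1/2))).
  by move: h6 h8 h9; rewrite -!mulrA -/y; lra.
have -> : (1 - d) * a * ((1 / 2 + 13 * d) * M%:R) = (1 - d) * (1 / 2 + 13 * d) * y.
  by rewrite /y; ring.
by nra.
Qed.

End HalfCount.

Section Grids.
Context {R : realType}.
Implicit Types (c z w : R[i]) (r : R).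

(** Here [r] is half the side length. *)
Definition in_square c r z : bool :=
  (`|complex.Re z - complex.Re c| <= r) && (`|complex.Im z - complex.Im c| <= r).

(** Midpoint of the i-th of the M equal parts of [-r, r]; each part has half length r / M. *)
Definition grid_coord r M i : R := ((2 * i%:R + 1) / M%:R - 1) * r.

Definition grid_center c r M i j : R[i] :=
  c + (grid_coord r M i +i* grid_coord r M j).

Lemma grid_coordS r M i : grid_coord r M i.+1 - grid_coord r M i = 2 * r / M%:R.
Proof. by rewrite /grid_coord -natr1; ring. Qed.

Lemma grid_coord_bound r M i : 0 <= r -> (i < M)%N -> `|grid_coord r M i| <= r - r / M%:R.
Proof.
move=> r0 iM; have M0 : 0 < M%:R :> R by rewrite ltr0n (leq_ltn_trans _ iM).
have iM1 : i%:R + 1 <= M%:R :> R by rewrite natr1 ler_nat.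
have i0 : 0 <= i%:R :> R by [].
have -> : r - r / M%:R = (1 - 1 / M%:R) * r by ring.
rewrite /grid_coord normrM (ger0_norm r0) ler_wpM2r// ler_norml.
have -> : - (1 - 1 / M%:R) = 1 / M%:R - 1 :> R by ring.
rewrite lerD2r ler_pM2r ?invr_gt0//; apply/andP; split; first by lra.
have q0 : 0 < M%:R^-1 :> R by rewrite invr_gt0.
have := mulVf (lt0r_neq0 M0); move: q0 iM1; set q := _^-1; set m := M%:R; nra.
Qed.

Lemma grid_coord_cover r M (x : R) : 0 < r -> (0 < M)%N -> `|x| <= r ->
  exists2 i, (i < M)%N & `|x - grid_coord r M i| <= r / M%:R.
Proof.
move=> r0 M0; rewrite ler_norml => /andP[x1 x2].
have Mr : 0 < M%:R :> R by rewrite ltr0n.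
pose y : R := (x / r + 1) * M%:R / 2.
have Ex : x = (2 * y / M%:R - 1) * r by rewrite /y; field; rewrite !gt_eqF.
have y0 : 0 <= y.
  rewrite /y !mulr_ge0//; have : -1 <= x / r by rewrite ler_pdivlMr// mulN1r.
  lra.
have yM : y <= M%:R.
  rewrite /y ler_pdivrMr// mulrC ler_wpM2l//.
  by have : x / r <= 1 by [rewrite ler_pdivrMr// mul1r]; lra.
have key i : i%:R <= y <= i%:R + 1 -> `|x - grid_coord r M i| <= r / M%:R.
  move=> /andP[h1 h2]; rewrite Ex /grid_coord.
  have -> : (2 * y / M%:R - 1) * r - ((2 * i%:R + 1) / M%:R - 1) * r =
    (2 * (y - i%:R) - 1) * (r / M%:R) by ring.
  have rM : 0 <= r / M%:R by rewrite divr_ge0// ltW.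
  by rewrite normrM (ger0_norm rM) ler_piMl// ler_norml; apply/andP; split; lra.
have [yM'|yM'] := ltP y M%:R.
  have /andP[h1 h2] := truncn_itv y0.
  exists (Num.truncn y); last by apply: key; rewrite h1 natr1 ltW.
  by rewrite -(ltr_nat R) (le_lt_trans h1).
exists M.-1; first by rewrite prednK.
by apply: key; rewrite natr1 prednK// yM andbT (le_trans _ yM')// ler_nat leq_pred.
Qed.

Lemma in_square_center c r : 0 <= r -> in_square c r c.
Proof. by move=> r0; rewrite /in_square !subrr normr0 r0. Qed.

Lemma in_square_normc c r z : in_square c r z -> normc (z - c) <= 2 * r.
Proof.
move=> /andP[h1 h2]; apply: le_trans (normc_leD _) _.
by rewrite ReB ImB; lra.
Qed.

Lemma in_square_dist c r z w : in_square c r z -> in_square c r w -> normc (z - w) <= 4 * r.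
Proof.
move=> /in_square_normc hz /in_square_normc hw.
by apply: le_trans (normc_distD z c w) _; rewrite (normc_distC c); lra.
Qed.

Lemma normc_in_square c r z : normc (z - c) <= r -> in_square c r z.
Proof.
move=> h; rewrite /in_square -ReB -ImB.
by rewrite (le_trans (ler_Re_normc _) h) (le_trans (ler_Im_normc _) h).
Qed.

Lemma subgrid_square c r M i j z : 0 <= r -> (i < M)%N -> (j < M)%N ->
  in_square (grid_center c r M i j) (r / M%:R) z -> in_square c r z.
Proof.
move=> r0 iM jM /andP[h1 h2]; apply/andP; split.
  have := ler_normD (complex.Re z - complex.Re (grid_center c r M i j)) (grid_coord r M i).
  rewrite /grid_center in h1 *; rewrite ReD /= opprD addrA subrK.
  have := grid_coord_bound r0 iM; rewrite ReD /= opprD addrA in h1; lra.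
have := ler_normD (complex.Im z - complex.Im (grid_center c r M i j)) (grid_coord r M j).
rewrite /grid_center in h2 *; rewrite ImD /= opprD addrA subrK.
have := grid_coord_bound r0 jM; rewrite ImD /= opprD addrA in h2; lra.
Qed.

Lemma grid_center_in_square c r M i j : 0 <= r -> (i < M)%N -> (j < M)%N ->
  in_square c r (grid_center c r M i j).
Proof.
move=> r0 iM jM; apply: (subgrid_square r0 iM jM); apply: in_square_center.
by rewrite divr_ge0.
Qed.

Lemma grid_cover c r M z : 0 < r -> (0 < M)%N -> in_square c r z ->
  exists i j, [/\ (i < M)%N, (j < M)%N & in_square (grid_center c r M i j) (r / M%:R) z].
Proof.
move=> r0 M0 /andP[h1 h2].
have [i iM hi] := grid_coord_cover r0 M0 h1.
have [j jM hj] := grid_coord_cover r0 M0 h2.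
exists i, j; split => //; rewrite /in_square /grid_center ReD ImD /= !opprD !addrA.
by rewrite hi hj.
Qed.

Definition count2 (p : nat -> nat -> bool) M : nat :=
  \sum_(0 <= i < M) count (p i) (iota 0 M).

Lemma count2C p M : count2 p M = count2 (fun i j => p j i) M.
Proof.
rewrite /count2; under eq_bigr do rewrite -sum1_count big_mkcond /=.
by rewrite exchange_big /= /index_iota subn0; under eq_bigr do rewrite -big_mkcond sum1_count.
Qed.

Lemma count2_le p M (B : R) : (forall i, (i < M)%N -> (count (p i) (iota 0 M))%:R <= B) ->
  (count2 p M)%:R <= B * M%:R.
Proof.
move=> h; rewrite /count2 natr_sum.
apply: le_trans (_ : \sum_(0 <= i < M) B <= _).
  by rewrite big_nat [leRHS]big_nat ler_sum// => i /andP[_]; exact: h.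
by rewrite sumr_const_nat subn0 mulr_natr.
Qed.

(** The lower bound on r |D| makes Im f run through many periods along each line; the upper bound
    relative to M makes one grid step move the phase by at most d. These are the two requirements of
    [count_half_line]. *)
Lemma count_half_grid (d : R) : 0 < d <= 1 / 16 ->
  forall (f : R[i] -> R[i]) D c r M (t : R), 0 < r ->
    (forall z w, in_square c r z -> in_square c r w ->
       exists2 u, normc (u - 1) <= d / 2 & f z - f w = D * (z - w) * u) ->
    17 / d <= r * normc D -> 2 * r * normc D <= d * M%:R ->
  (count2 (fun i j => - sin d <= cos (complex.Im (f (grid_center c r M i j)) + t)) M)%:R
    <= (1 / 2 + 13 * d) * M%:R ^+ 2.
Proof.
move=> hd f D c r M t r0 hf h1 h2; have /andP[d0 d1] := hd.
have D0 : 0 < normc D.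
  rewrite -(pmulr_rgt0 _ r0); apply: lt_le_trans h1; by rewrite divr_gt0.
have M0 : 0 < M%:R :> R.
  by rewrite -(pmulr_rgt0 _ d0); apply: lt_le_trans h2; rewrite !mulr_gt0.
have stepM : 0 < 2 * r / M%:R by rewrite divr_gt0// mulr_gt0.
(* One of the two coordinate directions changes the imaginary part at a
   definite rate; count along it. *)
have line (g : nat -> R[i]) (A : R) : normc D / 2 <= `|A| -> `|A| <= normc D ->
    (forall i, (i.+1 < M)%N -> exists2 e, `|e| <= normc D * (d / 2) &
      complex.Im (f (g i.+1)) - complex.Im (f (g i)) = 2 * r / M%:R * (A + e)) ->
    (count (fun i => - sin d <= cos (complex.Im (f (g i)) + t)) (iota 0 M))%:R
      <= (1 / 2 + 13 * d) * M%:R.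
  move=> hA hA' hg.
  (* Cosine is even, so the phase may be reversed to become increasing. *)
  pose s : R := if 0 <= A then 1 else -1.
  have sA : s * A = `|A|.
    rewrite /s; case: ifP => [A0|/negbT]; first by rewrite mul1r ger0_norm.
    by rewrite -ltNge => A0; rewrite mulN1r ltr0_norm.
  have s1 : `|s| = 1 by rewrite /s; case: ifP; rewrite ?normrN normr1.
  have -> : count (fun i => - sin d <= cos (complex.Im (f (g i)) + t)) (iota 0 M) =
     count (fun i => - sin d <= cos (s * complex.Im (f (g i)) + s * t)) (iota 0 M).
    apply: eq_count => i /=; rewrite -mulrDr /s; case: ifP => _; first by rewrite mul1r.
    by rewrite mulN1r cosN.
  apply: (@count_half_line _ d hd (fun i => s * complex.Im (f (g i))) (s * t)
    (2 * r / M%:R * `|A|)).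
  - have A0 : 0 < `|A| by apply: lt_le_trans hA; rewrite divr_gt0.
    rewrite mulr_gt0//= mulrAC ler_pdivrMr//.
    by apply: le_trans h2; rewrite ler_wpM2l// mulr_ge0// ltW.
  - rewrite mulrAC mulfVK ?gt_eqF//; apply: le_trans h1 _; nra.
  move=> i iM; have [e he E] := hg i iM.
  rewrite -mulrBr E.
  have -> : s * (2 * r / M%:R * (A + e)) = 2 * r / M%:R * (`|A| + s * e).
    by rewrite -sA; ring.
  have : `|s * e| <= d * `|A|.
    by rewrite normrM s1 mul1r; apply: le_trans he _; nra.
  rewrite ler_norml => /andP[e1 e2].
  rewrite (mulrCA (1 - d)) (mulrCA (1 + d)) !ler_pM2l//.
  by apply/andP; split; lra.
have inc z w : in_square c r z -> in_square c r w -> exists2 u, normc (u - 1) <= d / 2 &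
   f z - f w = (z - w) * (D + D * (u - 1)).
  by move=> hz hw; have [u hu E] := hf z w hz hw; exists u => //; rewrite E; ring.
have hDu u : normc (u - 1) <= d / 2 -> normc (D * (u - 1)) <= normc D * (d / 2).
  by move=> hu; rewrite normcM ler_wpM2l// ltW.
have r0' := ltW r0.
(* A horizontal step multiplies D by a real number and moves Im f at rate Im D; a vertical step
   multiplies it by an imaginary one and gives rate Re D. One of the two is at least |D| / 2. *)
have [hI|hI] := leP (normc D / 2) `|complex.Im D|.
- rewrite count2C expr2 mulrA; apply: count2_le => j jM.
  apply: (line (fun i => grid_center c r M i j) _ hI (ler_Im_normc _)) => i iM.
  have [u hu E] := inc _ _ (grid_center_in_square c r0' iM jM)
    (grid_center_in_square c r0' (ltnW iM) jM).
  exists (complex.Im (D * (u - 1))).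
    by apply: le_trans (ler_Im_normc _) (hDu _ hu).
  rewrite -ImB E -ImD.
  have -> : grid_center c r M i.+1 j - grid_center c r M i j = (2 * r / M%:R)%:C.
    rewrite /grid_center opprD addrACA subrr add0r -(grid_coordS r M i).
    by congr (_ +i* _); rewrite subrr.
  by case: (D + _) => x y /=; rewrite mul0r addr0.
- rewrite expr2 mulrA; apply: count2_le => i iM.
  have hR : normc D / 2 <= `|complex.Re D| by have := normc_leD D; lra.
  apply: (line (fun j => grid_center c r M i j) _ hR (ler_Re_normc _)) => j jM.
  have [u hu E] := inc _ _ (grid_center_in_square c r0' iM jM)
    (grid_center_in_square c r0' iM (ltnW jM)).
  exists (complex.Re (D * (u - 1))).
    by apply: le_trans (ler_Re_normc _) (hDu _ hu).
  rewrite -ImB E -ReD.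
  have -> : grid_center c r M i j.+1 - grid_center c r M i j = 0 +i* (2 * r / M%:R).
    rewrite /grid_center opprD addrACA subrr add0r -(grid_coordS r M j).
    by congr (_ +i* _); rewrite subrr.
  by case: (D + _) => x y /=; rewrite mul0r add0r.
Qed.

End Grids.

(** * Neighbourhoods and derivatives in the complex plane *)

Section ComplexTopology.
Context {R : realType}.

(** The norm on [R[i]] takes values in [R[i]], so radii of balls are complex; being positive forces
    them to be real. *)
Lemma complex_gt0P (e : R[i]) : 0 < e -> exists2 r : R, 0 < r & e = r%:C.
Proof.
case: e => x y; rewrite ltcE /= => /andP[/eqP -> x0]; by exists x.
Qed.

Lemma nbhs_cplaneP (a : cplane R) (A : set (cplane R)) :
  nbhs a A <-> exists2 d : R, 0 < d & forall z : R[i], normc (z - a) < d -> A z.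
Proof.
split.
  move=> /nbhs_ballP[e /= /complex_gt0P[r r0 ->]] h; exists r => // z hz.
  by apply: h; rewrite -ball_normE /= ltcR normc_distC.
move=> [d d0 h]; apply/nbhs_ballP; exists d%:C; first by rewrite /= ltcR.
by move=> z; rewrite -ball_normE /= ltcR normc_distC => /h.
Qed.

Lemma dnbhs_complexP (A : set R[i]) :
  (0 : (R[i] : numFieldType))^' A <-> exists2 d : R, 0 < d & forall z : R[i], z != 0 -> normc z < d -> A z.
Proof.
rewrite /dnbhs /within /=; split.
  move=> /(nbhs_cplaneP 0)[d d0 h]; exists d => // z z0 zd.
  by apply: h => //; rewrite subr0.
move=> [d d0 h]; apply/(nbhs_cplaneP 0); exists d => // z.
by rewrite subr0 => zd z0; exact: h.
Qed.

Lemma quotient_estimate (w l z : R[i]) (e : R) : z != 0 ->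
  normc (l - z^-1 * w) <= e -> normc (w - l * z) <= e * normc z.
Proof.
move=> z0 hz; have -> : w - l * z = - ((l - z^-1 * w) * z) by field.
by rewrite normc_opp normcM ler_wpM2r ?normc_ge0.
Qed.

Lemma derive1_complex (f : cplane R -> cplane R) (a l : R[i]) :
  (forall e : R, 0 < e -> exists2 d, 0 < d & forall h : R[i], h != 0 -> normc h < d ->
    normc ((f (h + a) - f a) - l * h) <= e * normc h) ->
  derive1 f a = l.
Proof.
move=> H; rewrite /derive1; apply: cvg_lim; first exact: norm_hausdorff.
apply/cvgrPdist_le => e /complex_gt0P[r r0 ->].
have [d d0 h] := H r r0.
apply/dnbhs_complexP; exists d => // z z0 zd.
rewrite /= -/(normc _) lecR.
change (normc (l - z^-1 * (f (z + a) - f a)) <= r).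
have -> : l - z^-1 * (f (z + a) - f a) = - (((f (z + a) - f a) - l * z) / z).
  by field.
by rewrite normc_opp normcM normcV ler_pdivrMr ?normc_gt0// h.
Qed.

Lemma derivable_complex (f : cplane R -> cplane R) (a : R[i]) (e : R) :
  derivable f a 1 -> 0 < e -> exists2 d, 0 < d & forall h : R[i], h != 0 -> normc h < d ->
    normc ((f (h + a) - f a) - derive1 f a * h) <= e * normc h.
Proof.
rewrite /derivable => df e0.
move: df => /cvgrPdist_le.
move=> /(_ e%:C); rewrite ltcR => /(_ e0) /dnbhs_complexP[d d0 h].
rewrite derive1E.
exists d => // z z0 zd; have := h z z0 zd.
rewrite /= -/(normc _) lecR.
rewrite (_ : z%:A = z); last exact: mulr1.
rewrite -[lim _]/('D_1 f a).
move: (f (z + a) - f a) ('D_1 f a) => w l.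
exact: quotient_estimate.
Qed.

Lemma derive1_Eexp (lam z : R[i]) : derive1 (Eexp lam) z = Eexp lam z.
Proof.
apply: derive1_complex => e e0.
pose K := normc (Eexp lam z).
have K0 : 0 <= K := normc_ge0 _.
exists (Num.min (1/2) (e / (5 * (K + 1)))).
  by rewrite lt_min !divr_gt0//; lra.
move=> h h0; rewrite lt_min => /andP[h1 h2].
suff : normc (cE lam (h + z) - cE lam z - cE lam z * h) <= e * normc h by [].
rewrite (addrC h) cED.
have -> : cE lam z * cexp h - cE lam z - cE lam z * h = cE lam z * (cexp h - 1 - h).
  by ring.
rewrite normcM; have := cexp_quad (ltW h1).
move: h2; rewrite ltr_pdivlMr; last by lra.
have := normc_ge0 h; have := normc_ge0 (cexp h - 1 - h).
rewrite -[normc (cE lam z)]/K; set N := normc h => N1 N0 h2 h3.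
apply: (@le_trans _ _ (K * (5 * N ^+ 2))); first by rewrite ler_wpM2l.
have -> : K * (5 * N ^+ 2) = (5 * K * N) * N by ring.
by rewrite ler_wpM2r//; nra.
Qed.

End ComplexTopology.

(** * Real orbits and the Koenigs function *)

Section RealOrbit.
Context {R : realType}.
Variables (l0 b x0 : R).
Hypotheses (b_gt1 : 1 < b) (fix_b : l0 * expR b = b) (x0_gt : b < x0).

Local Notation X := (fun n => iter n (fun x => l0 * expR x) x0).

Lemma expR_shift_fixpoint x : l0 * expR x = b * expR (x - b).
Proof. by rewrite -{1}fix_b -mulrA -expRD addrC subrK. Qed.

(** One step gives l0 e^x - b = b (e^(x - b) - 1) >= b (x - b). *)
Lemma real_orbit_growth n : b ^+ n * (x0 - b) <= X n - b.
Proof.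
have B1 := b_gt1; have B0 := x0_gt; elim: n => [|n IH]; first by rewrite mul1r.
have -> : X n.+1 - b = b * (expR (X n - b) - 1).
  by rewrite iterS expR_shift_fixpoint mulrBr mulr1.
rewrite exprS -mulrA ler_wpM2l//; first by lra.
by apply: le_trans IH _; rewrite lerBrDl expR_ge1Dx.
Qed.

Lemma real_orbit_gt n : b < X n.
Proof.
rewrite -subr_gt0; apply: lt_le_trans (real_orbit_growth n).
by rewrite mulr_gt0 ?exprn_gt0 ?subr_gt0// (lt_trans ltr01).
Qed.

Lemma real_orbit_leS n : X n <= X n.+1.
Proof.
have B1 := b_gt1; have h := real_orbit_gt n.
have -> : X n.+1 = b + b * (expR (X n - b) - 1).
  by rewrite iterS expR_shift_fixpoint; ring.
have := expR_ge1Dx (X n - b); nra.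
Qed.

Lemma real_orbit_mono : {homo X : m n / (m <= n)%N >-> m <= n}.
Proof. by apply: homo_leq real_orbit_leS => [//|? ? ?]; exact: le_trans. Qed.

Lemma real_orbit_unbounded A : exists N, forall n, (N <= n)%N -> A <= X n.
Proof.
have x0b : 0 < x0 - b by rewrite subr_gt0.
have [N hN] := expr_unbounded (`|A| / (x0 - b)) b_gt1; exists N => n Nn.
apply: le_trans (real_orbit_mono Nn); apply: le_trans (ler_norm _) _.
have := real_orbit_growth N; move: hN; rewrite ler_pdivrMr//.
have := b_gt1; lra.
Qed.

End RealOrbit.

Section KoenigsFunction.
Context {R : realType}.
Variables (l0 b : R) (Phi : R -> R).
Hypotheses (l0_gt0 : 0 < l0) (b_gt1 : 1 < b) (fix_b : l0 * expR b = b).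
Hypothesis PhiE : forall x, b <= x -> Phi (l0 * expR x) = b * Phi x.
(** This is what is kept of the holomorphic linearization: value 0 and derivative 1 at b, read on
    the right of b. With [PhiE] it forces Phi y to be the limit of b^n (L^n y - b), so comparisons
    of pulled-back points decide comparisons of Phi. *)
Hypothesis Phi_germ : forall e, 0 < e -> exists2 d, 0 < d &
  forall x, b <= x -> x - b < d -> `|Phi x - (x - b)| <= e * (x - b).

Local Notation L := (fun y => ln (y / l0)).

Let b_gt0 : 0 < b. Proof. exact: lt_trans b_gt1. Qed.

Let expL y : b <= y -> l0 * expR (L y) = y.
Proof.
move=> hy; have y0 : 0 < y := lt_le_trans b_gt0 hy.
by rewrite lnK ?posrE ?divr_gt0// mulrCA divff ?mulr1// gt_eqF.
Qed.

Let L_ge y : b <= y -> b <= L y.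
Proof.
move=> hy; rewrite -ler_expR -(ler_pM2l l0_gt0) fix_b expL//.
Qed.

Let EbL y : b <= y -> y = b * expR (L y - b).
Proof.
move=> hy; rewrite -[LHS](expL hy) -[X in _ = X * _]fix_b -mulrA -expRD.
by rewrite (addrC b) subrK.
Qed.

Let L_contract y : b <= y -> L y - b <= (y - b) / b.
Proof.
move=> hy; rewrite ler_pdivlMr// [in leRHS](EbL hy).
by have := expR_ge1Dx (L y - b); rewrite -(ler_pM2l b_gt0); lra.
Qed.

Let L_gt y : b < y -> b < L y.
Proof.
move=> hy; have := L_ge (ltW hy); rewrite le_eqVlt => /orP[/eqP h|//].
by have := EbL (ltW hy); rewrite -h subrr expR0 mulr1 => E; move: hy; rewrite E ltxx.
Qed.

Let itL_ge n y : b <= y -> b <= iter n L y.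
Proof. by move=> hy; elim: n => [//|n IH] /=; exact: L_ge. Qed.

Let itL_gt n y : b < y -> b < iter n L y.
Proof. by move=> hy; elim: n => [//|n IH] /=; exact: L_gt. Qed.

Let itL_small y d : b <= y -> 0 < d -> exists N, forall n, (N <= n)%N -> iter n L y - b < d.
Proof.
move=> hy d0.
have itb n : iter n L y - b <= (y - b) / b ^+ n.
  elim: n => [|n IH]; first by rewrite expr0 divr1.
  apply: le_trans (L_contract (itL_ge n hy)) _.
  by rewrite exprSr invfM mulrA ler_pM2r ?invr_gt0.
have [N hN] := expr_unbounded ((y - b) / d + 1) b_gt1.
exists N => n Nn; apply: le_lt_trans (itb n) _.
rewrite ltr_pdivrMr ?exprn_gt0// mulrC -ltr_pdivrMr//.
apply: lt_le_trans (_ : (y - b) / d + 1 <= _); first by rewrite ltrDl.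
by apply: le_trans hN _; rewrite ler_eXn2l.
Qed.

Let Phi_iter n y : b <= y -> Phi y = b ^+ n * Phi (iter n L y).
Proof.
move=> hy; elim: n => [|n ->]; first by rewrite mul1r.
by rewrite exprSr -mulrA -PhiE ?itL_ge// [iter n.+1 L y]/= expL// itL_ge.
Qed.

Let Phi_germ_ge0 u : b <= u -> 0 <= Phi u.
Proof.
move=> hu; have [d d0 hd] := Phi_germ (@ltr01 R).
have [N hN] := itL_small hu d0.
rewrite (Phi_iter N hu) mulr_ge0 ?exprn_ge0 ?(ltW b_gt0)//.
have := hd _ (itL_ge N hu) (hN N (leqnn _)); rewrite ler_norml => /andP[h _]; lra.
Qed.

(* The functional equation turns a comparison of pulled-back points near the
   fixed point into a comparison of values. *)
Lemma koenigs_compare u v c : b <= u -> b <= v -> 0 <= c ->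
  (forall n, iter n L u - b <= c * (iter n L v - b)) -> Phi u <= c * Phi v.
Proof.
move=> hu hv c0 H.
have key e : 0 < e < 1 -> (1 - e) * Phi u <= (1 + e) * (c * Phi v).
  move=> /andP[e0 e1]; have [d d0 hd] := Phi_germ e0.
  have [N hN] := itL_small hu d0; have [M hM] := itL_small hv d0.
  pose n := maxn N M.
  have := hd _ (itL_ge n hu) (hN n (leq_maxl _ _)).
  have := hd _ (itL_ge n hv) (hM n (leq_maxr _ _)).
  rewrite !ler_norml => /andP[h1 _] /andP[_ h2].
  rewrite (Phi_iter n hu) (Phi_iter n hv) (mulrCA _ (b ^+ n)) (mulrCA c) (mulrCA _ (b ^+ n)).
  rewrite ler_pM2l ?exprn_gt0//.
  have hn := H n; set x := iter n L u in h2 hn *; set y := iter n L v in h1 hn *.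
  have h3 : (1 - e) * Phi x <= (1 - e) * ((1 + e) * (x - b)) by rewrite ler_wpM2l; lra.
  have h4 : (1 + e) * (c * ((1 - e) * (y - b))) <= (1 + e) * (c * Phi y).
    by rewrite ler_pM2l ?ler_wpM2l//; lra.
  have h5 : (1 - e) * (1 + e) * (x - b) <= (1 - e) * (1 + e) * (c * (y - b)).
    by rewrite ler_pM2l// mulr_gt0; lra.
  lra.
have B0 : 0 <= c * Phi v by rewrite mulr_ge0 ?Phi_germ_ge0.
rewrite leNgt; apply/negP => AB.
set A := Phi u in key AB; set B := c * Phi v in key B0 AB.
have s0 : 0 < 2 * (A + B) by lra.
(* For this e one has e (A + B) = (A - B) / 2 < A - B, so (1 - e) A > (1 + e) B, against [key]. *)
have /key : 0 < (A - B) / (2 * (A + B)) < 1.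
  by rewrite divr_gt0 ?subr_gt0//= ltr_pdivrMr//; lra.
set e := _ / _ => he.
have : e * (A + B) = (A - B) / 2 by rewrite /e; field; lra.
lra.
Qed.

Lemma koenigs_pos y : b < y -> 0 < Phi y.
Proof.
move=> hy; have h20 : 0 < 1 / 2 :> R by lra.
have [d d0 hd] := Phi_germ h20.
have [N hN] := itL_small (ltW hy) d0.
rewrite (Phi_iter N (ltW hy)) mulr_gt0 ?exprn_gt0//.
have := hd _ (itL_ge N (ltW hy)) (hN N (leqnn _)); rewrite ler_norml => /andP[h _].
have := itL_gt N hy; lra.
Qed.

Lemma koenigs_mono u v : b <= u -> u <= v -> Phi u <= Phi v.
Proof.
move=> hu uv; rewrite -[leRHS]mul1r; apply: koenigs_compare => //.
  exact: le_trans uv.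
move=> n; rewrite mul1r lerD2r.
elim: n => [//|n IH] /=; rewrite ler_ln ?posrE ?divr_gt0//.
- by rewrite ler_pM2r ?invr_gt0.
- exact: lt_le_trans b_gt0 (itL_ge n hu).
exact: lt_le_trans b_gt0 (itL_ge n (le_trans hu uv)).
Qed.

Let L_concave u v : b <= v -> v <= u -> (L u - b) * (v - b) <= (u - b) * (L v - b).
Proof.
move=> hv vu; have hu := le_trans hv vu.
set x := L u - b; set y := L v - b.
have -> : u - b = b * (expR x - 1) by rewrite mulrBr mulr1 -EbL.
have -> : v - b = b * (expR y - 1) by rewrite mulrBr mulr1 -EbL.
have y0 : 0 <= y by rewrite subr_ge0 L_ge.
have yx : y <= x.
  have u0 := lt_le_trans b_gt0 hu; have v0 := lt_le_trans b_gt0 hv.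
  by rewrite lerD2r ler_ln ?posrE ?divr_gt0// ler_pM2r ?invr_gt0.
have ey := expR_ge0 y.
(* tangent line of exp at y, evaluated at x and at 0 *)
have h1 : expR y * (1 + (x - y)) <= expR x.
  have := expR_ge1Dx (x - y); rewrite -(ler_pM2l (expR_gt0 y)) -expRD.
  by rewrite [y + (x - y)]addrC subrK.
have h2 : expR y * (1 - y) <= 1.
  by have := expR_ge1Dx (- y); rewrite -(ler_pM2l (expR_gt0 y)) expRxMexpNx_1.
have h3 := ler_wpM2l y0 h1.
have xy0 : 0 <= x - y by rewrite subr_ge0.
have h4 := ler_wpM2l xy0 h2.
rewrite mulrCA -(mulrA b) ler_pM2l//; lra.
Qed.

(** By concavity of the logarithm ([L_concave]), each pull-back lowers the ratio of the distances to
    b, so it stays below its initial value (u - b)/(v - b); [koenigs_compare] transfers this to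
    Phi. *)
Lemma koenigs_ratio u v : b < v -> v <= u -> Phi u * (v - b) <= (u - b) * Phi v.
Proof.
move=> hv vu; have hu := le_trans (ltW hv) vu.
have vb : 0 < v - b by rewrite subr_gt0.
rewrite -ler_pdivlMr// mulrAC; apply: koenigs_compare => //; first exact: ltW.
  by rewrite divr_ge0 ?(ltW vb)// subr_ge0.
move=> n; rewrite mulrAC ler_pdivlMr//.
have iuv : iter n L v <= iter n L u.
  elim: n => [//|n IH] /=; rewrite ler_ln ?posrE ?divr_gt0//.
  - by rewrite ler_pM2r ?invr_gt0.
  - exact: lt_le_trans b_gt0 (itL_ge n (ltW hv)).
  exact: lt_le_trans b_gt0 (itL_ge n hu).
elim: n iuv => [_|n IH _]; first by rewrite mulrC.
have iuv : iter n L v <= iter n L u.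
  elim: n {IH} => [//|n IH] /=; rewrite ler_ln ?posrE ?divr_gt0//.
  - by rewrite ler_pM2r ?invr_gt0.
  - exact: lt_le_trans b_gt0 (itL_ge n (ltW hv)).
  exact: lt_le_trans b_gt0 (itL_ge n hu).
have := L_concave (itL_ge n (ltW hv)) iuv.
have /= := IH iuv; set x := iter n L u; set y := iter n L v => h1 h2.
have y0 : 0 < y - b by rewrite subr_gt0 itL_gt.
rewrite -(ler_pM2r y0).
have Ly0 : 0 <= L y - b by rewrite subr_ge0 L_ge// itL_ge// ltW.
have := ler_wpM2r Ly0 h1; have := ler_wpM2r (ltW vb) h2; lra.
Qed.

(** Phi varies slowly: one pull-back turns the factor M into the summand ln M, which is negligible
    against L x - b for large x by [koenigs_ratio]. *)
Lemma koenigs_scale M e : 1 <= M -> 0 < e ->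
  exists2 x0, b < x0 & forall x, x0 <= x -> Phi (M * x) <= (1 + e) * Phi x.
Proof.
move=> M1 e0; have M0 : 0 < M := lt_le_trans ltr01 M1.
have lM : 0 <= ln M by rewrite ln_ge0.
pose a := b + 1 + ln M / e.
have q0 : 0 <= ln M / e by rewrite divr_ge0// ltW.
have ba : b < a by rewrite /a; lra.
exists (l0 * expR a); first by rewrite -{1}fix_b ltr_pM2l// ltr_expR.
move=> x hx.
have bx : b < x by apply: lt_le_trans hx; rewrite -{1}fix_b ltr_pM2l// ltr_expR.
have x0 : 0 < x := lt_trans b_gt0 bx.
have xMx : x <= M * x by rewrite ler_peMl// ltW.
have aL : a <= L x.
  by rewrite -(expRK a) ler_ln ?posrE ?divr_gt0 ?expR_gt0// ler_pdivlMr// mulrC.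
have LM : L (M * x) = L x + ln M by rewrite -mulrA lnM ?posrE ?divr_gt0// addrC.
have bMx : b <= M * x by rewrite (le_trans (ltW bx)).
rewrite (Phi_iter 1 bMx) (Phi_iter 1 (ltW bx)) !expr1 /= mulrCA ler_pM2l// LM.
have bL : b < L x by apply: lt_le_trans aL.
have := koenigs_ratio bL (_ : L x <= L x + ln M); rewrite lerDl => /(_ lM).
have P0 := koenigs_pos bL; set y := L x in aL bL P0 * => h.
have yb : 0 < y - b by lra.
rewrite -(ler_pM2r yb); apply: le_trans h _.
rewrite mulrAC ler_pM2r//.
have : ln M <= e * (y - b).
  rewrite mulrC -ler_pdivrMr//; rewrite /a in aL; lra.
lra.
Qed.

Lemma koenigs_iter x n : b < x -> Phi (iter n (fun y => l0 * expR y) x) = b ^+ n * Phi x.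
Proof.
move=> bx; elim: n => [|n IH]; first by rewrite mul1r.
by rewrite iterS PhiE ?IH ?exprS ?mulrA// ltW// (real_orbit_gt b_gt1 fix_b).
Qed.

Lemma koenigs_unbounded A : exists2 x0, b < x0 & forall x, x0 <= x -> A <= Phi x.
Proof.
have b1 : b < b + 1 by rewrite ltrDl.
have [n hn] := expr_unbounded (A / Phi (b + 1)) b_gt1.
have itE := real_orbit_gt b_gt1 fix_b b1 n.
exists (iter n (fun y => l0 * expR y) (b + 1)) => // x hx.
apply: le_trans (koenigs_mono (ltW itE) hx).
by rewrite koenigs_iter// -ler_pdivrMr// koenigs_pos.
Qed.

End KoenigsFunction.

Section KoenigsData.
Context {R : realType}.

(** [Eexp] is its own derivative, so the multiplier at the fixed point is b itself. *)
Lemma repelling_fixpoint_real (l0 b : R) : 0 < l0 ->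
  real_repelling_fixpoint (Eexp l0%:C) b -> l0 * expR b = b /\ 1 < b.
Proof.
move=> l00 [E d1]; have Eb : l0 * expR b = b.
  by have := congr1 (@complex.Re R) E; rewrite /Eexp /cexp /= cos0 sin0 !mulr1 mul0r subr0.
split=> //; move: d1; rewrite derive1_Eexp E normc_real ger0_norm//.
by rewrite -Eb mulr_ge0 ?expR_ge0// ltW.
Qed.

Lemma koenigs_germ (l0 b : R) (Phi : R -> R) : koenigs l0 b Phi ->
  forall e, 0 < e -> exists2 d, 0 < d &
  forall x, b <= x -> x - b < d -> `|Phi x - (x - b)| <= e * (x - b).
Proof.
move=> [[V [phi [Vb dphi [phi0 phi1] _ phiPhi]]] _] e e0.
have nV := open_nbhs_nbhs Vb.
have [d1 d10 hV] := (nbhs_cplaneP _ _).1 nV.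
have Vbb : V b%:C by apply: hV; rewrite subrr normc0.
have [d2 d20 hd] := derivable_complex (dphi _ Vbb) e0.
exists (Num.min d1 d2); first by rewrite lt_min d10.
move=> x bx; rewrite lt_min => /andP[x1 x2].
have xb0 : 0 <= x - b by rewrite subr_ge0.
have nx : normc (x%:C - b%:C) = x - b.
  by rewrite -rmorphB normc_real ger0_norm.
have Vx : V x%:C by apply: hV; rewrite nx.
have [->|xnb] := eqVneq x b.
  have := phiPhi b (lexx _) Vbb; rewrite phi0 => /(congr1 (@complex.Re R)) /= <-.
  by rewrite !subrr normr0 mulr0.
have := hd (x%:C - b%:C); rewrite nx => /(_ _ x2).
rewrite subr_eq0 => H.
have {}/H : x%:C != b%:C :> R[i] by apply: contraNneq xnb => /complexI ->.
rewrite (subrK (b%:C : R[i])) (phiPhi x bx Vx) phi0 phi1.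
have -> : (Phi x)%:C - 0 - 1 * (x%:C - b%:C) = (Phi x - (x - b))%:C :> R[i].
  by rewrite subr0 mul1r !rmorphB.
by rewrite normc_real.
Qed.

End KoenigsData.

(** * Orbits in a right half plane, inverse branches and holes *)

Section ExpandingOrbits.
Context {R : realType}.

Lemma cE_diff (lam p q : R[i]) : cE lam q - cE lam p = cE lam p * (cexp (q - p) - 1).
Proof. by rewrite mulrBr mulr1 -cED (addrC p) subrK. Qed.

Theorem distortion_le (b kap : R) : 1 < b -> 0 < kap -> exists2 eps : R, 0 < eps &
  forall (lam z0 : R[i]) (r : R) n, 0 <= r -> expanding_upto lam b z0 n ->
    normc (iter_deriv lam z0 n) * r <= eps ->
    forall j, (j <= n.+1)%N -> affine_on lam z0 r kap j.
Proof.
move=> b1 k0; have [eps e0 H] := distortion b1 k0.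
exists eps => // lam z0 r n r0 hb hD [|j] jn; last exact: (H lam z0 r n).
move=> z w _ _; exists 1; first by rewrite subrr normc0 ltW.
by rewrite iter_deriv0 mul1r mulr1.
Qed.

Variables lam b : R.
(** In this section b is -ln lam, where lam e^x has derivative 1, and not the fixed point; b > 1
    means lam < 1/e. The half plane Re <= b is mapped into the closed unit disc, and to its right E
    expands. *)
Hypotheses (lam_gt0 : 0 < lam) (b_gt1 : 1 < b) (lamEb : lam * expR b = 1).

Local Notation E := (cE lam%:C).
Local Notation D := (iter_deriv lam%:C).

(** A superset of the Julia set, see [julia_right_orbit]; the upper bound covers this set
    instead. *)
Definition right_orbit (z : R[i]) : Prop := forall n, b < complex.Re (iter n E z).

Lemma Re_cE z : complex.Re (E z) = lam * (expR (complex.Re z) * cos (complex.Im z)).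
Proof. by rewrite /cE /cexp /= mul0r subr0. Qed.

Lemma normc_cE_real z : normc (E z) = lam * expR (complex.Re z).
Proof. by rewrite normc_cE normc_real gtr0_norm. Qed.

Lemma right_orbitS z : right_orbit z -> right_orbit (E z).
Proof. by move=> h n; rewrite -iterSr; exact: h. Qed.

Lemma right_orbit_iter z n : right_orbit z -> right_orbit (iter n E z).
Proof. by move=> h; elim: n => [//|n IH] /=; exact: right_orbitS. Qed.

Let Re_le (z : R[i]) : complex.Re z <= normc z.
Proof. by apply: le_trans (ler_norm _) (ler_Re_normc z). Qed.

Lemma right_orbit_expanding z n : right_orbit z -> expanding_upto lam%:C b z n.
Proof. by move=> h j _; rewrite (le_trans _ (Re_le _))// ltW. Qed.

Lemma right_orbit_cos z n : right_orbit z -> 0 < cos (complex.Im (iter n E z)).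
Proof.
move=> h; have := h n.+1; rewrite iterS Re_cE => h1.
have : 0 < lam * (expR (complex.Re (iter n E z)) * cos (complex.Im (iter n E z))).
  by rewrite (lt_trans _ h1)// (lt_trans ltr01).
by rewrite !pmulr_rgt0// expR_gt0.
Qed.

(** The preimage is z plus a difference of principal logarithms, that is, the inverse branch sending
    E z back to z. It contracts by 1 / b through [cexp_expanding], and it stays in the half plane
    because lam e^(Re w) = |w'| >= b > 1 = lam e^b. *)
Lemma pullback1 z w' : b <= complex.Re (E z) -> b <= complex.Re w' ->
  exists w, [/\ E w = w', b <= complex.Re w & b * normc (w - z) <= normc (w' - E z)].
Proof.
move=> hz hw; have B1 := b_gt1; have b0 : 0 < b by lra.
have [a1 ha1 Ea1] := clog_exists (lt_le_trans b0 hz).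
have [a2 ha2 Ea2] := clog_exists (lt_le_trans b0 hw).
exists (z + (a2 - a1)).
have ea1 : cexp a1 != 0 :> R[i] by exact: cexp_neq0.
have EE : E (z + (a2 - a1)) = w'.
  rewrite cED -Ea1 -cexpD -Ea2; congr cexp; rewrite addrC subrK//.
split=> //.
  have : b <= lam * expR (complex.Re (z + (a2 - a1))).
    by rewrite -normc_cE_real EE (le_trans hw).
  move=> h; rewrite -ler_expR -(ler_pM2l lam_gt0) lamEb; lra.
rewrite addrC addKr -Ea1 -Ea2; apply: cexp_expanding => //; first by rewrite Ea2.
by rewrite Ea1.
Qed.

Lemma pullback J z w' : right_orbit z -> b <= complex.Re w' ->
  exists w, [/\ iter J E w = w', forall i, (i <= J)%N -> b <= complex.Re (iter i E w) &
    forall i, (i <= J)%N -> b ^+ (J - i) * normc (iter i E w - iter i E z) <=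
      normc (w' - iter J E z)].
Proof.
have B1 := b_gt1; elim: J z => [|J IH] z hz hw.
  by exists w'; split => // -[]//= _; rewrite ?subn0 ?mul1r.
have [w1 [E1 R1 N1]] := IH (E z) (right_orbitS hz) hw.
have [w [Ew Rw Nw]] := pullback1 (ltW (hz 1)) (R1 0 (leq0n _)).
exists w; split.
- by rewrite iterSr Ew.
- by case=> [//|i] iJ; rewrite iterSr Ew R1.
case=> [_|i iJ]; last by rewrite !iterSr Ew subSS N1.
have := N1 0 (leq0n _); rewrite !subn0 /= -!iterSr => h.
apply: le_trans h; rewrite exprSr -mulrA ler_wpM2l ?exprn_ge0//; lra.
Qed.

(** Only |E p| is bounded, not p: increments of E from p are E p times a function of q - p, so eta
    is uniform over an unbounded set of p. *)
Lemma iter_cE_uniform k (T : R) : 0 < T -> exists2 eta, 0 < eta &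
  forall p q, normc (E p) <= T -> normc (q - p) <= eta ->
    normc (iter k E q - iter k E p) <= 1.
Proof.
elim: k T => [|k IH] T T0; first by exists 1.
have [eta e0 H] := IH (lam * expR T) (mulr_gt0 lam_gt0 (expR_gt0 T)).
exists (Num.min (1 / 2) (eta / (4 * T))).
  by rewrite lt_min !divr_gt0// mulr_gt0.
move=> p q hp; rewrite le_min => /andP[h1 h2].
rewrite !iterSr; apply: H.
  by rewrite normc_cE_real ler_pM2l// ler_expR (le_trans (Re_le _)).
rewrite cE_diff normcM.
have := cexp_sub1_le h1; move: h2; rewrite ler_pdivlMr; last by rewrite mulr_gt0.
have := normc_ge0 (q - p); have := normc_ge0 (cexp (q - p) - 1); have := normc_ge0 (E p).
set x := normc (E p) in hp *; set y := normc (q - p); set w := normc _ => x0 w0 y0 h2 h3.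
have : x * w <= T * (4 * y) by rewrite ler_pM.
lra.
Qed.

(* A pulled-back orbit converges to the given one, so the derivative controls
   the initial distance from below. *)
Lemma pullback_dist z w (X : R) j : 0 <= X -> (forall i, (i <= j)%N ->
    normc (iter i E w - iter i E z) <= X * b ^+ i) ->
  X * b ^+ j <= 1 / 2 -> 10 * X * b ^+ j <= b - 1 ->
  normc (D z j) * normc (w - z) <= 2 * normc (iter j E w - iter j E z).
Proof.
move=> X0 hX X1 X2; have B1 := b_gt1; have b10 : 0 < b - 1 by lra.
have bi i : 0 < b ^+ i by rewrite exprn_gt0//; lra.
(* It satisfies s(i+1) = s(i) + 5 X b^i, the relative loss of step i coming from [cexp_quad]. The
   bound on 10 X b^j gives s(j) <= 1/2, hence the factor 2. *)
pose s i := 5 / (b - 1) * X * b ^+ i.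
have c0 : 0 <= 5 / (b - 1) by rewrite divr_ge0//; lra.
have s0 i : 0 <= s i by rewrite /s mulr_ge0 ?(ltW (bi i))// mulr_ge0.
have key i : (i <= j)%N ->
    normc (D z i) * normc (w - z) * (1 - s i) <= normc (iter i E w - iter i E z).
  elim: i => [_|i IH ij].
    by rewrite iter_deriv0 normc1 mul1r ler_piMr ?normc_ge0// lerBlDr lerDl.
  have hi := hX i (ltnW ij).
  have bij : X * b ^+ i <= X * b ^+ j by rewrite ler_wpM2l// ler_eXn2l// ltnW.
  have di : normc (iter i E w - iter i E z) <= 1 / 2 by lra.
  have IHi := IH (ltnW ij).
  rewrite !iterS cE_diff normcM normc_iter_derivS iterS.
  have := cexp_quad di; set d := iter i E w - iter i E z in hi di IHi *.
  have := ler_normcB d (d - (cexp d - 1)).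
  have -> : d - (d - (cexp d - 1)) = cexp d - 1 by ring.
  rewrite (normc_distC d) => h1 h2.
  have h3 : normc d * (1 - 5 * (X * b ^+ i)) <= normc (cexp d - 1).
    have := ler_wpM2l (normc_ge0 d) hi; lra.
  have d0 := normc_ge0 d; have E0 := normc_ge0 (E (iter i E z)).
  have sS : s i.+1 = s i + 5 * (X * b ^+ i) by rewrite /s exprS; field; lra.
  have si0 := s0 i.
  have sj : s j <= 1 / 2 by rewrite /s -mulrA mulrAC ler_pdivrMr//; lra.
  have sij : s i.+1 <= s j by rewrite /s ler_wpM2l ?ler_eXn2l// mulr_ge0.
  set A := normc (D z i) * normc (w - z) in IHi *.
  have A0 : 0 <= A by rewrite mulr_ge0 ?normc_ge0.
  have -> : normc (D z i) * normc (E (iter i E z)) * normc (w - z) =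
            normc (E (iter i E z)) * A by rewrite /A; ring.
  rewrite -mulrA ler_wpM2l//; apply: le_trans h3.
  have q0 : 0 <= X * b ^+ i by rewrite mulr_ge0// (ltW (bi i)).
  have h4 : A * (1 - s i) * (1 - 5 * (X * b ^+ i)) <= normc d * (1 - 5 * (X * b ^+ i)).
    by rewrite ler_wpM2r//; lra.
  apply: le_trans h4; rewrite -mulrA ler_wpM2l// sS; nra.
have sj : s j <= 1 / 2 by rewrite /s -mulrA mulrAC ler_pdivrMr//; lra.
have := key j (leqnn _); have : 0 <= normc (D z j) * normc (w - z) by rewrite mulr_ge0 ?normc_ge0.
nra.
Qed.

(** A vertical move of a late iterate of z, of length at most 6, makes the next iterate negative.
    Pulled back k extra steps, the moved point becomes some v close to z. Discs of radius eta r at v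
    are carried by a nearly affine map and then by k + 1 applications of E, which are uniformly
    continuous because |E^(j+1) v| <= T + 7; so eta depends only on lam, b, eps and T. *)
Lemma fatou_hole (eps T : R) : 0 < eps -> 0 < T -> exists2 eta, 0 < eta <= 1 / 4 &
  forall z j r, right_orbit z -> 0 < r -> eps <= normc (D z j) * r <= 1 ->
    affine_on lam%:C z r 1 j -> normc (iter j.+1 E z) <= T ->
    exists2 v, normc (v - z) <= r / 4 &
      forall q, normc (q - v) <= eta * r -> ~ right_orbit q.
Proof.
move=> e0 T0; have B1 := b_gt1; have b10 : 0 < b - 1 by lra.
have b0 : 0 < b by lra.
(* With 6 >= 3 pi / 2 bounding the vertical move: 6 / b^k <= 1/2 and 60 / b^k <= b - 1 serve
   [pullback_dist], and 12 / b^k <= eps / 4 gives |v - z| <= r / 4. *)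
have [k hk] := expr_unbounded (12 + 60 / (b - 1) + 48 / eps) B1.
have q1 : 0 < 60 / (b - 1) by rewrite divr_gt0.
have q2 : 0 < 48 / eps by rewrite divr_gt0.
have bi i : 0 < b ^+ i by rewrite exprn_gt0.
have k1 : (1 <= k)%N by case: k hk => // h; exfalso; move: h; rewrite expr0; lra.
have T70 : 0 < T + 7 by lra.
have [eta' e'0 Heta] := iter_cE_uniform k.+1 T70.
exists (Num.min (1 / 4) (eta' / 2)).
  by rewrite lt_min ge_min lexx andbT !divr_gt0.
move=> z j r hz r0 /andP[hr1 hr2] haff hT.
have hzJ := right_orbit_iter (j + k) hz.
have [a ha Ea] := clog_exists (lt_trans b0 (hz (j + k).+1)).
(* The shift turns the argument of the next iterate into pi, so E w' is real and at most -b. *)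
pose w' : R[i] := iter (j + k) E z + (0 +i* (pi - complex.Im a)).
have pi4 : pi < 4 :> R by have := @pihalf_lt2 R; lra.
have pi0 := @pi_gt0 R.
have ha' : `|pi - complex.Im a| <= 6.
  by move: ha; rewrite ltr_norml => /andP[? ?]; rewrite ler_norml; apply/andP; split; lra.
have Nw : normc (w' - iter (j + k) E z) <= 6.
  by rewrite /w' addrC addKr (le_trans (normc_leD _))//= normr0 add0r.
have Rw : b <= complex.Re w' by rewrite /w' ReD /= addr0 ltW// hz.
have EwR : complex.Re (E w') <= - b.
  rewrite /w' cED -[E _]/(iter (j + k).+1 E z) -Ea -cexpD Re_cexp ReD ImD /= addr0.
  rewrite (addrC (complex.Im a)) subrK cospi mulrN1 lerN2 -normc_cexp Ea.
  exact: le_trans (ltW (hz _)) (Re_le _).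
have [v [Ev Rv Nv]] := pullback (j + k) hz Rw.
pose X := 6 / b ^+ (j + k).
have X0 : 0 <= X by rewrite divr_ge0// ltW.
have hX i : (i <= j + k)%N -> normc (iter i E v - iter i E z) <= X * b ^+ i.
  move=> ijk; have Eb : b ^+ (j + k) = b ^+ (j + k - i) * b ^+ i by rewrite -exprD subnK.
  rewrite /X mulrAC ler_pdivlMr// Eb mulrA ler_pM2r//.
  by rewrite mulrC (le_trans (Nv i ijk)).
have Xj : X * b ^+ j = 6 / b ^+ k.
  by rewrite /X exprD; field; rewrite !gt_eqF.
have Bk (y : R) : 0 < y -> y <= b ^+ k -> 6 / b ^+ k <= 6 / y.
  by move=> y0 hy; rewrite ler_pM2l// lef_pV2 ?posrE.
have X1 : X * b ^+ j <= 1 / 2.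
  rewrite Xj; apply: le_trans (Bk 12 _ _) _; lra.
have X2 : 10 * X * b ^+ j <= b - 1.
  rewrite -mulrA Xj.
  have h60 : 60 / (b - 1) <= b ^+ k by lra.
  apply: le_trans (ler_wpM2l _ (Bk _ q1 h60)) _; first by lra.
  by rewrite le_eqVlt; apply/orP; left; apply/eqP; field; lra.
have := pullback_dist X0 (fun i ij => hX i (leq_trans ij (leq_addr _ _))) X1 X2.
have := hX j (leq_addr _ _); rewrite Xj => hj hv.
have D0 : 0 < normc (D z j).
  by rewrite (iter_deriv_gt0 b0)//; exact: right_orbit_expanding.
have vz : normc (v - z) <= r / 4.
  have h48 : 48 / eps <= b ^+ k by lra.
  have := Bk _ q2 h48; have -> : 6 / (48 / eps) = eps / 8 by field; lra.
  move=> h1; rewrite -(ler_pM2l D0); apply: le_trans hv _; lra.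
exists v => // q hq0 hq.
have : complex.Re (iter (j + k).+1 E q) <= 0.
  have vr : normc (v - z) <= r by lra.
  have qr : normc (q - z) <= r.
    apply: le_trans (normc_distD q v z) _.
    have : Num.min (1 / 4) (eta' / 2) * r <= 1 / 4 * r by rewrite ler_pM2r// ge_min lexx.
    lra.
  have [u hu Eu] := haff _ _ qr vr.
  have u2 : normc u <= 2 by have := ler_normcB u 1; rewrite normc1; lra.
  have Nq : normc (iter j E q - iter j E v) <= eta'.
    rewrite Eu !normcM.
    have h1 : normc (q - v) <= eta' / 2 * r.
      by apply: le_trans hq0 _; rewrite ler_pM2r// ge_min lexx orbT.
    apply: (@le_trans _ _ (normc (D z j) * (eta' / 2 * r) * 2)).
      by rewrite ler_pM ?mulr_ge0 ?normc_ge0// ler_wpM2l// ltW.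
    have -> : normc (D z j) * (eta' / 2 * r) * 2 = eta' * (normc (D z j) * r) by field.
    by rewrite ler_piMr// ltW.
  have Ep : normc (E (iter j E v)) <= T + 7.
    have jk : (j.+1 <= j + k)%N by rewrite -addn1 leq_add2l.
    have := hX j.+1 jk; have : X * b ^+ j.+1 <= 6.
      apply: (@le_trans _ _ (X * b ^+ (j + k))).
        by rewrite ler_wpM2l// ler_eXn2l.
      by rewrite /X divfK// gt_eqF.
    have := ler_normcB (iter j.+1 E v) (iter j.+1 E z); rewrite -iterS; lra.
  have := Heta _ _ Ep Nq; rewrite -!iterD addSn (addnC k) [iter _ E v]iterS Ev.
  have := ler_Re_normc (iter (j + k).+1 E q - E w'); rewrite ReB ler_norml => /andP[_].
  lra.
by have := hq (j + k).+1; lra.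
Qed.

End ExpandingOrbits.

(** The same small increment at z is written with the derivative at z and with the one at z0; both
    correction factors lie within 1/2 of 1, so the derivatives differ by a factor of at most 3. *)
Lemma deriv_compare (R : realType) (b : R) (lam z0 z : R[i]) (r : R) k : 1 < b ->
  expanding_upto lam b z k -> affine_on lam z0 r (1 / 2) k -> normc (z - z0) < r ->
  normc (iter_deriv lam z k) <= 3 * normc (iter_deriv lam z0 k) /\
  normc (iter_deriv lam z0 k) <= 3 * normc (iter_deriv lam z k).
Proof.
move=> b_gt1 hb aff hz; have h120 : 0 < 1 / 2 :> R by rewrite divr_gt0.
have [eps e0 H] := distortion_le b_gt1 h120.
have B1 := b_gt1; have D0 : 0 < normc (iter_deriv lam z k) by apply: (iter_deriv_gt0 _ hb); lra.
pose h := Num.min (r - normc (z - z0)) (eps / normc (iter_deriv lam z k)).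
have h0 : 0 < h by rewrite lt_min subr_gt0 hz divr_gt0.
have hD : normc (iter_deriv lam z k) * h <= eps.
  by rewrite mulrC -ler_pdivlMr// ge_min lexx orbT.
have aff' := H lam z h k (ltW h0) hb hD k (leqnSn _).
have hh : normc ((z + h%:C) - z) = h.
  by rewrite addrC addKr normc_real gtr0_norm.
have [||u hu Eu] := aff' (z + h%:C) z; rewrite ?subrr ?normc0 ?hh// ?(ltW h0)//.
have [||v hv Ev] := aff (z + h%:C) z; rewrite ?(ltW hz)//.
  apply: le_trans (normc_distD _ z _) _; rewrite hh -lerBrDr ge_min lexx//.
have : normc (iter_deriv lam z k) * h * normc u = normc (iter_deriv lam z0 k) * h * normc v.
  by rewrite -hh -!normcM -Eu Ev.
have u1 := ler_normcB u 1; have u2 := ler_normcB 1 u; rewrite (normc_distC 1) in u2.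
have v1 := ler_normcB v 1; have v2 := ler_normcB 1 v; rewrite (normc_distC 1) in v2.
rewrite !normc1 in u1 u2 v1 v2.
rewrite !(mulrAC _ h) => /(mulIf (lt0r_neq0 h0)) EE.
have D1 := normc_ge0 (iter_deriv lam z0 k); have D2 := ltW D0.
have a1 : normc (iter_deriv lam z k) * (1 / 2) <= normc (iter_deriv lam z k) * normc u.
  by rewrite ler_wpM2l//; lra.
have a2 : normc (iter_deriv lam z k) * normc u <= normc (iter_deriv lam z k) * (3 / 2).
  by rewrite ler_wpM2l//; lra.
have a3 : normc (iter_deriv lam z0 k) * (1 / 2) <= normc (iter_deriv lam z0 k) * normc v.
  by rewrite ler_wpM2l//; lra.
have a4 : normc (iter_deriv lam z0 k) * normc v <= normc (iter_deriv lam z0 k) * (3 / 2).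
  by rewrite ler_wpM2l//; lra.
by split; lra.
Qed.

(** * Covers of right orbits: one refinement step and its iteration *)

Section GridCells.
Context {R : realType}.
Local Notation cell := (R[i] * R)%type.

Definition grid_cells (G : nat -> nat -> bool) c (r : R) M : seq cell :=
  [seq (grid_center c r M i j, r / M%:R) | i <- iota 0 M, j <- [seq j <- iota 0 M | G i j]].

Lemma size_grid_cells G c r M : size (grid_cells G c r M) = count2 G M.
Proof.
rewrite size_allpairs_dep /count2 sumnE big_map /index_iota subn0.
by apply: eq_bigr => i _; rewrite size_filter.
Qed.

Lemma grid_cellsP G c r M Q : Q \in grid_cells G c r M ->
  exists i j, [/\ (i < M)%N, (j < M)%N, G i j & Q = (grid_center c r M i j, r / M%:R)].
Proof.
move=> /allpairsPdep[i [j []]]; rewrite mem_iota mem_filter mem_iota !add0n.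
by move=> iM /andP[Gij jM] ->; exists i, j.
Qed.

Definition grid_hit (P : R[i] -> Prop) c (r : R) M i j :=
  `[< exists2 p, P p & in_square (grid_center c r M i j) (r / M%:R) p >].

Definition grid_hits P c r M := grid_cells (grid_hit P c r M) c r M.

End GridCells.

Section CoverStep.
Context {R : realType}.
Variables lam b : R.
Hypotheses (lam_gt0 : 0 < lam) (b_gt1 : 1 < b) (lamEb : lam * expR b = 1).

Local Notation E := (cE lam%:C).
Local Notation D := (iter_deriv lam%:C).
Local Notation P := (right_orbit lam b).

(** At a point p of a right orbit the cosine of Im E^(n+1) p is positive, since Re E^(n+2) p > 0.
    The phase varies by at most d / 2 <= sin d from p to the centre of its cell, so each cell that
    is hit counts in [count_half_grid]. The radius 5 r about z contains the whole square, of which z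
    need not be the centre. *)
Lemma half_loss (d : R) : 0 < d <= 1 / 16 -> exists2 eps, 0 < eps &
  forall c r z n, in_square c r z -> P z -> 0 < r ->
    normc (D z n) * (5 * r) <= eps -> 17 / d <= r * normc (D z n.+1) ->
    exists M, [/\ (1 < M)%N, M%:R <= 9 * r * normc (D z n.+1) / d &
      (count2 (grid_hit P c r M) M)%:R <= (1 / 2 + 13 * d) * M%:R ^+ 2].
Proof.
move=> hd; have /andP[d0 d1] := hd; have d20 : 0 < d / 2 by rewrite divr_gt0.
have [eps e0 H] := distortion_le b_gt1 d20.
exists eps => // c r z n cz Pz r0 hD hX.
have r40 : 0 <= 5 * r by rewrite mulr_ge0// ltW.
have hb : expanding_upto lam%:C b z n by exact: right_orbit_expanding.
have aff := H lam%:C z (5 * r) n r40 hb hD n.+1 (leqnn _).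
set f := iter n.+1 E in aff *; set A := D z n.+1 in hX aff *.
have A0 : 0 < normc A.
  rewrite -(pmulr_rgt0 _ r0); apply: lt_le_trans hX; by rewrite divr_gt0.
(* More than y subdivisions bring the image of a cell side, about 2 r |A| / M, below d / 4. *)
pose y := 8 * (r * normc A) / d.
have y0 : 0 <= y by rewrite !mulr_ge0 ?invr_ge0 ?(ltW d0) ?(ltW r0) ?(ltW A0).
pose M := (Num.truncn y).+1.
have M0 : (0 < M)%N by [].
have Mgt1 : (1 < M)%N.
  rewrite /M ltnS truncn_gt0 /y ler_pdivlMr// mul1r.
  by move: hX; rewrite ler_pdivrMr// => ?; nra.
have Mr : 0 < M%:R :> R by rewrite ltr0n.
have My : y < M%:R by exact: truncnS_gt.
have My1 : M%:R <= y + 1 by rewrite -natr1 lerD2r; have /andP[] := truncn_itv y0.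
have hX' : 17 <= r * normc A * d.
  by move: hX; rewrite ler_pdivrMr.
exists M; split => //.
  apply: le_trans My1 _; rewrite /y ler_pdivlMr// mulrDl mul1r divfK ?gt_eqF//.
  have rA : 0 < r * normc A by rewrite mulr_gt0.
  by nra.
have step : 2 * r * normc A <= d / 4 * M%:R.
  move/ltW: My; rewrite /y ler_pdivrMr//; lra.
have aff' z' w' : in_square c r z' -> in_square c r w' ->
    exists2 u, normc (u - 1) <= d / 2 & f z' - f w' = A * (z' - w') * u.
  move=> hz hw; apply: aff; first by apply: (le_trans (in_square_dist hz cz)); lra.
  by apply: (le_trans (in_square_dist hw cz)); lra.
apply: le_trans (_ : (count2 (fun i j =>
    - sin d <= cos (complex.Im (f (grid_center c r M i j)) + 0)) M)%:R <= _).
  rewrite ler_nat /count2 !big_nat leq_sum// => i /andP[_ iM].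
  rewrite -!size_filter; apply: uniq_leq_size; first by rewrite filter_uniq ?iota_uniq.
  move=> j; rewrite !mem_filter !mem_iota => /andP[/asboolP[p Pp hp] /andP[j0 jM]].
  rewrite j0 jM !andbT addr0.
  have hpc := subgrid_square (ltW r0) iM jM hp.
  have [u hu Eu] := aff' _ _ hpc (grid_center_in_square c (ltW r0) iM jM).
  set g := grid_center c r M i j in hp Eu *.
  have hc : 0 < cos (complex.Im (f p)) by exact: (right_orbit_cos lam_gt0 b_gt1 n.+1 Pp).
  have := cos_diff (complex.Im (f p)) (complex.Im (f g)).
  rewrite -ImB => h1; have {h1} := le_trans h1 (ler_Im_normc _).
  rewrite Eu !normcM => h2.
  have h3 : normc A * normc (p - g) <= d / 4.
    have := ler_wpM2l (ltW A0) (in_square_normc hp) => h; apply: le_trans h _.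
    have -> : normc A * (2 * (r / M%:R)) = 2 * r * normc A / M%:R by ring.
    by rewrite ler_pdivrMr.
  have u2 : normc u <= 2 by have := ler_normcB u 1; rewrite normc1; lra.
  have h4 : normc A * normc (p - g) * normc u <= d / 4 * 2.
    by rewrite ler_pM ?mulr_ge0 ?normc_ge0.
  have hs : d / 2 <= sin d by apply: sin_ge_half; lra.
  by have := ler_norm (cos (complex.Im (f p)) - cos (complex.Im (f g))); lra.
apply: (@count_half_grid _ d hd f A) => //.
by apply: (le_trans step); rewrite ler_wpM2r//; lra.
Qed.

End CoverStep.

Section SquareCovers.
Context {R : realType}.
Variables (P : R[i] -> Prop) (W : R -> R).
Local Notation square := (R[i] * R)%type.

(** Halving the sides makes iterated refinements arbitrarily fine; nesting keeps them in a bounded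
    region; the factor t is to be below 1. *)
Definition refines (t : R) (Q : square) (s : seq square) : Prop :=
  [/\ forall q, q \in s -> 0 < q.2 <= Q.2 / 2,
      forall q, q \in s -> forall z, in_square q.1 q.2 z -> in_square Q.1 Q.2 z,
      forall z, in_square Q.1 Q.2 z -> P z -> exists2 q, q \in s & in_square q.1 q.2 z &
      \sum_(q <- s) W q.2 <= t * W Q.2].

Lemma refines_seq t (L : seq square) : (forall q, q \in L -> exists s, refines t q s) ->
  exists S : seq square, [/\ forall q, q \in S -> exists2 Q, Q \in L & 0 < q.2 <= Q.2 / 2,
    forall q, q \in S -> exists2 Q, Q \in L &
      forall z, in_square q.1 q.2 z -> in_square Q.1 Q.2 z,
    forall Q z, Q \in L -> in_square Q.1 Q.2 z -> P z ->
      exists2 q, q \in S & in_square q.1 q.2 z &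
    \sum_(q <- S) W q.2 <= t * \sum_(Q <- L) W Q.2].
Proof.
elim: L => [|Q L IH] H.
  by exists [::]; split => //; rewrite !big_nil mulr0.
have [s [s1 s2 s3 s4]] := H Q (mem_head _ _).
have [|S [S1 S2 S3 S4]] := IH.
  by move=> q qL; apply: H; rewrite in_cons qL orbT.
exists (s ++ S); split.
- move=> q; rewrite mem_cat => /orP[/s1|/S1[Q' Q'L]] h; first by exists Q => //; rewrite mem_head.
  by exists Q' => //; rewrite in_cons Q'L orbT.
- move=> q; rewrite mem_cat => /orP[/s2|/S2[Q' Q'L]] h; first by exists Q => //; rewrite mem_head.
  by exists Q' => //; rewrite in_cons Q'L orbT.
- move=> Q' z; rewrite in_cons => /orP[/eqP ->|Q'L] hz Pz.
    by have [q qs hq] := s3 z hz Pz; exists q => //; rewrite mem_cat qs.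
  by have [q qs hq] := S3 Q' z Q'L hz Pz; exists q => //; rewrite mem_cat qs orbT.
by rewrite big_cat big_cons mulrDr lerD.
Qed.

Lemma grid_hits_sum c r M :
  \sum_(q <- grid_hits P c r M) W q.2 = (count2 (grid_hit P c r M) M)%:R * W (r / M%:R).
Proof.
rewrite /grid_hits /grid_cells big_allpairs_dep /=.
under eq_bigr => i _ do rewrite big_const_seq count_predT size_filter iter_addr_0.
rewrite /count2 natr_sum mulr_suml /index_iota subn0.
by apply: eq_bigr => i _; rewrite mulr_natl.
Qed.

Lemma grid_hits_cover c r M z : 0 < r -> (0 < M)%N -> in_square c r z -> P z ->
  exists2 q, q \in grid_hits P c r M & in_square q.1 q.2 z.
Proof.
move=> r0 M0 hz Pz; have [i [j [iM jM hij]]] := grid_cover r0 M0 hz.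
exists (grid_center c r M i j, r / M%:R) => //.
apply/allpairsPdep; exists i, j; rewrite mem_iota mem_filter mem_iota !add0n iM jM; split=> //.
by apply/and3P; split => //; apply/asboolP; exists z.
Qed.

Lemma grid_hits_sub c r M q : 0 <= r -> q \in grid_hits P c r M ->
  forall z, in_square q.1 q.2 z -> in_square c r z.
Proof.
by move=> r0 /grid_cellsP[i [j [iM jM _ ->]]] z; exact: subgrid_square.
Qed.

Lemma grid_hits_refines c r M t : 0 < r -> (1 < M)%N ->
  (count2 (grid_hit P c r M) M)%:R * W (r / M%:R) <= t * W r ->
  refines t (c, r) (grid_hits P c r M).
Proof.
move=> r0 M1 hW; have M0 := ltnW M1; split => /=.
- move=> q /grid_cellsP[i [j [_ _ _ ->]]] /=; rewrite divr_gt0 ?ltr0n//=.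
  by rewrite ler_pM2l// lef_pV2 ?posrE ?ltr0n// ler_nat.
- by move=> q /grid_hits_sub; apply; exact: ltW.
- by move=> z; exact: grid_hits_cover.
by rewrite grid_hits_sum.
Qed.

Lemma count2_grid_le c r M : (count2 (grid_hit P c r M) M <= M ^ 2)%N.
Proof.
rewrite -(ler_nat R) natrX expr2; apply: count2_le => i _.
by rewrite ler_nat -[X in (_ <= X)%N](size_iota 0 M) count_size.
Qed.

Lemma count2_grid_lt c r M i j : (i < M)%N -> (j < M)%N -> ~~ grid_hit P c r M i j ->
  (count2 (grid_hit P c r M) M < M ^ 2)%N.
Proof.
move=> iM jM nh.
have lt_i : (count (grid_hit P c r M i) (iota 0 M) < M)%N.
  rewrite -[X in (_ < X)%N](size_iota 0 M) ltn_neqAle count_size andbT -all_count.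
  apply/negP => /allP/(_ j); rewrite mem_iota add0n jM => /(_ isT) h.
  by rewrite h in nh.
have le_k k : (count (grid_hit P c r M k) (iota 0 M) <= M)%N.
  by rewrite -[X in (_ <= X)%N](size_iota 0 M) count_size.
rewrite /count2 big_mkord (bigD1 (Ordinal iM)) //=.
have -> : (M ^ 2 = M + \sum_(k < M | k != Ordinal iM) M)%N.
  by rewrite -mulnn -{1}(card_ord M) -sum_nat_const (bigD1 (Ordinal iM)).
by rewrite -addSn leq_add// leq_sum.
Qed.

End SquareCovers.

Section OneStep.
Context {R : realType}.
Variables lam b : R.
Hypotheses (lam_gt0 : 0 < lam) (b_gt1 : 1 < b) (lamEb : lam * expR b = 1).
Variables (Psi : R -> R) (x1 q : R).
(** [Psi] stands for a power of the Koenigs function. By [Psi_scale] a bounded subdivision costs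
    almost nothing; by [Psi_exp] a subdivision of exponential size costs at most q, and q < 2 is
    outweighed by losing half of the cells. *)
Hypothesis Psi_pos : forall x, x1 <= x -> 0 < Psi x.
Hypothesis Psi_mono : forall x y, x1 <= x -> x <= y -> Psi x <= Psi y.
Hypothesis Psi_scale : forall M e, 1 <= M -> 0 < e ->
  exists x0, forall x, x0 <= x -> Psi (M * x) <= (1 + e) * Psi x.
Hypothesis Psi_exp : forall C, 0 < C -> exists x0, forall x, x0 <= x ->
  Psi (C * x * expR (x / 2)) <= q * Psi x.
Hypothesis q_range : 0 < q < 2.

Local Notation E := (cE lam%:C).
Local Notation D := (iter_deriv lam%:C).
Local Notation P := (right_orbit lam b).

Definition weight (r : R) : R := r ^+ 2 * Psi (1 / r).
Local Notation W := weight.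

Lemma weight_grid r M : (0 < M)%N ->
  M%:R ^+ 2 * W (r / M%:R) = r ^+ 2 * Psi (M%:R * (1 / r)).
Proof.
move=> M0; have Mr : M%:R != 0 :> R by rewrite pnatr_eq0 -lt0n.
rewrite /W; have -> : 1 / (r / M%:R) = M%:R * (1 / r) by rewrite invf_div mulrA mulr1 mul1r.
by field.
Qed.

Lemma le_inv_of (r x : R) : 0 < r -> r <= 1 / (1 + `|x|) -> x <= 1 / r.
Proof.
move=> r0 hr; have p0 : 0 < 1 + `|x| by rewrite ltr_wpDr.
rewrite ler_pdivlMr//; move: hr; rewrite ler_pdivlMr// => hr.
have := ler_norm x; have := normr_ge0 x; nra.
Qed.

Lemma small_radius (x : R) : 0 < 1 / (1 + `|x|).
Proof. by rewrite divr_gt0// ltr_wpDr. Qed.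

Lemma in_square_trans c (r s : R) z v : in_square c r z -> normc (v - z) <= s ->
  in_square c (r + s) v.
Proof.
move=> /andP[a1 a2] /normc_in_square /andP[a3 a4]; apply/andP; split.
  have := ler_normD (complex.Re v - complex.Re z) (complex.Re z - complex.Re c).
  rewrite addrA subrK; lra.
have := ler_normD (complex.Im v - complex.Im z) (complex.Im z - complex.Im c).
rewrite addrA subrK; lra.
Qed.

(** With y = 1 / r, both |D_n| and |E^n z| are at most y / 2, so M / r is at most a constant times y
    e^(y/2); [Psi_exp] then bounds the growth of the gauge from r to r / M by q. *)
Lemma high_step (d : R) : 0 < d <= 1 / 16 -> exists2 eps, 0 < eps <= 1 &
  forall A, exists2 r0, 0 < r0 & forall c r z n, in_square c r z -> P z -> 0 < r <= r0 ->
    normc z <= A -> normc (D z n) * (5 * r) <= eps -> 17 / d <= r * normc (D z n.+1) ->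
    exists s, refines P W ((1 / 2 + 13 * d) * q) (c, r) s.
Proof.
move=> hd; have [eps e0 H] := half_loss lam_gt0 b_gt1 hd.
have /andP[d0 d1] := hd; have /andP[q0 q2] := q_range.
exists (Num.min eps 1); first by rewrite lt_min e0 ltr01 ge_min lexx orbT.
have C0 : 0 < 9 / d * lam by rewrite mulr_gt0// divr_gt0.
move=> A; have [x0 Hx0] := Psi_exp C0.
pose Y := Num.max x1 (Num.max x0 (2 * A)).
exists (1 / (1 + `|Y|)); first exact: small_radius.
move=> c r z n cz Pz /andP[r0 hr] zA; rewrite le_min => /andP[hD hD1] hX.
have [M [M1 hM hc]] := H c r z n cz Pz r0 hD hX.
have := le_inv_of r0 hr; rewrite !ge_max => /and3P[y1 y0 yA].
set y := 1 / r in y1 y0 yA.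
have y_gt0 : 0 < y by rewrite divr_gt0.
have yr : y * r = 1 by rewrite /y divfK// gt_eqF.
have M0 := ltnW M1.
have Mr : 0 < M%:R :> R by rewrite ltr0n.
have hb : expanding_upto lam%:C b z n by exact: right_orbit_expanding.
have B1 := b_gt1.
have Dy : normc (D z n) <= y / 5.
  by rewrite ler_pdivlMr// -(ler_pM2r r0) yr -mulrA.
(* For n = 0 this is where the bound A on the starting point enters; for n >= 1, E^n z is a factor
   of D_n and the other factors are at least 1. *)
have zny : normc (iter n E z) <= y / 2.
  case: n {hD hX hc hM hD1} hb Dy => [_ _|n hb Dy]; first by rewrite /=; lra.
  have : normc (D z 0) <= normc (D z n).
    by apply: (@iter_deriv_mono _ _ b) => //; [exact: ltW|exact: expanding_uptoW hb].
  rewrite iter_deriv0 normc1 => h1; move: Dy; rewrite normc_iter_derivS.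
  have := normc_ge0 (iter n.+1 E z); nra.
have Dn1 : normc (D z n.+1) <= y * (lam * expR (y / 2)).
  rewrite normc_iter_derivS iterS normc_cE normc_real gtr0_norm//.
  apply: ler_pM; rewrite ?normc_ge0 ?mulr_ge0 ?expR_ge0 ?(ltW lam_gt0)//; first by lra.
  rewrite ler_pM2l// ler_expR; apply: le_trans zny.
  by apply: le_trans (ler_norm _) (ler_Re_normc _).
exists (grid_hits P c r M); apply: grid_hits_refines => //.
have hPsi : Psi (M%:R * (1 / r)) <= q * Psi (1 / r).
  apply: le_trans (Hx0 _ y0); apply: Psi_mono.
    by apply: le_trans y1 _; rewrite ler_peMl ?(ltW y_gt0)// ler1n.
  rewrite -/y; apply: le_trans (ler_wpM2r (ltW y_gt0) hM) _.
  have -> : 9 * r * normc (D z n.+1) / d * y = 9 / d * normc (D z n.+1) * (y * r) by ring.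
  have -> : 9 / d * lam * y * expR (y / 2) = 9 / d * (y * (lam * expR (y / 2))) by ring.
  by rewrite yr mulr1 ler_wpM2l// divr_ge0// ltW.
have hW : 0 <= W (r / M%:R).
  rewrite mulr_ge0 ?sqr_ge0// ltW// Psi_pos// invf_div mul1r.
  apply: le_trans y1 _; rewrite ler_pdivlMr// yr ler1n//.
apply: le_trans (ler_wpM2r hW hc) _.
rewrite -[leLHS]mulrA weight_grid// -[leRHS]mulrA ler_wpM2l//; first by lra.
by rewrite /W [leRHS]mulrCA ler_wpM2l ?sqr_ge0.
Qed.

Lemma weight_ge0 r : 0 < r -> x1 <= 1 / r -> 0 <= W r.
Proof. by move=> r0 h; rewrite mulr_ge0 ?sqr_ge0// ltW// Psi_pos. Qed.

Lemma le_inv_grid r M : 0 < r -> (0 < M)%N -> x1 <= 1 / r -> x1 <= 1 / (r / M%:R).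
Proof.
move=> r0 M0 h; rewrite invf_div mul1r; apply: le_trans h _.
by rewrite ler_pM2r ?invr_gt0// ler1n.
Qed.

(* A hole of relative size eta swallows a square of a fixed grid. *)
Lemma hole_refines (eta : R) : 0 < eta <= 1 / 4 -> exists g r0, [/\ 0 < g < 1, 0 < r0 &
  forall c r v, 0 < r <= r0 -> in_square c (3 * r / 4) v ->
    (forall z, normc (z - v) <= eta * r -> ~ P z) ->
    exists s, refines P W g (c, r) s].
Proof.
move=> /andP[e0 e1].
pose M := (Num.truncn (4 / eta)).+2.
have hM : 4 / eta <= M%:R.
  by rewrite (le_trans (ltW (truncnS_gt _)))// ler_nat.
have M1 : (1 < M)%N by [].
have M0 : (0 < M)%N by [].
have Mr : 0 < M%:R :> R by rewrite ltr0n.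
(* One of the M^2 cells is dropped; half of the gain 1 - t is left to pay for the change of scale in
   Psi. *)
pose t : R := 1 - 1 / M%:R ^+ 2.
have M2 : 1 < M%:R ^+ 2 :> R by rewrite exprn_egt1// ltr1n.
have M20 : 0 < M%:R ^+ 2 :> R by lra.
have t0 : 0 < t by rewrite subr_gt0 ltr_pdivrMr// mul1r.
have t1 : t < 1 by rewrite /t ltrBlDr ltrDl divr_gt0.
have a0 : 0 < (1 - t) / 2 by lra.
have M1r : 1 <= M%:R :> R by rewrite ler1n.
have [x0 Hx0] := Psi_scale M1r a0.
pose Y := Num.max x1 x0.
exists ((1 + (1 - t) / 2) * t), (1 / (1 + `|Y|)); split; [|exact: small_radius|].
  by apply/andP; split; [rewrite mulr_gt0//; lra | nra].
move=> c r v /andP[r0 hr] hv hole.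
have := le_inv_of r0 hr; rewrite ge_max => /andP[y1 y0].
have vc : in_square c r v by case/andP: hv => h1 h2; apply/andP; split; lra.
have [i [j [iM jM hij]]] := grid_cover r0 M0 vc.
have nh : ~~ grid_hit P c r M i j.
  apply/negP => /asboolP[p Pp hp]; apply: hole Pp.
  apply: le_trans (in_square_dist hp hij) _.
  rewrite mulrA ler_pdivrMr// mulrAC ler_pM2r//.
  by move: hM; rewrite ler_pdivrMr// mulrC.
have cnt : (count2 (grid_hit P c r M) M)%:R <= t * M%:R ^+ 2.
  have := count2_grid_lt iM jM nh; rewrite -ltnS => h.
  have -> : t * M%:R ^+ 2 = M%:R ^+ 2 - 1 by rewrite /t; field; rewrite gt_eqF.
  by rewrite lerBrDr natr1 -natrX ler_nat.
exists (grid_hits P c r M); apply: grid_hits_refines => //.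
have hW : 0 <= W (r / M%:R).
  by apply: weight_ge0; rewrite ?divr_gt0// le_inv_grid.
apply: le_trans (ler_wpM2r hW cnt) _.
rewrite -[leLHS]mulrA weight_grid// [leRHS]mulrAC mulrC.
rewrite ler_pM2r// /W [leRHS]mulrCA ler_wpM2l ?sqr_ge0//.
exact: Hx0.
Qed.

Lemma refines_le (t t' : R) Q s : t <= t' -> 0 <= W Q.2 ->
  refines P W t Q s -> refines P W t' Q s.
Proof.
by move=> tt W0 [h1 h2 h3 h4]; split => //; apply: le_trans h4 _; rewrite ler_wpM2r.
Qed.

Lemma refines_nil (t : R) Q : 0 <= t -> 0 <= W Q.2 ->
  (forall z, in_square Q.1 Q.2 z -> ~ P z) -> refines P W t Q [::].
Proof.
by move=> t0 W0 H; split => //; [move=> z /H|rewrite big_nil mulr_ge0].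
Qed.

Lemma refines_bind (t t' : R) c r M : 0 < r -> (1 < M)%N -> 0 <= t -> 0 <= W (r / M%:R) ->
  M%:R ^+ 2 * W (r / M%:R) <= t' * W r ->
  (forall q, q \in grid_hits P c r M -> exists s, refines P W t q s) ->
  exists s, refines P W (t * t') (c, r) s.
Proof.
move=> r0 M1 t0 W0 hW H; have M0 := ltnW M1.
have [S [S1 S2 S3 S4]] := refines_seq H.
have rM : r / M%:R <= r by rewrite ler_pdivrMr ?ltr0n// ler_peMr ?(ltW r0)// ler1n.
exists S; split => /=.
- move=> p /S1[Q QL /andP[p0 hp]]; rewrite p0 (le_trans hp)//.
  have [i [j [_ _ _ ->]]] := grid_cellsP QL; rewrite /=; lra.
- move=> p /S2[Q QL hp] z /hp; apply: (grid_hits_sub (ltW r0) QL).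
- move=> z hz Pz; have [Q QL hQ] := grid_hits_cover r0 M0 hz Pz.
  exact: (S3 Q).
apply: le_trans S4 _; rewrite -mulrA ler_wpM2l// grid_hits_sum.
apply: le_trans hW; rewrite ler_wpM2r// -natrX ler_nat; exact: count2_grid_le.
Qed.

Lemma stopping_index z (r eps : R) : P z -> 0 < r -> r <= eps ->
  exists m, normc (D z m) * r <= eps /\ eps < normc (D z m.+1) * r.
Proof.
move=> Pz r0 re; have B1 := b_gt1; have b0 : 0 <= b by lra.
have ex : exists k, eps < normc (D z k) * r.
  have [k hk] := expr_unbounded (eps / r + 1) B1; exists k.
  rewrite -ltr_pdivrMr//.
  have hb : expanding_upto lam%:C b z (0 + k) by exact: right_orbit_expanding.
  have := iter_deriv_ge b0 hb.
  rewrite iter_deriv0 normc1 mulr1 add0n; lra.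
case: (ex_minnP ex) => -[|m] hm hmin.
  by move: hm; rewrite iter_deriv0 normc1 mul1r ltNge re.
exists m; split => //; rewrite leNgt; apply/negP => /hmin; rewrite ltnn//.
Qed.

End OneStep.

Theorem cover_step (R : realType) (lam b : R) (lam_gt0 : 0 < lam) (b_gt1 : 1 < b)
    (lamEb : lam * expR b = 1) (Psi : R -> R) (x1 q : R)
    (Psi_pos : forall x, x1 <= x -> 0 < Psi x)
    (Psi_mono : forall x y, x1 <= x -> x <= y -> Psi x <= Psi y)
    (Psi_scale : forall M e, 1 <= M -> 0 < e ->
      exists x0, forall x, x0 <= x -> Psi (M * x) <= (1 + e) * Psi x)
    (Psi_exp : forall C, 0 < C -> exists x0, forall x, x0 <= x ->
      Psi (C * x * expR (x / 2)) <= q * Psi x)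
    (q_range : 0 < q < 2) :
  exists2 t, 0 < t < 1 & forall A, exists2 r0, 0 < r0 &
  forall c r, 0 < r <= r0 -> (forall z, in_square c r z -> normc z <= A) ->
    exists s, refines (right_orbit lam b) (weight Psi) t (c, r) s.
Proof.
have /andP[q0 q2] := q_range; have B1 := b_gt1.
(* Makes 13 d q at most half of 1 - q / 2, so (1/2 + 13 d) q < 1. *)
pose d : R := Num.min (1 / 16) ((1 - q / 2) / 52).
have d0 : 0 < d by rewrite lt_min; apply/andP; split; lra.
have d1 : d <= 1 / 16 by rewrite ge_min lexx.
have d2 : d <= (1 - q / 2) / 52 by rewrite ge_min lexx orbT.
have hd : 0 < d <= 1 / 16 by rewrite d0.
pose c1 := (1 / 2 + 13 * d) * q.
have c10 : 0 < c1 by rewrite mulr_gt0//; lra.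
have c11 : c1 < 1 by rewrite /c1; nra.
have [eps1 /andP[e10 e11] Hhigh] := high_step lam_gt0 b_gt1 Psi_pos Psi_mono Psi_exp q_range hd.
have h120 : 0 < 1 / 2 :> R by lra.
have [eps2 e20 Hdist] := distortion_le b_gt1 h120.
pose eps := Num.min eps1 eps2.
have e0 : 0 < eps by rewrite lt_min e10.
have ee1 : eps <= eps1 by rewrite ge_min lexx.
have ee2 : eps <= eps2 by rewrite ge_min lexx orbT.
have el1 : eps <= 1 by lra.
(* In the bounded case |D_(m+1)| r is at most 3 * 17 / d = 51 / d on the square, so after division
   by M >= 255 / (d eps) the disc of radius 5 r / M is small enough for distortion. *)
pose M := (Num.truncn (255 / (d * eps))).+2.
have M1 : (1 < M)%N by [].
have M0 : (0 < M)%N by [].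
have Mr : 0 < M%:R :> R by rewrite ltr0n.
have M1r : 1 <= M%:R :> R by rewrite ler1n.
have hM : 255 / (d * eps) <= M%:R by rewrite (le_trans (ltW (truncnS_gt _)))// ler_nat.
(* Lower bound for |D_(m+1)| r / M: the stopping rule gives eps < 5 |D_(m+1)| r at [z0], and moving
   to another point costs a factor 3. *)
pose eh := eps / (15 * M%:R).
have eh0 : 0 < eh by rewrite divr_gt0// mulr_gt0.
(* Beyond T the next factor makes |D_(m+2)| times the half side at least 17 / d, which allows
   [high_step] one iterate later. *)
pose T := 17 / d / eh.
have T0 : 0 < T by apply: divr_gt0 => //; apply: divr_gt0.
have [eta heta Hhole] := fatou_hole lam_gt0 b_gt1 lamEb eh0 T0.
have [g [rg [/andP[g0 g1] rg0 Hg]]] := hole_refines lam b Psi_pos Psi_scale heta.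
pose m12 := Num.max c1 g.
have m0 : 0 < m12 by rewrite lt_max c10.
have m1 : m12 < 1 by rewrite gt_max c11.
have e'0 : 0 < (1 - m12) / 2 by lra.
have [x0 Hx0] := Psi_scale _ _ M1r e'0.
exists (m12 * (1 + (1 - m12) / 2)); first by clear - m0 m1; apply/andP; split; [rewrite mulr_gt0; lra|nra].
move=> A; have [rA rA0 HA] := Hhigh A.
pose Y := Num.max x1 x0.
exists (Num.min (Num.min rA rg) (Num.min (eps / 5) (1 / (1 + `|Y|)))).
  by rewrite !lt_min rA0 rg0 small_radius divr_gt0.
move=> c r /andP[r0]; rewrite !le_min => /andP[/andP[rrA rrg] /andP[re rY]] hA.
have := le_inv_of r0 rY; rewrite ge_max => /andP[y1 y0].
have Wr : 0 <= weight Psi r := weight_ge0 Psi_pos r0 y1.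
have mle : m12 <= m12 * (1 + (1 - m12) / 2) by clear - m0 m1; rewrite ler_peMr ?(ltW m0)//; lra.
have [[z0 Pz0 hz0]|noP] := pselect (exists2 z, right_orbit lam b z & in_square c r z); last first.
  by exists [::]; apply: refines_nil => //= [|z hz Pz];
    [exact: le_trans (ltW m0) mle|apply: noP; exists z].
have r50 : 0 < 5 * r by rewrite mulr_gt0.
have r5e : 5 * r <= eps by clear - re; lra.
have [m [hm hm1]] := stopping_index b_gt1 Pz0 r50 r5e.
have [hX|hX] := leP (17 / d) (r * normc (iter_deriv lam%:C z0 m.+1)).
  have rr : 0 < r <= rA by rewrite r0.
  have [s hs] := HA c r z0 m hz0 Pz0 rr (hA _ hz0) (le_trans hm ee1) hX.
  by exists s; apply: refines_le hs => //; apply: le_trans mle; rewrite le_max lexx.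
have hb : expanding_upto lam%:C b z0 m by exact: right_orbit_expanding.
have aff0 := Hdist lam%:C z0 (5 * r) m (ltW r50) hb (le_trans hm ee2) m.+1 (leqnn _).
have rM0 : 0 < r / M%:R by rewrite divr_gt0.
have rMr : r / M%:R <= r by rewrite ler_pdivrMr// ler_peMr// ltW.
have WrM : 0 <= weight Psi (r / M%:R) by apply: (weight_ge0 Psi_pos) => //; exact: le_inv_grid.
apply: (@refines_bind _ lam b Psi m12 _ c r M) => //; first exact: ltW.
  by rewrite weight_grid// [leRHS]mulrCA ler_wpM2l ?sqr_ge0// Hx0.
move=> Q /grid_cellsP[i [j [iM jM _ ->]]] /=.
set c' := grid_center c r M i j; set r' := r / M%:R in rM0 rMr WrM *.
have sub z : in_square c' r' z -> in_square c r z by exact: subgrid_square (ltW r0) iM jM.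
have y1' : x1 <= 1 / r' by exact: le_inv_grid.
have r'g : 0 < r' <= rg by rewrite rM0 (le_trans rMr).
have gle : g <= m12 by rewrite le_max lexx orbT.
(* A hole centre within r' / 4 of a point of the inner half lies in the inner three quarters, as
   [hole_refines] asks. If the inner half contains no right orbit, it is itself a hole. *)
have [[z Pz hz]|noP] := pselect (exists2 z, right_orbit lam b z & in_square c' (r' / 2) z); last first.
  have [||s hs] := Hg c' r' c' r'g; last by exists s; apply: refines_le hs.
    by clear - rM0; apply: in_square_center; lra.
  move=> z hz Pz; apply: noP; exists z => //; apply: normc_in_square.
  apply: le_trans hz _; rewrite [leRHS]mulrC ler_wpM2r ?(ltW rM0)//.
  by clear - heta; case/andP: heta; lra.
have hz' : in_square c' r' z.
  by clear - hz rM0; case/andP: hz => ? ?; apply/andP; split; lra.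
have zz0 : normc (z - z0) < 5 * r.
  by apply: le_lt_trans (in_square_dist (sub _ hz') hz0) _; clear - r0; lra.
have hbz1 : expanding_upto lam%:C b z m.+1 by exact: right_orbit_expanding.
have [D1 D2] := deriv_compare b_gt1 hbz1 aff0 zz0.
have Dup : normc (iter_deriv lam%:C z m.+1) * (5 * r') <= eps.
  have h : normc (iter_deriv lam%:C z m.+1) * r <= 51 / d.
    have -> : 51 / d = 3 * (17 / d) by ring.
    apply: le_trans (_ : 3 * (r * normc (iter_deriv lam%:C z0 m.+1)) <= _).
      by have := ler_wpM2r (ltW r0) D1; clear; lra.
    by clear - hX; lra.
  have -> : normc (iter_deriv lam%:C z m.+1) * (5 * r') =
      5 * (normc (iter_deriv lam%:C z m.+1) * r) / M%:R by rewrite /r'; ring.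
  rewrite ler_pdivrMr//; apply: le_trans (_ : 255 / d <= _); first by clear - h; lra.
  by move: hM; rewrite invfM mulrA ler_pdivrMr// (mulrC M%:R).
have Dlo : eh <= normc (iter_deriv lam%:C z m.+1) * r'.
  rewrite /eh /r' invfM !mulrA ler_pM2r ?invr_gt0// ler_pdivrMr//.
  by have := ler_wpM2r (ltW r0) D2; clear - hm1; lra.
have [hT|hT] := leP (normc (iter m.+2 (cE lam%:C) z)) T.
  have hbz : expanding_upto lam%:C b z m.+1 by exact: right_orbit_expanding.
  have Dr' : normc (iter_deriv lam%:C z m.+1) * r' <= eps.
    apply: le_trans Dup; rewrite ler_wpM2l ?normc_ge0//.
    by clear - rM0; lra.
  have aff := Hdist lam%:C z r' m.+1 (ltW rM0) hbz (le_trans Dr' ee2) m.+1 (leqnSn _).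
  have aff1 : affine_on lam%:C z r' 1 m.+1.
    move=> p p' hp hp'; have [u hu Eu] := aff p p' hp hp'; exists u => //.
    by clear - hu; lra.
  have Drange : eh <= normc (iter_deriv lam%:C z m.+1) * r' <= 1 by rewrite Dlo (le_trans Dr').
  have [v vz hv] := Hhole z m.+1 r' Pz rM0 Drange aff1 hT.
  have [||s hs] := Hg c' r' v r'g; last by exists s; apply: refines_le hs.
    by have := in_square_trans hz vz; congr in_square; field.
  exact: hv.
have rr : 0 < r' <= rA by rewrite rM0 (le_trans rMr).
have hX' : 17 / d <= r' * normc (iter_deriv lam%:C z m.+2).
  rewrite normc_iter_derivS mulrA (mulrC r').
  have -> : 17 / d = eh * T by rewrite /T; field; rewrite !gt_eqF.
  by apply: ler_pM; rewrite ?(ltW eh0) ?(ltW T0) ?(ltW hT).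
have [s hs] := HA c' r' z m.+1 hz' Pz rr (hA _ (sub _ hz')) (le_trans Dup ee1) hX'.
by exists s; apply: refines_le hs => //; rewrite le_max lexx.
Qed.

Section FineCovers.
Context {R : realType}.
Local Notation square := (R[i] * R)%type.

Lemma iter_refine (P : R[i] -> Prop) (W : R -> R) (t r0 : R) (B : R[i] -> Prop)
    (L : seq square) : 0 <= t ->
  (forall c r, 0 < r <= r0 -> (forall z, in_square c r z -> B z) ->
    exists s, refines P W t (c, r) s) ->
  (forall q, q \in L -> 0 < q.2 <= r0) ->
  (forall q, q \in L -> forall z, in_square q.1 q.2 z -> B z) ->
  forall n, exists S : seq square,
    [/\ forall q, q \in S -> 0 < q.2 <= r0 / 2 ^+ n,
        forall q, q \in S -> forall z, in_square q.1 q.2 z -> B z,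
        forall Q z, Q \in L -> in_square Q.1 Q.2 z -> P z ->
          exists2 q, q \in S & in_square q.1 q.2 z &
        \sum_(q <- S) W q.2 <= t ^+ n * \sum_(q <- L) W q.2].
Proof.
move=> t0 H L1 L2; elim=> [|n [S [S1 S2 S3 S4]]].
  exists L; split => //; last by rewrite expr0 mul1r.
    by move=> q; rewrite expr0 divr1; exact: L1.
  by move=> Q z QL hz _; exists Q.
have [|S' [T1 T2 T3 T4]] := @refines_seq _ P W t S.
  move=> [c r] qS; apply: H; last exact: S2 qS.
  have /andP[/= r_gt0 hr] := S1 _ qS; rewrite r_gt0 (le_trans hr)//.
  have rr0 : 0 < r0.
    by have := lt_le_trans r_gt0 hr; rewrite pmulr_lgt0// invr_gt0 exprn_gt0.
  by rewrite ler_piMr ?(ltW rr0)// invf_le1 ?exprn_gt0// exprn_ege1// ler1n.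
exists S'; split.
- move=> q /T1[Q /S1/andP[Q0 hQ] /andP[q0 hq]]; rewrite q0 (le_trans hq)//.
  by rewrite exprSr invfM mulrA ler_pM2r ?invr_gt0.
- by move=> q /T2[Q QS hq] z /hq; exact: S2.
- move=> Q z QL hz Pz; have [q qS hq] := S3 Q z QL hz Pz; exact: (T3 q).
by rewrite exprS -mulrA; apply: le_trans T4 _; rewrite ler_wpM2l.
Qed.

(** Of the n + m refinements, n suffice to make the squares small and m to make the weight small;
    the start is a grid of squares of half side at most [r0]. *)
Theorem fine_cover (P : R[i] -> Prop) (W : R -> R) (t : R) : 0 < t < 1 ->
  (forall A, exists2 r0, 0 < r0 & forall c r, 0 < r <= r0 ->
    (forall z, in_square c r z -> normc z <= A) -> exists s, refines P W t (c, r) s) ->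
  forall c r dl e, 0 < r -> 0 < dl -> 0 < e -> exists s : seq square,
    [/\ forall q, q \in s -> 0 < q.2 < dl,
      forall z, in_square c r z -> P z -> exists2 q, q \in s & in_square q.1 q.2 z &
      \sum_(q <- s) W q.2 <= e].
Proof.
move=> /andP[t0 t1] H c r dl e r_gt0 dl0 e0.
have [r0 r00 Hr] := H (normc c + 2 * r).
pose M := (Num.truncn (r / r0)).+1.
have M0 : (0 < M)%N by [].
have hM : r / M%:R <= r0.
  rewrite ler_pdivrMr ?ltr0n// mulrC -ler_pdivrMr// ltW//; exact: truncnS_gt.
pose L := grid_hits P c r M; pose S0 := \sum_(q <- L) W q.2.
have [n hn] := @expr_unbounded _ (Num.max (r0 / dl + 1) 0) 2 (ltr1n _ 2).
have ti : 1 < t^-1 by rewrite invf_gt1.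
have [m hm] := expr_unbounded (`|S0| / e) ti.
have [//| |S [S1 _ S3 S4]] := @iter_refine P W t r0 (fun z => normc z <= normc c + 2 * r) L
  (ltW t0) Hr _ _ (n + m).
- by move=> q /grid_cellsP[i [j [_ _ _ ->]]] /=; rewrite hM andbT divr_gt0// ltr0n.
- move=> q qL z hz; have := grid_hits_sub (ltW r_gt0) qL hz => /in_square_normc h.
  by have := normc_triangle (z - c) c; rewrite subrK; lra.
exists S; split.
- move=> q /S1/andP[q0 hq]; rewrite q0 (le_lt_trans hq)//.
  rewrite ltr_pdivrMr ?exprn_gt0// mulrC -ltr_pdivrMr//.
  move: hn; rewrite ge_max => /andP[hn _].
  apply: (@lt_le_trans _ _ (r0 / dl + 1)); first by rewrite ltrDl.
  by apply: (le_trans hn); rewrite ler_eXn2l ?ltr1n// leq_addr.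
- move=> z hz Pz; have [q qL hq] := grid_hits_cover r_gt0 M0 hz Pz; exact: (S3 q).
apply: (le_trans S4).
have t2 : t ^+ (n + m) <= t ^+ m by rewrite ler_iXn2l ?leq_addl.
apply: (@le_trans _ _ (t ^+ (n + m) * `|S0|)).
  by rewrite ler_wpM2l ?exprn_ge0 ?(ltW t0)// ler_norm.
apply: le_trans (ler_wpM2r (normr_ge0 _) t2) _.
by move: hm; rewrite exprVn ler_pdivrMr// mulrC ler_pdivlMr ?exprn_gt0// mulrC.
Qed.

End FineCovers.

(** * Powers of the Koenigs function as gauges *)

Section KoenigsGauge.
Context {R : realType}.

(** The real power Phi(x)^s. *)
Definition koenigs_gauge (Phi : R -> R) (s x : R) : R := expR (s * ln (Phi x)).

Variables (l0 b : R) (Phi : R -> R) (s : R).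
Hypotheses (l0_gt0 : 0 < l0) (b_gt1 : 1 < b) (fix_b : l0 * expR b = b).
Hypothesis PhiE : forall x, b <= x -> Phi (l0 * expR x) = b * Phi x.
Hypothesis Phi_germ : forall e, 0 < e -> exists2 d, 0 < d &
  forall x, b <= x -> x - b < d -> `|Phi x - (x - b)| <= e * (x - b).
Hypothesis s_ge0 : 0 <= s.

Local Notation Psi := (koenigs_gauge Phi s).
Let pos := koenigs_pos l0_gt0 b_gt1 fix_b PhiE Phi_germ.
Let mono := koenigs_mono l0_gt0 b_gt1 fix_b PhiE Phi_germ.
Let scale := koenigs_scale l0_gt0 b_gt1 fix_b PhiE Phi_germ.

Lemma koenigs_gauge_mono x y : b < x -> x <= y -> Psi x <= Psi y.
Proof.
move=> bx xy; have by' := lt_le_trans bx xy.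
rewrite ler_expR ler_wpM2l// ler_ln ?posrE ?pos//.
by rewrite mono// ltW.
Qed.

Lemma koenigs_gauge_le x y (A B : R) : b < x -> b < y -> 0 < A -> s * ln A <= B ->
  Phi x <= A * Phi y -> Psi x <= expR B * Psi y.
Proof.
move=> bx by' A0 AB h; rewrite -expRD ler_expR.
apply: le_trans (_ : s * ln (A * Phi y) <= _).
  by rewrite ler_wpM2l// ler_ln ?posrE ?mulr_gt0 ?pos.
by rewrite lnM ?posrE ?pos// mulrDr lerD2r.
Qed.

Lemma small_log_factor B : 0 < B -> exists2 e, 0 < e & s * ln (1 + e) <= B.
Proof.
move=> B0; have s1 : 0 < s + 1 by rewrite ltr_pwDr.
exists (B / (s + 1)); first by rewrite divr_gt0.
have e0 : 0 <= B / (s + 1) by rewrite divr_ge0 ?ltW.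
have h : ln (1 + B / (s + 1)) <= B / (s + 1).
  by rewrite -ler_expR lnK ?posrE ?expR_ge1Dx// ltr_pwDl.
apply: (le_trans (ler_wpM2l s_ge0 h)).
by rewrite mulrA ler_pdivrMr// mulrC ler_wpM2l ?(ltW B0)// lerDl.
Qed.

Lemma koenigs_gauge_scale M e : 1 <= M -> 0 < e ->
  exists x0, forall x, x0 <= x -> Psi (M * x) <= (1 + e) * Psi x.
Proof.
move=> M1 e0; have l0' : 0 < ln (1 + e) by rewrite ln_gt0// ltrDl.
have [e' e'0 he'] := small_log_factor l0'.
have [x0 bx0 H] := scale M1 e'0.
exists x0 => x hx; have bx := lt_le_trans bx0 hx.
have e1 : 0 < 1 + e by rewrite ltr_pwDl// ltW.
rewrite -(lnK (_ : 1 + e \is Num.pos)) ?posrE//.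
apply: (@koenigs_gauge_le _ _ (1 + e')) => //.
- apply: (lt_le_trans bx); rewrite ler_peMl// (le_trans _ (ltW bx))//.
  by rewrite (le_trans ler01)// ltW.
- by rewrite ltr_pwDl// ltW.
exact: H.
Qed.

(** For large x, C x e^(x/2) <= l0 e^(2x), where Phi equals b Phi(2x) <= b (1 + e) Phi(x). The
    exponent [B] is the midpoint of s ln b and ln 2. *)
Lemma koenigs_gauge_exp : s * ln b < ln 2 -> exists2 q, 0 < q < 2 &
  forall C, 0 < C -> exists x0, forall x, x0 <= x ->
    Psi (C * x * expR (x / 2)) <= q * Psi x.
Proof.
move=> hs; pose B := s * ln b + (ln 2 - s * ln b) / 2.
exists (expR B).
  rewrite expR_gt0/= -[ltRHS](@lnK R 2) ?posrE// ltr_expR /B; lra.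
have k0 : 0 < (ln 2 - s * ln b) / 2 by lra.
have [e e0 he] := small_log_factor k0.
move=> C C0; have [x0 bx0 H] := scale (ler1n _ 2) e0.
have B1 := b_gt1; have b0 : 0 < b by lra.
pose Y := Num.max x0 (Num.max (2 * (C / l0)) (2 * b / C)).
exists Y => x; rewrite !ge_max => /and3P[h1 h2 h3].
have bx := lt_le_trans bx0 h1; have x_gt0 := lt_trans b0 bx.
have ex2 := expR_ge1Dx (x / 2).
have lo : b < C * x * expR (x / 2).
  move: h3; rewrite ler_pdivrMr// (mulrC x) => h3.
  have : C * x * 1 <= C * x * expR (x / 2) by rewrite ler_wpM2l ?mulr_ge0 ?ltW//; lra.
  lra.
have hi : C * x * expR (x / 2) <= l0 * expR (2 * x).
  have -> : 2 * x = x + x / 2 + x / 2 by field.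
  rewrite !expRD mulrA ler_pM2r ?expR_gt0//.
  have h4 : C <= l0 * expR (x / 2).
    have : C / l0 <= expR (x / 2) by lra.
    by rewrite ler_pdivrMr// mulrC.
  rewrite mulrCA [leRHS]mulrC [C * x]mulrC [leRHS]mulrC; apply: ler_pM => //; rewrite ?ltW//.
  by have := expR_ge1Dx x; lra.
have b2x : b < 2 * x by lra.
apply: (@koenigs_gauge_le _ _ (b * (1 + e))) => //.
- by rewrite mulr_gt0//; lra.
- rewrite lnM ?posrE//; last by lra.
  by rewrite mulrDr /B; lra.
apply: le_trans (mono (ltW lo) hi) _.
rewrite PhiE ?(ltW b2x)// -mulrA ler_pM2l//; exact: H.
Qed.

End KoenigsGauge.

(** * Normal families, and the attracting basin for real parameters below 1/e *)

Section Normality.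
Context {R : realType}.
Local Notation C := (cplane R).

Lemma uniform_cvg_complex (K : set C) (f : nat -> C -> C) (g : C -> C) :
  (forall e : R, 0 < e -> exists N, forall n z, (N <= n)%N -> K z ->
     normc ((g z : R[i]) - f n z) < e) ->
  {uniform K, f @ \oo --> g}.
Proof.
move=> H W; rewrite uniform_nbhs => -[A [entA subW]].
move: entA; rewrite -entourage_ballE => -[e /= /complex_gt0P[r r0 ->]] hA.
have [N HN] := H r r0.
exists N => // n /= Nn; apply: subW => z Kz; apply: hA => /=.
by rewrite -ball_normE /= ltcR; exact: HN.
Qed.

Lemma open_nbhs_disc (z : R[i]) (d : R) : 0 < d ->
  open_nbhs (z : C) [set w : C | normc ((w : R[i]) - z) < d].
Proof.
move=> d0; split; last by rewrite /= subrr normc0.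
rewrite openE => w /= hw; rewrite /interior; apply/nbhs_cplaneP.
exists (d - normc ((w : R[i]) - z)); first by rewrite subr_gt0.
move=> v hv /=; apply: le_lt_trans (normc_distD v (w : R[i]) z) _.
by rewrite -ltrBrDr.
Qed.

Lemma uniform_cvg_point (z : C) (f : nat -> C -> C) (g : C -> C) :
  {uniform [set z], f @ \oo --> g} -> forall e : R, 0 < e ->
  exists N, forall n, (N <= n)%N -> normc ((g z : R[i]) - f n z) < e.
Proof.
rewrite uniform_set1 => /cvgrPdist_lt H e e0.
have /H [N _ HN] : 0 < e%:C :> R[i] by rewrite ltcR.
by exists N => n /HN; rewrite /= ltcR.
Qed.

Lemma increasing_choice (Q : nat -> nat -> Prop) :
  (forall N m, exists2 k, (m <= k)%N & Q N k) ->
  exists s : nat -> nat, {homo s : m n / (m < n)%N} /\ forall i, Q i (s i).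
Proof.
move=> H.
pose F (p : nat * nat) : nat := sval (cid2 (H p.1 p.2)).
have F1 p : (p.2 <= F p)%N by rewrite /F; case: cid2.
have F2 p : Q p.1 (F p) by rewrite /F; case: cid2.
pose s := fix s n := if n is m.+1 then F (n, (s m).+1) else F (0, 0).
exists s; split; last by case=> [|i] /=; exact: (F2 (_, _)).
apply: homo_ltn; first exact: ltn_trans.
by move=> i /=; exact: (F1 (i.+1, (s i).+1)).
Qed.

(** [normal_on] allows arbitrary sequences of iterates, with repetitions, so their indices need not
    tend to infinity. *)
Lemma index_dichotomy (idx : nat -> nat) :
  (exists v, forall m, exists2 k, (m <= k)%N & idx k = v) \/
  (forall N m, exists2 k, (m <= k)%N & (N <= idx k)%N).
Proof.
have [h|h] := pselect (forall N m, exists2 k, (m <= k)%N & (N <= idx k)%N); first by right.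
left; move/existsNP: h => [N /existsNP[m h]].
have hk k : (m <= k)%N -> (idx k < N)%N.
  by move=> mk; rewrite ltnNge; apply/negP => Nk; apply: h; exists k.
apply: contrapT => /forallNP hv.
have {}hv v : exists B, forall k, (B <= k)%N -> idx k != v.
  have /existsNP[B hB] := hv v; exists B => k Bk; apply/eqP => kv.
  by apply: hB; exists k.
have [B hB] := choice hv.
pose k := maxn m (\max_(v < N) B v).
have kN : (idx k < N)%N by rewrite hk// leq_maxl.
suff /hB : (B (idx k) <= k)%N by rewrite eqxx.
apply: leq_trans (leq_maxr _ _); exact: (leq_bigmax (Ordinal kN)).
Qed.

Lemma cexp_lipschitz (m : R) (p q : R[i]) : complex.Re p <= m -> complex.Re q <= m ->
  normc (cexp p - cexp q) <= expR m * normc (p - q).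
Proof.
move=> pm qm; rewrite -(@ler_pXn2r _ 2)//; last 2 first.
- by rewrite nnegrE normc_ge0.
- by rewrite nnegrE mulr_ge0 ?expR_ge0 ?normc_ge0.
rewrite exprMn normc_sqr_cexpB normc_sqr.
case: p q pm qm => [x y] [u v] /= xm um.
have e0 := expR_gt0 m; have e1 := expR_gt0 x; have e2 := expR_gt0 u.
have ex : expR x <= expR m by rewrite ler_expR.
have eu : expR u <= expR m by rewrite ler_expR.
set h := (y - v) / 2.
have H1 : (expR x - expR u) ^+ 2 <= (expR m * (x - u)) ^+ 2.
  wlog xu : x u {xm um} e1 e2 ex eu / u <= x => [H|].
    case: (leP u x) => [/H->//|/ltW /H HH].
    by rewrite -sqrrN -(sqrrN (expR m * _)) -mulrN !opprB HH.
  have := expR_ge1Dx (u - x); have : expR u = expR x * expR (u - x).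
    by rewrite -expRD addrC subrK.
  move=> E HE.
  have A0 : 0 <= expR x - expR u by rewrite subr_ge0 ler_expR.
  have A : expR x - expR u <= expR x * (x - u) by rewrite E; nra.
  have xu0 : 0 <= x - u by rewrite subr_ge0.
  have A2 : expR x - expR u <= expR m * (x - u).
    by apply: le_trans A _; rewrite ler_wpM2r.
  by rewrite ler_sqr// nnegrE (le_trans A0).
rewrite mulrDr -exprMn lerD//.
have -> : y - v = 2 * h by rewrite /h; field.
have hs : sin h ^+ 2 <= h ^+ 2.
  have := sin_diff h 0; rewrite sin0 !subr0 => hh.
  by have : `|sin h| ^+ 2 <= `|h| ^+ 2; [rewrite ler_sqr ?nnegrE|rewrite !real_normK ?num_real].
have e3 : expR x * expR u <= expR m ^+ 2 by rewrite expr2 ler_pM// ltW.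
rewrite exprMn (_ : expR m ^+ 2 * _ = 4 * expR m ^+ 2 * h ^+ 2); last by ring.
by rewrite ler_pM ?sqr_ge0 ?mulr_ge0 ?(ltW e1) ?(ltW e2)// ler_pM2l.
Qed.

Lemma iter_cE_continuous (lam z : R[i]) n e : 0 < e -> exists2 d : R, 0 < d &
  forall w, normc (w - z) < d -> normc (iter n (cE lam) w - iter n (cE lam) z) < e.
Proof.
elim: n e => [|n IH] e e0; first by exists e.
pose K := normc (cE lam (iter n (cE lam) z)) + 1.
have K0 : 0 < K by rewrite ltr_pwDr// normc_ge0.
have [|d d0 H] := IH (Num.min (1 / 2) (e / (4 * K))).
  by rewrite lt_min !divr_gt0// mulr_gt0.
exists d => // w /H; rewrite lt_min => /andP[h1 h2].
rewrite !iterS cE_diff normcM.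
have := cexp_sub1_le (ltW h1); move: h2; rewrite ltr_pdivlMr; last by rewrite mulr_gt0.
set x := normc (iter n _ w - _); set y := normc (cexp _ - 1) => h2 h3.
have KK : normc (cE lam (iter n (cE lam) z)) <= K by rewrite /K lerDl.
apply: le_lt_trans (_ : K * (4 * x) < e); last by lra.
by rewrite ler_pM ?normc_ge0.
Qed.

End Normality.

Section AttractingBasin.
Context {R : realType}.
Variables lam b : R.
Hypotheses (lam_gt0 : 0 < lam) (b_gt1 : 1 < b) (lamEb : lam * expR b = 1).
Local Notation C := (cplane R).
Local Notation E := (cE lam%:C).

Lemma real_attracting_fixpoint : exists2 a : R, 0 <= a <= 1 & lam * expR a = a.
Proof.
pose f x := lam * expR x - x.
have fc : {within `[0, 1], continuous f}.
  apply: continuous_subspaceT => x; apply: cvgB; last exact: cvg_id.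
  by apply: cvgMr; exact: continuous_expR.
have lam1 : lam * expR 1 <= 1.
  by rewrite -[leRHS]lamEb ler_pM2l// ler_expR ltW.
have [|c] := @IVT R f 0 1 0 ler01 fc.
  rewrite /f expR0 subr0 mulr1 ge_min le_max (ltW lam_gt0) /=.
  by rewrite andbT subr_le0 lam1 orbT.
rewrite in_itv /= => c01 fc0; exists c => //; move: fc0; rewrite /f; lra.
Qed.

(** Up to the midpoint (1 + b) / 2 one has |E'| <= e^(-(b - 1)/2) < 1. The image lies in the unit
    disc, hence again in this half plane. *)
Lemma basin_contracts (k : R) : expR (- (b - 1) / 2) <= k ->
  forall p q : R[i], complex.Re p <= 1 + (b - 1) / 2 -> complex.Re q <= 1 + (b - 1) / 2 ->
  normc (E p - E q) <= k * normc (p - q) /\ normc (E p) <= k.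
Proof.
move=> hk p q hp hq.
have Em : lam * expR (1 + (b - 1) / 2) = expR (- (b - 1) / 2).
  have -> : 1 + (b - 1) / 2 = b + - (b - 1) / 2 by field.
  by rewrite expRD mulrA lamEb mul1r.
split.
  rewrite /cE -mulrBr normcM normc_real gtr0_norm//.
  apply: le_trans (ler_wpM2l (ltW lam_gt0) (cexp_lipschitz hp hq)) _.
  by rewrite mulrA Em ler_wpM2r ?normc_ge0.
rewrite normc_cE_real//; apply: le_trans hk; rewrite -Em ler_pM2l// ler_expR//.
Qed.

End AttractingBasin.

(** From Re E^n z <= b follows |E^(n+1) z| <= lam e^b = 1, so a whole disc enters the half plane of
    [basin_contracts]. Iterates of unbounded index then have a subsequence converging uniformly to
    the attracting fixed point; a recurring index gives a constant subsequence. *)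
Lemma fatou_basin (R : realType) (lam b : R) (z : R[i]) n :
  0 < lam -> 1 < b -> lam * expR b = 1 ->
  complex.Re (iter n (cE lam%:C) z) <= b -> Defs.fatou (Eexp lam%:C) z.
Proof.
move=> lam_gt0 B1 lamEb; set E := cE lam%:C => hz.
pose k := expR (- (b - 1) / 2).
have k0 : 0 < k := expR_gt0 _.
have k1 : k < 1 by rewrite /k expR_lt1; lra.
have [a /andP[a0 a1] Ea] := real_attracting_fixpoint lam_gt0 B1 lamEb.
have EaC : E a%:C = a%:C.
  by rewrite /E /cE /cexp /= cos0 sin0; simpc; rewrite Ea.
have Ra : complex.Re a%:C <= 1 + (b - 1) / 2 by rewrite /=; lra.
have ek0 : 0 < (b - 1) / 2 by lra.
have [d d0 Hd] := @iter_cE_continuous _ lam%:C z n.+1 _ ek0.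
have hz1 : normc (iter n.+1 E z) <= 1.
  by rewrite iterS normc_cE_real// -[leRHS]lamEb ler_pM2l// ler_expR.
have U1 w : normc (w - z) < d -> complex.Re (iter n.+1 E w) <= 1 + (b - 1) / 2.
  move=> /Hd h.
  have := ler_normcB (iter n.+1 E w) (iter n.+1 E z).
  have := ler_Re_normc (iter n.+1 E w); rewrite ler_norml => /andP[_].
  clear - h hz1; lra.
have cv p m : complex.Re p <= 1 + (b - 1) / 2 -> complex.Re (iter m E p) <= 1 + (b - 1) / 2 /\
    normc (iter m E p - a%:C) <= k ^+ m * normc (p - a%:C).
  move=> hp; elim: m => [|m [IH1 IH2]]; first by rewrite mul1r.
  have [h1 h2] := basin_contracts lam_gt0 lamEb (lexx k) IH1 Ra; rewrite iterS; split.
    have := ler_Re_normc (E (iter m E p)); rewrite ler_norml => /andP[_].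
    move: h2 k1 ek0; clear; lra.
  rewrite -{1}EaC exprS -mulrA; apply: le_trans h1 _.
  by rewrite ler_pM2l.
exists [set w : cplane R | normc ((w : R[i]) - z) < d].
  exact: open_nbhs_disc.
move=> f hf.
have hf' i : exists m, f i = iter m (Eexp lam%:C) by have [m _ <-] := hf i; exists m.
have [idx hidx] := choice hf'.
case: (index_dichotomy idx) => [[v hv]|hu].
  have [s [s1 s2]] := increasing_choice (Q := fun _ k => idx k = v) (fun _ => hv).
  exists s; split => //; left; exists (iter v (Eexp lam%:C)) => K _ _.
  apply: uniform_cvg_complex => e e0; exists 0 => i w _ _.
  by rewrite /= hidx s2 subrr normc0.
have [s [s1 s2]] := increasing_choice hu.
exists s; split => //; left; exists (fun=> a%:C) => K _ KU.
apply: uniform_cvg_complex => e e0.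
have ti : 1 < k^-1 by rewrite invf_gt1.
have [m hm] := expr_unbounded ((2 + b) / e + 1) ti.
exists (n.+2 + m)%N => i w hi Kw.
rewrite /= hidx normc_distC -[iter _ (Eexp _) w]/(iter (idx (s i)) E w).
have : (n.+2 + m <= idx (s i))%N := leq_trans hi (s2 i).
move=> /subnK <-; rewrite addnA.
set p := iter n.+1 E w; have hp := U1 _ (KU _ Kw).
have [_ hEp] := basin_contracts lam_gt0 lamEb (lexx k) hp hp.
have RE : complex.Re (E p) <= 1 + (b - 1) / 2.
  have := ler_Re_normc (E p); rewrite ler_norml => /andP[_].
  by move: hEp k1 ek0; clear; lra.
set l := (_ - _)%N; have -> : (l + n.+2 + m = (l + m) + n.+2)%N by rewrite addnAC.
rewrite iterD [iter n.+2 _ w]iterS -/p.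
have [_ h] := cv _ (l + m)%N RE.
apply: le_lt_trans h _.
have h1 : normc (E p - a%:C) <= 2 + b.
  apply: le_trans (normc_triangleB _ _) _; rewrite normc_real ger0_norm//.
  by move: hEp k1 a1 B1; clear; lra.
have h2 : k ^+ (l + m) <= k ^+ m by rewrite ler_iXn2l ?leq_addl ?(ltW k0) ?(ltW k1).
have bb : 0 < 2 + b by clear - B1; lra.
apply: le_lt_trans (_ : k ^+ m * (2 + b) < e).
  by rewrite ler_pM ?exprn_ge0 ?normc_ge0// ltW.
rewrite mulrC -ltr_pdivlMr ?exprn_gt0// -exprVn mulrC -ltr_pdivrMr//.
by apply: lt_le_trans hm; rewrite ltrDl.
Qed.

Theorem julia_right_orbit (R : realType) (lam b : R) (z : R[i]) :
  0 < lam -> 1 < b -> lam * expR b = 1 ->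
  julia (Eexp lam%:C) z -> right_orbit lam b z.
Proof.
move=> lam0 b1 lb hz n; rewrite ltNge; apply/negP => h.
by apply: hz; exact: fatou_basin h.
Qed.

(** * Hausdorff measure tools and the case of measure zero *)

Section HausdorffTools.
Context {R : realType}.
Local Notation C := (cplane R).

Lemma diam_ge0 (A : set C) : (0 <= diam A)%E.
Proof. by apply: ereal_sup_ubound; left. Qed.

Lemma diam_le (A : set C) (r : R) : 0 <= r ->
  (forall z w : R[i], A z -> A w -> normc (z - w) <= r) -> (diam A <= r%:E)%E.
Proof.
move=> r0 H; apply: ge_ereal_sup => _ [->|[z Az] [w Aw] <-].
  by rewrite lee_fin.
by rewrite lee_fin; exact: H.
Qed.

Lemma diam_set0 : diam (set0 : set C) = 0%E :> \bar R.
Proof. by apply/eqP; rewrite eq_le diam_ge0 andbT; exact: diam_le. Qed.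

Lemma diam_square (c : R[i]) (r : R) : 0 <= r ->
  (diam ([set z : C | in_square c r z] : set C) <= (4 * r)%:E)%E.
Proof.
move=> r0; apply: diam_le; first by rewrite mulr_ge0.
by move=> z w hz hw; exact: in_square_dist hz hw.
Qed.

Lemma fine_diam_lt (A : set C) (d : R) : (diam A < d%:E)%E -> 0 <= fine (diam A) < d.
Proof.
move=> h; have h0 := diam_ge0 A.
have fA : diam A \is a fin_num by rewrite ge0_fin_numE// (lt_trans h)// ltry.
by rewrite fine_ge0//= -lte_fin fineK.
Qed.

Lemma hausdorff_content_mono (h : R -> R) (A : set C) (d1 d2 : R) : d1 <= d2 ->
  (hausdorff_content h A d2 <= hausdorff_content h A d1)%E.
Proof.
move=> d12; apply: le_ereal_inf => _ [D [AD hD] <-]; exists D => //.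
by split=> // i; apply: lt_le_trans (hD i) _; rewrite lee_fin.
Qed.

Lemma hausdorff_content_ge0 (h : R -> R) (A : set C) (eps d : R) :
  (forall t, 0 <= t < eps -> 0 <= h t) -> d <= eps ->
  (0 <= hausdorff_content h A d)%E.
Proof.
move=> h0 de; apply: le_ereal_inf_tmp => _ [D [AD hD] <-].
apply: nneseries_ge0 => i _ _; rewrite lee_fin h0//.
by have /fine_diam_lt/andP[-> /lt_le_trans->] := hD i.
Qed.

Lemma hausdorff_measure_eq0 (h : R -> R) (A : set C) : gauge_function h ->
  (forall d e : R, 0 < d -> 0 < e -> exists2 D : nat -> set C,
     A `<=` \bigcup_i D i /\ (forall i, (diam (D i) < d%:E)%E) &
     (\sum_(0 <= i <oo) (h (fine (diam (D i))))%:E <= e%:E)%E) ->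
  hausdorff_measure h A = 0%E.
Proof.
move=> [eps e0 [_ h0 _ _]] H; apply: cvg_lim => //.
apply: cvg_near_cst; near=> d.
have d0 : 0 < d by near: d; exact: nbhs_right_gt.
have de : d <= eps by near: d; exact: nbhs_right_le.
apply/eqP; rewrite eq_le (hausdorff_content_ge0 _ h0 de) andbT.
apply/lee_addgt0Pr => e e_gt0; rewrite add0e.
have [D [AD hD] hs] := H d e d0 e_gt0.
by apply: ereal_inf_le; exists (\sum_(0 <= i <oo) (h (fine (diam (D i))))%:E)%E => //; exists D.
Unshelve. all: by end_near. Qed.

(** A bijection between nat and pairs merges countably many covers, with budgets e / 2^(n+1), into
    one sequence. *)
Lemma sum_pairs_le (F : nat -> nat -> R) (e : R) : 0 <= e ->
  (forall n i, 0 <= F n i) ->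
  (forall n, (\sum_(0 <= i <oo) (F n i)%:E <= (e / (2 ^ n.+1)%:R)%:E)%E) ->
  exists2 f : nat -> nat * nat, (forall p, exists k, f k = p) &
    (\sum_(0 <= k <oo) (F (f k).1 (f k).2)%:E <= e%:E)%E.
Proof.
move=> e0 F0 Fe.
have /card_esym/ppcard_eqP[f] := card_nat2.
exists f; first by move=> p; exists (f^-1%FUN p); rewrite invK ?inE.
rewrite nneseries_esumT; last by move=> k; rewrite lee_fin.
rewrite -(@reindex_esum R _ _ setT setT f (fun p => (F p.1 p.2)%:E)) //.
rewrite (_ : setT = setT `*`` (fun=> setT)); last by apply/seteqP; split => // -[].
rewrite -(@esum_esum R _ _ setT (fun=> setT) (fun n i => (F n i)%:E)); last first.
  by move=> i j _ _; rewrite lee_fin.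
rewrite -nneseries_esumT; last by move=> n; apply: esum_ge0 => i _; rewrite lee_fin.
apply: le_trans (epsilon_trick0 xpredT e0).
apply: lee_nneseries => [n _ _|n _]; first by apply: esum_ge0 => i _; rewrite lee_fin.
by rewrite -nneseries_esumT// => i; rewrite lee_fin.
Qed.

Lemma nneseries_le_of_sums (F : nat -> R) (e : R) : (forall i, 0 <= F i) ->
  (\forall N \near \oo, \sum_(0 <= i < N) F i <= e) ->
  (\sum_(0 <= i <oo) (F i)%:E <= e%:E)%E.
Proof.
move=> F0 H; apply: lime_le; first by apply: is_cvg_nneseries => i _ _; rewrite lee_fin.
by apply: filterS H => N; rewrite sumEFin lee_fin.
Qed.

Lemma sum_le_of_nneseries (F : nat -> R) (e : R) N : (forall i, 0 <= F i) ->
  (\sum_(0 <= i <oo) (F i)%:E <= e%:E)%E -> \sum_(0 <= i < N) F i <= e.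
Proof.
move=> F0 H; rewrite -lee_fin -sumEFin; apply: le_trans H.
by apply: nneseries_lim_ge => i _ _; rewrite lee_fin.
Qed.

End HausdorffTools.

Section LogRatio.
Context {R : realType}.
Variables (g Phi : R -> R) (K : R).
Hypothesis Phi_large : exists2 d : R, 0 < d & forall t, 0 < t < d -> 1 < Phi (1 / t).

Lemma at_right0P (V : set R) : (0 : R)^'+ V -> exists2 d : R, 0 < d & forall t, 0 < t < d -> V t.
Proof.
move=> /nbhs_ballP[d /= d0 h]; exists d => // t /andP[t0 td]; apply: h => //.
by rewrite -ball_normE /= sub0r normrN gtr0_norm.
Qed.

Lemma log_ratio_limsup : 0 < K -> (limf_esup (log_ratio g Phi) 0^'+ < K%:E)%E ->
  exists s, [/\ 0 <= s, s < K & exists2 d, 0 < d &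
    forall t, 0 < t < d -> g t <= koenigs_gauge Phi s (1 / t)].
Proof.
move=> K0; have [d0 d00 hd0] := Phi_large.
move=> /ereal_inf_lt[_ [V FV <-]] hV.
have [d1 d10 hd1] := at_right0P FV.
pose M := ereal_sup (log_ratio g Phi @` V).
(* [M] may be negative, or -oo with [fine M] = 0; the maximum with 0 keeps the exponent nonnegative,
   as monotonicity of the gauge requires. *)
exists (Num.max 0 (fine M)).
have fM : (M <= (Num.max 0 (fine M))%:E)%E.
  rewrite -/M in hV; case: M hV => [r _|h|_] /=; last by rewrite leNye.
    by rewrite lee_fin le_max lexx orbT.
  by rewrite ltNge leey in h.
split; first by rewrite le_max lexx.
  rewrite gt_max K0 /=; rewrite -/M in hV; case: M hV {fM} => [r|h|_] //=.
exists (Num.min d0 d1); first by rewrite lt_min d00.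
move=> t; rewrite lt_min => /and3P[t0 td0 td1].
have P1 : 1 < Phi (1 / t) by apply: hd0; rewrite t0.
have L0 : 0 < ln (Phi (1 / t)) by rewrite ln_gt0.
have [gt0|gt0] := leP (g t) 0; first by rewrite (le_trans gt0)// expR_ge0.
have : (log_ratio g Phi t <= (Num.max 0 (fine M))%:E)%E.
  apply: le_trans fM; apply: ereal_sup_ubound; exists t => //; apply: hd1.
  by rewrite t0.
rewrite /log_ratio lne_EFin// inver gt_eqF// -EFinM lee_fin ler_pdivrMr// => h.
by rewrite /koenigs_gauge -(@lnK _ (g t)) ?posrE// ler_expR.
Qed.

Lemma log_ratio_liminf : (K%:E < limf_einf (log_ratio g Phi) 0^'+)%E ->
  exists s, K < s /\ exists2 d, 0 < d &
    forall t, 0 < t < d -> koenigs_gauge Phi s (1 / t) <= g t.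
Proof.
have [d0 d00 hd0] := Phi_large.
rewrite limf_einfE => /ereal_sup_gt[_ [V FV <-]] hV.
have [d1 d10 hd1] := at_right0P FV.
pose M := ereal_inf (log_ratio g Phi @` V); rewrite -/M in hV.
have [s Ks sM] : exists2 s, K < s & (s%:E <= M)%E.
  case: M hV => [r Kr| _|//]; last by exists (K + 1); rewrite ?leey// ltrDl.
  by exists r => //; rewrite -lte_fin.
exists s; split => //; exists (Num.min d0 d1); first by rewrite lt_min d00.
move=> t; rewrite lt_min => /and3P[t0 td0 td1].
have P1 : 1 < Phi (1 / t) by apply: hd0; rewrite t0.
have L0 : 0 < ln (Phi (1 / t)) by rewrite ln_gt0.
have : (s%:E <= log_ratio g Phi t)%E.
  apply: le_trans sM _; apply: ereal_inf_lbound; exists t => //; apply: hd1.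
  by rewrite t0.
(* If g t <= 0, its logarithm and the quotient are -oo, contrary to the lower bound s. *)
rewrite /log_ratio; have [gt0|gt0] := leP (g t) 0.
  by rewrite le0_lneNy// inver gt_eqF// gt0_mulNye// lte_fin invr_gt0.
rewrite lne_EFin// inver gt_eqF// -EFinM lee_fin ler_pdivlMr// => h.
by rewrite /koenigs_gauge -[leRHS](@lnK _ (g t)) ?posrE// ler_expR.
Qed.

End LogRatio.

Theorem hausdorff_julia_eq0 (R : realType) (lam0 beta s d : R) (Phi g h : R -> R) (lam : R) :
  0 < lam0 -> 1 < beta -> lam0 * expR beta = beta -> koenigs lam0 beta Phi ->
  (forall t, h t = t ^+ 2 * g t) -> gauge_function h ->
  0 <= s -> s * ln beta < ln 2 -> 0 < d ->
  (forall t, 0 < t < d -> g t <= koenigs_gauge Phi s (1 / t)) ->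
  0 < lam < (expR 1)^-1 ->
  hausdorff_measure h (julia (Eexp lam%:C)) = 0%E.
Proof.
move=> l0 b1 fb hK hg hh s0 sb d0 hd /andP[lam_gt0 lam1].
have germ := koenigs_germ hK; have PhiE := hK.2.
pose b := - ln lam.
have Eb : lam * expR b = 1 by rewrite /b expRN lnK ?posrE// divff// gt_eqF.
have bgt1 : 1 < b.
  rewrite /b ltrNr -(expRK (-1)) ltr_ln ?posrE ?expR_gt0// expRN//.
have [q q02 hq] := koenigs_gauge_exp l0 b1 fb PhiE germ s0 sb.
have bx1 x : beta + 1 <= x -> beta < x by move=> h1; apply: lt_le_trans h1; rewrite ltrDl.
have [t t01 Ht] := @cover_step R lam b lam_gt0 bgt1 Eb (koenigs_gauge Phi s) (beta + 1) q
  (fun x _ => expR_gt0 _)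
  (fun x y hx xy => koenigs_gauge_mono l0 b1 fb PhiE germ s0 (bx1 x hx) xy)
  (fun M e => @koenigs_gauge_scale R lam0 beta Phi s l0 b1 fb PhiE germ s0 M e) hq q02.
have cov := fine_cover t01 Ht.
apply: hausdorff_measure_eq0 => // dl e dl0 e0.
have [eps eps0 [h00 hpos hmono _]] := hh.
(* A square of half side r has diameter at most 4 r, so 4 r must respect the cover size, the bound
   on g, the domain of the gauge and the range of Phi. *)
pose rr := Num.min (Num.min dl d) (Num.min eps (1 / (beta + 1))) / 4.
have bb0 : 0 < beta + 1 by lra.
have rr0 : 0 < rr by rewrite divr_gt0// !lt_min dl0 d0 eps0 divr_gt0.
have hrr r : 0 < r < rr -> [/\ 4 * r < dl, 4 * r < d, 4 * r < eps & beta + 1 <= 1 / (4 * r)].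
  move=> /andP[r0]; rewrite /rr ltr_pdivlMr// mulrC !lt_min.
  move=> /andP[/andP[-> ->] /andP[-> h4]]; split => //.
  rewrite ler_pdivlMr ?mulr_gt0// mulrC -ler_pdivlMr//; exact: ltW.
(* The plane is exhausted by squares of half side n + 1; 16 = 4^2 pays for passing from half side to
   diameter. *)
have cs n := cov 0 n.+1%:R rr (e / (2 ^ n.+1)%:R / 16) (ltr0Sn R n) rr0
  (_ : 0 < e / (2 ^ n.+1)%:R / 16).
have en n : 0 < e / (2 ^ n.+1)%:R / 16 by rewrite !divr_gt0// ltr0n expn_gt0.
have [S HS] := choice (cs en).
pose x0 : R[i] * R := (0, 0).
(* Finite lists are padded with the empty set, of diameter 0 and weight h 0 = 0. *)
pose B n i : set (cplane R) := if (i < size (S n))%N then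
  [set z : cplane R | in_square (nth x0 (S n) i).1 (nth x0 (S n) i).2 z] else set0.
have Bdiam n i : (i < size (S n))%N -> (diam (B n i) <= (4 * (nth x0 (S n) i).2)%:E)%E.
  move=> hi; rewrite /B hi; apply: diam_square.
  by have [+ _ _] := HS n => /(_ _ (mem_nth x0 hi))/andP[/ltW].
have Bdl n i : (diam (B n i) < (Num.min dl eps)%:E)%E.
  have [hi|hi] := ltnP i (size (S n)).
    apply: le_lt_trans (Bdiam _ _ hi) _; rewrite lte_fin lt_min.
    by have [+ _ _] := HS n => /(_ _ (mem_nth x0 hi))/hrr[-> _ ->].
  by rewrite /B ltnNge hi/= diam_set0 lte_fin lt_min dl0 eps0.
pose F n i := h (fine (diam (B n i))).
have F0 n i : 0 <= F n i.
  apply: hpos; have /fine_diam_lt/andP[-> ] := Bdl n i.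
  by move=> /lt_le_trans; apply; rewrite ge_min lexx orbT.
have Fs n i : (size (S n) <= i)%N -> F n i = 0.
  by move=> hi; rewrite /F /B ltnNge hi /= diam_set0.
have Fle n i : (i < size (S n))%N ->
    F n i <= 16 * weight (koenigs_gauge Phi s) (nth x0 (S n) i).2.
  move=> hi; have [+ _ _] := HS n => /(_ _ (mem_nth x0 hi)) rq.
  have [h1 h2 h3 h4] := hrr _ rq; set r := (nth x0 (S n) i).2 in rq h1 h2 h3 h4 *.
  have /andP[r0 _] := rq.
  apply: (@le_trans _ _ (h (4 * r))).
    apply: hmono => //; first by have /fine_diam_lt/andP[-> ] := Bdl n i.
    have := Bdiam n i hi; rewrite -/r => h5.
    rewrite -lee_fin fineK// ge0_fin_numE ?diam_ge0//.
    by apply: le_lt_trans h5 _; rewrite ltry.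
  rewrite hg /weight exprMn -mulrA (_ : 4 ^+ 2 = 16); last by ring.
  rewrite ler_pM2l// ler_wpM2l ?sqr_ge0//.
  apply: le_trans (hd _ _) _; first by rewrite mulr_gt0.
  apply: (koenigs_gauge_mono l0 b1 fb PhiE germ s0 (bx1 _ h4)).
  by rewrite ler_pM2l// lef_pV2 ?posrE ?mulr_gt0// ler_peMl ?(ltW r0)// ler1n.
have [n|f fsurj fsum] := @sum_pairs_le _ F e (ltW e0) F0.
  apply: nneseries_le_of_sums => //; exists (size (S n)) => // N /= sN.
  rewrite (big_cat_nat (n := size (S n)))//= [X in _ + X](_ : _ = 0) ?addr0; last first.
    by rewrite big_nat big1// => i /andP[si _]; exact: Fs.
  have [_ _ h3] := HS n; rewrite big_nat.
  apply: (@le_trans _ _ (\sum_(0 <= i < size (S n))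
      16 * weight (koenigs_gauge Phi s) (nth x0 (S n) i).2)).
    by rewrite big_nat ler_sum => // i /andP[_ hi]; exact: Fle.
  rewrite -mulr_sumr -(big_nth x0 xpredT (fun q => weight (koenigs_gauge Phi s) q.2)).
  by move: h3; rewrite ler_pdivlMr// mulrC.
exists (fun k => B (f k).1 (f k).2); last exact: fsum.
split=> [z /(julia_right_orbit lam_gt0 bgt1 Eb) hz|k]; last first.
  by apply: lt_le_trans (Bdl _ _) _; rewrite lee_fin ge_min lexx.
pose n := Num.truncn (normc (z : R[i])).
have zn : in_square 0 n.+1%:R (z : R[i]).
  by apply: normc_in_square; rewrite subr0 ltW// truncnS_gt.
have [_ + _] := HS n => /(_ z zn hz)[p pS hp].
have [k hk] := fsurj (n, index p (S n)).
by exists k => //; rewrite hk /B /= index_mem pS /= nth_index.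
Qed.

(** * Choosing a branch of squares that avoids given squares *)

Section Overlap.
Context {R : realType}.

Definition clamp (p t x : R) : R := Num.min (Num.max x (p - t)) (p + t).

(** Length of the intersection of [c - r, c + r] with [p - t, p + t]; as a difference of values of
    one function it telescopes over a grid. *)
Definition overlap (p t c r : R) : R := clamp p t (c + r) - clamp p t (c - r).

Lemma overlap_ge0 p t c r : 0 <= r -> 0 <= overlap p t c r.
Proof.
move=> r0; rewrite subr_ge0 /clamp le_min !ge_min lexx orbT andbT; apply/orP; left.
by rewrite ge_max !le_max lexx orbT andbT; apply/orP; left; lra.
Qed.

Lemma overlap_le p t c r : 0 <= t -> overlap p t c r <= 2 * t.
Proof.
move=> t0; rewrite /overlap /clamp.
have h1 : Num.min (Num.max (c + r) (p - t)) (p + t) <= p + t by rewrite ge_min lexx orbT.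
have h2 : p - t <= Num.min (Num.max (c - r) (p - t)) (p + t).
  by rewrite le_min le_max lexx orbT /=; lra.
lra.
Qed.

Lemma overlap_full p t c r : 0 <= r -> `|c - p| + r <= t -> overlap p t c r = 2 * r.
Proof.
move=> r0 h; have /andP[h1 h2] : - (t - r) <= c - p <= t - r by rewrite -ler_norml; lra.
have clampE x : p - t <= x <= p + t -> clamp p t x = x.
  by case/andP=> a b; rewrite /clamp max_l// min_l.
by rewrite /overlap !clampE; [lra | lra | lra].
Qed.

Lemma overlap_grid p t c r M : (0 < M)%N ->
  \sum_(0 <= i < M) overlap p t (c + grid_coord r M i) (r / M%:R) = overlap p t c r.
Proof.
move=> M0; have Mr : M%:R != 0 :> R by rewrite pnatr_eq0 -lt0n.
pose x i : R := c - r + 2 * r * (i%:R / M%:R).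
under eq_bigr => i _.
  have -> : overlap p t (c + grid_coord r M i) (r / M%:R) =
      clamp p t (x i.+1) - clamp p t (x i).
    by congr (clamp _ _ _ - clamp _ _ _); rewrite /x /grid_coord -?natr1; field.
  over.
by rewrite telescope_sumr// /overlap; congr (clamp _ _ _ - clamp _ _ _); rewrite /x; field.
Qed.

Local Notation cell := (R[i] * R)%type.

(** The share of the area of Q that lies in the square with centre p and half side t. *)
Definition square_density (p : R[i]) (t : R) (Q : cell) : R :=
  overlap (complex.Re p) t (complex.Re Q.1) Q.2 *
  overlap (complex.Im p) t (complex.Im Q.1) Q.2 / (4 * Q.2 ^+ 2).

Lemma square_density_ge0 p t Q : 0 <= Q.2 -> 0 <= square_density p t Q.
Proof. by move=> r0; rewrite divr_ge0 ?mulr_ge0 ?overlap_ge0 ?sqr_ge0. Qed.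

Lemma square_density_le p t Q : 0 <= t -> 0 < Q.2 -> square_density p t Q <= t ^+ 2 / Q.2 ^+ 2.
Proof.
move=> t0 r0; rewrite ler_pdivrMr; last by rewrite mulr_gt0 ?exprn_gt0.
have -> : t ^+ 2 / Q.2 ^+ 2 * (4 * Q.2 ^+ 2) = (2 * t) * (2 * t) by field; rewrite gt_eqF.
by rewrite ler_pM ?overlap_ge0 ?overlap_le// ltW.
Qed.

Lemma square_density_full p t Q : 0 < Q.2 -> in_square p (t - Q.2) Q.1 ->
  square_density p t Q = 1.
Proof.
move=> r0 /andP[h1 h2]; rewrite /square_density !overlap_full ?(ltW r0)//; [|lra|lra].
by field; rewrite gt_eqF.
Qed.

Lemma square_density_grid p t c r M : (0 < M)%N -> 0 < r ->
  \sum_(0 <= i < M) \sum_(0 <= j < M)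
    square_density p t (grid_center c r M i j, r / M%:R) = M%:R ^+ 2 * square_density p t (c, r).
Proof.
move=> M0 r0; have Mr : M%:R != 0 :> R by rewrite pnatr_eq0 -lt0n.
rewrite /square_density /=.
under eq_bigr => i _ do under eq_bigr => j _ do rewrite -mulrA mulrCA ReD ImD /=.
under eq_bigr => i _ do rewrite -mulr_suml overlap_grid// mulrC -mulrA.
by rewrite -mulr_suml overlap_grid//; field; rewrite gt_eqF//= Mr.
Qed.

Lemma grid_cells_density G p t c r M : (0 < M)%N -> 0 < r ->
  \sum_(Q <- grid_cells G c r M) square_density p t Q <= M%:R ^+ 2 * square_density p t (c, r).
Proof.
move=> M0 r0; rewrite -square_density_grid// big_allpairs_dep /= /index_iota subn0.
apply: ler_sum => i _; rewrite big_filter big_mkcond ler_sum// => j _.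
by case: ifP => // _; rewrite square_density_ge0//= divr_ge0// ltW.
Qed.

End Overlap.

(* Derandomized choice of a branch: some child keeps every partial sum of the
   potentials below c, because the children do so on average. *)
Lemma greedy_branch (R : realType) (T : eqType) (Inv : nat -> T -> Prop) (step : T -> T -> Prop)
    (U : nat -> nat -> T -> R) (c : R) Q0 :
  (forall i n Q, Inv n Q -> 0 <= U i n Q) ->
  (forall n Q, Inv n Q -> exists L : seq T,
     [/\ (0 < size L)%N, forall Q', Q' \in L -> Inv n.+1 Q' /\ step Q Q' &
         forall i, \sum_(Q' <- L) U i n.+1 Q' <= (size L)%:R * U i n Q]) ->
  Inv 0 Q0 -> (forall N, \sum_(0 <= i < N) U i 0 Q0 <= c) ->
  exists Qs : nat -> T, [/\ Qs 0 = Q0, forall n, Inv n (Qs n), forall n, step (Qs n) (Qs n.+1) &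
    forall n N, \sum_(0 <= i < N) U i n (Qs n) <= c].
Proof.
move=> U0 children I0 c0.
pose good n Q := Inv n Q /\ forall N, \sum_(0 <= i < N) U i n Q <= c.
have next n Q : exists Q', good n Q -> good n.+1 Q' /\ step Q Q'.
  have [[IQ hQ]|nQ] := pselect (good n Q); last by exists Q.
  have [L [L0 hL hU]] := children n Q IQ.
  have [[Q' Q'L hQ']|nL] := pselect (exists2 Q', Q' \in L & good n.+1 Q').
    by exists Q' => _; have [_ ?] := hL _ Q'L.
  exfalso.
  have bad Q' : exists N, Q' \in L -> c < \sum_(0 <= i < N) U i n.+1 Q'.
    have [Q'L|] := boolP (Q' \in L); last by exists 0.
    apply: contrapT => /forallNP h; apply: nL; exists Q' => //; split; first by have [] := hL _ Q'L.
    by move=> N; rewrite leNgt; apply/negP => hlt; apply: (h N).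
  have [Nf hNf] := choice bad.
  (* The terms are nonnegative, so all children exceed c at this common index, and averaging over
     them contradicts the bound for the parent. *)
  pose N := \max_(Q' <- L) Nf Q'.
  have : \sum_(Q' <- L) c < \sum_(Q' <- L) \sum_(0 <= i < N) U i n.+1 Q'.
    rewrite big_seq [ltRHS]big_seq; apply: ltr_sum; last first.
      move=> Q' Q'L; apply: lt_le_trans (hNf Q' Q'L) _.
      have le_N : (Nf Q' <= N)%N by exact: leq_bigmax_seq.
      rewrite [leRHS](big_cat_nat (leq0n _) le_N) lerDl sumr_ge0// => i _.
      by apply: U0; have [] := hL _ Q'L.
    by case: L L0 {hL hU nL bad hNf N} => //= x L _; rewrite inE eqxx.
  rewrite exchange_big /= big_const_seq count_predT iter_addr_0 -mulr_natl.
  rewrite ltNge => /negP; apply.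
  apply: le_trans (_ : \sum_(0 <= i < N) (size L)%:R * U i n Q <= _).
    by apply: ler_sum => i _; exact: hU.
  by rewrite -mulr_sumr ler_wpM2l.
have [f hf] := choice (fun p : nat * T => next p.1 p.2).
pose Qs := fix Qs n := if n is m.+1 then f (m, Qs m) else Q0.
have gQ n : good n (Qs n).
  by elim: n => [//|n IH] /=; have [] := hf (n, Qs n) IH.
exists Qs; split => // n; try by have [] := gQ n.
by have [_] := hf (n, Qs n) (gQ n).
Qed.

Section SquareTree.
Context {R : realType}.
Local Notation cell := (R[i] * R)%type.
Variables (Inv : nat -> cell -> Prop) (q : R) (rho : nat -> R).
Hypothesis q_ge0 : 0 <= q.
Hypothesis Inv_gt0 : forall n Q, Inv n Q -> 0 < Q.2.
Hypothesis Inv_rho : forall n Q, Inv n.+1 Q -> Q.2 <= rho n.+1.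
(** [q] bounds the inverse proportion of kept children: restricting an average to them costs at most
    this factor. *)
Hypothesis Inv_children : forall n c r, Inv n (c, r) -> exists M (G : nat -> nat -> bool),
  [/\ (0 < M)%N, M%:R ^+ 2 <= q * (count2 G M)%:R &
      forall i j, (i < M)%N -> (j < M)%N -> G i j ->
        Inv n.+1 (grid_center c r M i j, r / M%:R)].

(* Up to level N, the relative area of the enlarged square in Q, with the loss
   q of every remaining subdivision; from then on Q is small, and either misses
   the square or not. *)
Let potential (p : R[i]) (t : R) N n (Q : cell) : R :=
  if (n <= N)%N then q ^+ (N.+1 - n) * square_density p (3 * t) Q
  else (in_square p (t + Q.2) Q.1)%:R.

(** A cell of half side at most t that meets the square of half side t lies entirely in the one of
    half side 3 t, where its density is 1. *)
Let hit_density p t (Q : cell) : 0 < Q.2 -> Q.2 <= t ->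
  (in_square p (t + Q.2) Q.1)%:R <= square_density p (3 * t) Q.
Proof.
move=> r0 rt; have [/andP[h1 h2]|_] := boolP (in_square _ _ _); last first.
  by rewrite square_density_ge0// ltW.
by rewrite square_density_full//; apply/andP; split; lra.
Qed.

Let hit_subgrid (p : R[i]) (t : R) c r M i j : 0 < r -> (i < M)%N -> (j < M)%N ->
  in_square p (t + r / M%:R) (grid_center c r M i j) -> in_square p (t + r) c.
Proof.
move=> r0 iM jM /andP[h1 h2]; apply/andP; split.
  have := ler_normD (complex.Re (grid_center c r M i j) - complex.Re p) (- grid_coord r M i).
  rewrite normrN; have := grid_coord_bound (ltW r0) iM.
  rewrite /grid_center in h1 *; rewrite ReD /= in h1 *.
  have -> : complex.Re c + grid_coord r M i - complex.Re p - grid_coord r M i =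
    complex.Re c - complex.Re p by ring.
  lra.
have := ler_normD (complex.Im (grid_center c r M i j) - complex.Im p) (- grid_coord r M j).
rewrite normrN; have := grid_coord_bound (ltW r0) jM.
rewrite /grid_center in h2 *; rewrite ImD /= in h2 *.
have -> : complex.Im c + grid_coord r M j - complex.Im p - grid_coord r M j =
  complex.Im c - complex.Im p by ring.
lra.
Qed.

(** The hypothesis on sums bounds the initial potentials by c < 1; below level N i the potential of
    square i is 0 or 1, hence 0 on the chosen branch. *)
Theorem avoiding_branch Q0 (p : nat -> R[i]) (t : nat -> R) (N : nat -> nat) (c : R) :
  Inv 0 Q0 -> c < 1 -> (forall i, 0 < t i) -> (forall i n, (N i < n)%N -> rho n <= t i) ->
  (forall k, \sum_(0 <= i < k) q ^+ (N i).+1 * ((3 * t i) ^+ 2 / Q0.2 ^+ 2) <= c) ->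
  exists Qs : nat -> cell, [/\ Qs 0 = Q0, forall n, Inv n (Qs n),
    forall n z, in_square (Qs n.+1).1 (Qs n.+1).2 z -> in_square (Qs n).1 (Qs n).2 z &
    forall i n, (N i < n)%N -> ~~ in_square (p i) (t i + (Qs n).2) (Qs n).1].
Proof.
move=> I0 c1 t0 rho_t hc.
pose U i := potential (p i) (t i) (N i).
have U0 i n Q : Inv n Q -> 0 <= U i n Q.
  move=> /Inv_gt0 r0; rewrite /U /potential; case: ifP => // _.
  by rewrite mulr_ge0 ?exprn_ge0 ?square_density_ge0// ltW.
pose step (Q Q' : cell) := forall z, in_square Q'.1 Q'.2 z -> in_square Q.1 Q.2 z.
have [||Qs [Qs0 QsI QsS QsU]] := @greedy_branch R _ Inv step U c Q0 U0 _ I0.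
- move=> n [c' r] IQ; have r0 := Inv_gt0 IQ; rewrite /= in r0.
  have [M [G [M0 hM hG]]] := Inv_children IQ.
  have G0 : (0 < count2 G M)%N.
    rewrite lt0n; apply/eqP => G0; move: hM; rewrite G0 mulr0 leNgt.
    by rewrite exprn_gt0// ltr0n.
  have cells Q' : Q' \in grid_cells G c' r M -> Inv n.+1 Q'.
    by move=> /grid_cellsP[i [j [iM jM Gij ->]]]; exact: hG.
  exists (grid_cells G c' r M); rewrite size_grid_cells; split => // [Q' Q'L|i].
    split; first exact: cells.
    case/grid_cellsP: Q'L => [i [j [iM jM _ ->]]] z /=; exact: subgrid_square (ltW r0) iM jM.
  rewrite /U /potential.
  have dens : \sum_(Q' <- grid_cells G c' r M) square_density (p i) (3 * t i) Q' <=
      (count2 G M)%:R * (q * square_density (p i) (3 * t i) (c', r)).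
    apply: le_trans (grid_cells_density _ _ _ _ M0 r0) _.
    by rewrite [leRHS]mulrA (mulrC _ q) ler_wpM2r// square_density_ge0// ltW.
  (* Before level N i the density loses a factor q per level; at N i it turns into the indicator by
     [hit_density]; afterwards the indicator can only drop. *)
  have [nN|] := ltnP n (N i).
    rewrite (ltnW nN) -mulr_sumr subSS (subSn (ltnW nN)) exprS.
    by rewrite (mulrC q) -mulrA mulrCA ler_wpM2l ?exprn_ge0.
  rewrite leq_eqVlt => /orP[/eqP Nn|Nn].
    rewrite Nn leqnn subSnn expr1; apply: le_trans dens.
    rewrite big_seq [leRHS]big_seq; apply: ler_sum => Q' Q'L.
    apply: hit_density; first exact: Inv_gt0 (cells _ Q'L).
    by apply: le_trans (Inv_rho (cells _ Q'L)) _; apply: rho_t; rewrite Nn.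
  rewrite leqNgt Nn /=.
  apply: le_trans (_ : \sum_(Q' <- grid_cells G c' r M) (in_square (p i) (t i + r) c')%:R <= _).
    rewrite big_seq [leRHS]big_seq; apply: ler_sum => Q' /grid_cellsP[a [b [aM bM _ ->]]] /=.
    have [/(hit_subgrid r0 aM bM) ->|_] := boolP (in_square _ _ (grid_center _ _ _ _ _)) => //.
  by rewrite big_const_seq count_predT iter_addr_0 size_grid_cells mulr_natl.
- move=> k; apply: le_trans (hc k); apply: ler_sum => i _.
  rewrite /U /potential /= subn0 ler_wpM2l ?exprn_ge0// square_density_le ?(Inv_gt0 I0)//.
  by rewrite mulr_ge0// ltW.
- exists Qs; split => // i n Nn; apply/negP => hit.
  have := QsU n i.+1; rewrite big_nat_recr//= {2}/U /potential leqNgt Nn hit /=.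
  have : 0 <= \sum_(0 <= j < i) U j n (Qs n) by rewrite sumr_ge0// => j _; exact: U0.
  by move: c1; clear; lra.
Qed.

End SquareTree.

(** * Escaping cells and their limit points in the Julia set *)

Section EscapingTree.
Context {R : realType}.
Local Notation cell := (R[i] * R)%type.

Lemma count2_predC (p : nat -> nat -> bool) M :
  (count2 p M + count2 (fun i j => ~~ p i j) M = M ^ 2)%N.
Proof.
rewrite /count2 -big_split /=.
under eq_bigr => i _ do rewrite count_predC size_iota.
by rewrite sum_nat_const_nat subn0.
Qed.

Lemma Re_cE_polar (lam z : R[i]) (th : R) : lam = (normc lam)%:C * cexp (0 +i* th) ->
  complex.Re (cE lam z) = normc (cE lam z) * cos (complex.Im z + th).
Proof.
move=> lamE; rewrite normc_cE.
have -> : cE lam z = (normc lam)%:C * cexp (z + (0 +i* th)).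
  by rewrite /cE {1}lamE cexpD mulrAC mulrA.
by rewrite /cexp ReD ImD /= addr0 mul0r subr0 mulrA.
Qed.

Variables (lam : R[i]) (th d eps tau q : R) (Y : nat -> R).
Local Notation E := (cE lam).
Local Notation D := (iter_deriv lam).

Hypothesis lamE : lam = (normc lam)%:C * cexp (0 +i* th).
Hypothesis d_range : 0 < d <= 1 / 52.
Hypothesis eps_range : 0 < eps <= sin d / 8.
Hypothesis distort : forall (z0 : R[i]) (r : R) n, 0 <= r -> expanding_upto lam 2 z0 n ->
    normc (D z0 n) * r <= eps ->
    forall j, (j <= n.+1)%N -> affine_on lam z0 r (d / 2) j.
Hypothesis tau_range : [/\ 0 < tau, tau <= d / 2 & 15 * tau <= eps].
Hypothesis Y_ge2 : forall n, 2 <= Y n.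
Hypothesis Y_large : forall n, 102 <= d * (tau * Y n).
(** On the whole cell Re E^(n+1) keeps at least half of the centre's bound, that is (sin d / 2)
    Y_(n+1), which makes the next modulus exceed Y_(n+2). *)
Hypothesis Y_step : forall n, Y n.+1 <= normc lam * expR (sin d / 2 * Y n).
Hypothesis q_large : 1 <= q * (1 / 2 - 13 * d).

(* By the last condition Re E^(n+1) is of the order of |E^(n+1)| on all of Q,
   so that |E^(n+2)| is exponentially large there. *)
Definition escaping_cell n (Q : cell) : Prop :=
  [/\ 0 < Q.2 /\ Q.2 * Y n <= 1,
      forall z, in_square Q.1 Q.2 z -> forall j, (1 <= j <= n.+1)%N -> Y j <= normc (iter j E z),
      normc (D Q.1 n) * (5 * Q.2) <= eps,
      17 / d <= Q.2 * normc (D Q.1 n.+1) &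
      sin d * normc (iter n.+1 E Q.1) <= complex.Re (iter n.+1 E Q.1)].

Lemma escaping_cell_expanding n Q z m : escaping_cell n Q -> in_square Q.1 Q.2 z ->
  (m <= n.+1)%N -> expanding_upto lam 2 z m.
Proof.
move=> [_ h _ _ _] hz mn j /andP[j1 jm]; apply: le_trans (Y_ge2 j) (h _ hz _ _).
by rewrite j1 (leq_trans jm mn).
Qed.

Lemma escaping_cell_affine n Q j : escaping_cell n Q -> (j <= n.+1)%N ->
  affine_on lam Q.1 (5 * Q.2) (d / 2) j.
Proof.
move=> hQ jn; have [[r0 _] h1 h2 _ _] := hQ; apply: distort h2 _ jn.
  by rewrite mulr_ge0// ltW.
by apply: escaping_cell_expanding hQ _ (leqnSn _); rewrite in_square_center// ltW.
Qed.

(** The n-th iterate varies by at most eps <= sin d / 8, so E^(n+1) varies by the relative amount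
    sin d / 2, half of what the centre guarantees for its real part. *)
Lemma escaping_cell_next n Q z : escaping_cell n Q -> in_square Q.1 Q.2 z ->
  Y n.+2 <= normc (iter n.+2 E z).
Proof.
move=> hQ hz; have [[r0 _] h1 h2 _ h4] := hQ.
have /andP[e0 e1] := eps_range.
have /andP[d0 d1] := d_range.
have cQ : in_square Q.1 Q.2 Q.1 by rewrite in_square_center// ltW.
have zc := in_square_normc hz.
have [u hu Eu] : exists2 u, normc (u - 1) <= d / 2 &
    iter n E z - iter n E Q.1 = D Q.1 n * (z - Q.1) * u.
  apply: (escaping_cell_affine hQ (leqnSn _)); first by lra.
  by rewrite subrr normc0; lra.
have u2 : normc u <= 2 by have := ler_normcB u 1; rewrite normc1; lra.
have Dz : normc (D Q.1 n) * normc (z - Q.1) <= normc (D Q.1 n) * (2 * Q.2).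
  by rewrite ler_wpM2l ?normc_ge0.
have zn : normc (iter n E z - iter n E Q.1) <= eps.
  rewrite Eu !normcM; apply: le_trans (_ : normc (D Q.1 n) * (2 * Q.2) * 2 <= _).
    by rewrite ler_pM ?mulr_ge0 ?normc_ge0.
  have : 0 <= normc (D Q.1 n) * Q.2 by rewrite mulr_ge0 ?normc_ge0// ltW.
  lra.
have sin1 := sin_le1 d.
have hexp : normc (cexp (iter n E z - iter n E Q.1) - 1) <= sin d / 2.
  apply: le_trans (cexp_sub1_le _) _; lra.
have := cE_diff lam (iter n E Q.1) (iter n E z); rewrite -!iterS => diffE.
have Nd : normc (iter n.+1 E z - iter n.+1 E Q.1) <= sin d / 2 * normc (iter n.+1 E Q.1).
  by rewrite diffE normcM mulrC ler_wpM2r ?normc_ge0.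
have := ler_Re_normc (iter n.+1 E z - iter n.+1 E Q.1).
rewrite ReB ler_norml => /andP[Rd _].
have Yc := h1 _ cQ n.+1; rewrite leqnn /= in Yc.
rewrite [iter n.+2 E z]iterS normc_cE; apply: le_trans (Y_step _) _.
rewrite ler_wpM2l ?normc_ge0// ler_expR.
have := ler_wpM2l (_ : 0 <= sin d / 2) (Yc isT); lra.
Qed.

(** Chosen so that a child has half side between tau / (2 |D_(n+1)|) and tau / |D_(n+1)|. *)
Definition subdivision n (Q : cell) : nat :=
  (Num.truncn (Q.2 * normc (D Q.1 n.+1) / tau)).+1.

Lemma subdivision_bounds n Q : escaping_cell n Q ->
  Q.2 * normc (D Q.1 n.+1) <= tau * (subdivision n Q)%:R <= 2 * (Q.2 * normc (D Q.1 n.+1)).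
Proof.
move=> [[r0 _] _ _ h3 _]; have [t0 t1 _] := tau_range.
have /andP[d0 d1] := d_range.
set X := Q.2 * _ in h3 *.
have X17 : 17 <= X.
  apply: le_trans h3; rewrite ler_pdivlMr//; lra.
apply/andP; split.
  by rewrite mulrC -ler_pdivrMr// ltW// truncnS_gt.
have : (Num.truncn (X / tau))%:R <= X / tau by rewrite truncn_le divr_ge0//; lra.
rewrite ler_pdivlMr// /subdivision -/X -natr1; lra.
Qed.

Lemma escaping_cell_count n c r M t : escaping_cell n (c, r) -> M = subdivision n (c, r) ->
  (count2 (fun i j => - sin d <=
     cos (complex.Im (iter n.+1 E (grid_center c r M i j)) + t)) M)%:R
    <= (1 / 2 + 13 * d) * M%:R ^+ 2.
Proof.
move=> hQ ->; have [[r0 _] _ _ h3 _] := hQ; rewrite /= in r0.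
have [t0 t1 _] := tau_range; have /andP[d0 d1] := d_range.
have /andP[M1 _] := subdivision_bounds hQ.
apply: (@count_half_grid _ d _ (iter n.+1 E) (D c n.+1)) => //.
- by apply/andP; split; lra.
- move=> z w hz hw; apply: (escaping_cell_affine hQ (leqnn _)) => /=.
    by have := in_square_normc hz; lra.
  by have := in_square_normc hw; lra.
- rewrite /= in M1; have := ler_wpM2r (ler0n R (subdivision n (c, r))) t1.
  by move: M1; lra.
Qed.

Lemma escaping_cell_children n c r : escaping_cell n (c, r) ->
  exists M (G : nat -> nat -> bool),
  [/\ (0 < M)%N, M%:R ^+ 2 <= q * (count2 G M)%:R &
      forall i j, (i < M)%N -> (j < M)%N -> G i j ->
        escaping_cell n.+1 (grid_center c r M i j, r / M%:R)].
Proof.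
move=> hQ; have [[r0 _] h1 h2 h3 _] := hQ; rewrite /= in r0 h1 h2 h3.
have [t0 t1 t2] := tau_range; have /andP[d0 d1] := d_range.
have /andP[M1 M2] := subdivision_bounds hQ.
have [M ME] : exists M, M = subdivision n (c, r) by exists (subdivision n (c, r)).
have M0 : (0 < M)%N by rewrite ME.
have cnt t := escaping_cell_count t hQ ME; rewrite -ME /= in M1 M2; clear ME.
have Mr : 0 < M%:R :> R by rewrite ltr0n.
(* The shift by pi turns the count into one of the cells with cosine at most sin d; the complement,
   at least the share 1/2 - 13 d, is kept. *)
pose N i j := - sin d <= cos (complex.Im (iter n.+1 E (grid_center c r M i j)) + (th + pi)).
exists M, (fun i j => ~~ N i j); split => //.
  have := congr1 (fun k : nat => k%:R : R) (count2_predC N M).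
  rewrite natrD natrX => hc; have := cnt (th + pi); rewrite -/(N _ _) => hN.
  have N0 : 0 <= (count2 (fun i j => ~~ N i j) M)%:R :> R by [].
  have h : (1 / 2 - 13 * d) * M%:R ^+ 2 <= (count2 (fun i j => ~~ N i j) M)%:R.
    by move: hc hN; rewrite /N; lra.
  have q0 : 0 <= q.
    rewrite leNgt; apply/negP => q0.
    have := q_large; have : q * (1 / 2 - 13 * d) <= 0 by rewrite mulr_le0_ge0//; lra.
    lra.
  have := ler_wpM2l q0 h; have := ler_wpM2r (sqr_ge0 (M%:R : R)) q_large.
  rewrite mulrA; lra.
move=> i j iM jM; rewrite -ltNge addrA cosDpi ltrN2 => Gij.
set c' := grid_center c r M i j in Gij *; set r' := r / M%:R.
have r'0 : 0 < r' by rewrite divr_gt0.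
have c'Q : in_square c r c' by apply: grid_center_in_square => //; exact: ltW.
have sub z : in_square c' r' z -> in_square c r z by exact: subgrid_square (ltW r0) iM jM.
have Yz z k : in_square c' r' z -> (1 <= k <= n.+2)%N -> Y k <= normc (iter k E z).
  move=> /sub hz /andP[k1]; rewrite leq_eqVlt => /orP[/eqP ->|kn].
    exact: (escaping_cell_next hQ hz).
  by apply: h1; rewrite ?k1.
have aff2 : affine_on lam c (5 * r) (1 / 2) n.+1.
  move=> z w hz hw; have [u hu Eu] := escaping_cell_affine hQ (leqnn _) hz hw.
  by exists u => //; move: hu d1; lra.
have two1 : (1 : R) < 2 by lra.
have c'c : normc (c' - c) < 5 * r by have := in_square_normc c'Q; lra.
have [D1 D2] := deriv_compare two1 (escaping_cell_expanding hQ c'Q (leqnn _)) aff2 c'c.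
set A := normc (D c n.+1) in D1 D2 M1 M2 h3 *.
have rM : r = r' * M%:R by rewrite /r' divfK// gt_eqF.
have A1 : r' * A <= tau by rewrite -(ler_pM2r Mr) mulrAC -rM.
have A2 : tau <= 2 * (r' * A) by rewrite -(ler_pM2r Mr) -mulrA (mulrAC r') -rM.
have cQ : in_square c r c by rewrite in_square_center// ltW.
have A3 : Y n.+1 <= A.
  rewrite /A normc_iter_derivS.
  have := iter_deriv_mono (ltW two1) (leq0n n) (escaping_cell_expanding hQ cQ (leqnSn _)).
  rewrite iter_deriv0 normc1 => hD; apply: le_trans (h1 _ cQ n.+1 _) _; first by rewrite leqnn.
  by rewrite ler_peMl ?normc_ge0.
have c'Q' : in_square c' r' c' by rewrite in_square_center// ltW.
have YE := Yz c' n.+2 c'Q'; rewrite leqnn /= in YE; have {}YE := YE isT.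
split => /=.
- split=> //; apply: le_trans (_ : tau <= 1); last by lra.
  by apply: le_trans A1; rewrite ler_pM2l.
- by move=> z hz k hk; exact: Yz.
- apply: le_trans (_ : 3 * A * (5 * r') <= _); last by lra.
  by rewrite ler_pM2r//; lra.
- rewrite -[iter_deriv _ _ _]/(D c' n.+2) normc_iter_derivS.
  apply: le_trans (_ : r' * (A / 3 * Y n.+2) <= _); last first.
    rewrite ler_pM2l// ler_pM//; first by rewrite divr_ge0// /A normc_ge0.
    + by have := Y_ge2 n.+2; lra.
    + by lra.
  rewrite ler_pdivrMr//.
  have Y0 : 0 <= Y n.+2 by have := Y_ge2 n.+2; lra.
  have := ler_wpM2r Y0 A2; have := Y_large n.+2.
  have := ltW d0; move: Y0; nra.
- rewrite -[cE lam (cE lam _)]/(iter n.+2 E c') [in leRHS]iterS (Re_cE_polar _ lamE) -iterS.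
  by rewrite mulrC ler_wpM2l ?normc_ge0// ltW.
Qed.

(** Cells whose centre has cosine at least -sin d make up at most 1/2 + 13 d <= 3/4, so some centre
    has Re E^(n+2) <= 0. *)
Lemma escaping_cell_bounded_point n Q : escaping_cell n Q ->
  exists2 w, in_square Q.1 Q.2 w & normc (iter n.+3 E w) <= normc lam.
Proof.
case: Q => c r hQ; have [[r0 _] _ _ _ _] := hQ; rewrite /= in r0.
have /andP[d0 d1] := d_range.
have [M ME] : exists M, M = subdivision n (c, r) by exists (subdivision n (c, r)).
have M0 : (0 < M)%N by rewrite ME.
have cnt := escaping_cell_count th hQ ME; clear ME.
have Mr : 0 < M%:R ^+ 2 :> R by rewrite exprn_gt0// ltr0n.
have [[i [j [iM jM]]]|none] := pselect (exists i j, [/\ (i < M)%N, (j < M)%N &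
  ~~ (- sin d <= cos (complex.Im (iter n.+1 E (grid_center c r M i j)) + th))]).
  rewrite -ltNge => hlt; exists (grid_center c r M i j).
    by apply: grid_center_in_square => //; exact: ltW.
  rewrite [iter n.+3 _ _]iterS normc_cE ler_piMr ?normc_ge0// -expR0 ler_expR.
  rewrite iterS (Re_cE_polar _ lamE) mulr_ge0_le0 ?normc_ge0//.
  have s0 := @sin_ge_half R d; have := s0 _; move: hlt d0 d1; lra.
exfalso.
move: cnt; rewrite (_ : count2 _ M = (M ^ 2)%N); last first.
  rewrite -[RHS](count2_predC (fun i j =>
    - sin d <= cos (complex.Im (iter n.+1 E (grid_center c r M i j)) + th))).
  rewrite [X in (_ + X)%N](_ : _ = 0%N) ?addn0//.
  rewrite /count2 big_nat big1// => i /andP[_ iM].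
  apply/eqP; rewrite -leqn0 leqNgt -has_count; apply/negP => /hasP[j].
  rewrite mem_iota add0n => /andP[_ jM] h; apply: none; exists i, j; split => //.
rewrite natrX; nra.
Qed.

End EscapingTree.

Section EscapingLimit.
Context {R : realType}.
Local Notation C := (cplane R).
Local Notation cell := (R[i] * R)%type.

Lemma nested_intervals (a b : nat -> R) : (forall n, a n <= a n.+1) ->
  (forall n, b n.+1 <= b n) -> (forall n, a n <= b n) ->
  exists x, forall n, a n <= x <= b n.
Proof.
move=> ha hb hab.
have a_mono : {homo a : m n / (m <= n)%N >-> m <= n}.
  by apply: homo_leq ha => [//|? ? ?]; exact: le_trans.
have b_mono : {homo b : m n / (m <= n)%N >-> n <= m}.
  by apply: (homo_leq (r := fun x y => y <= x)) hb => [//|? ? ? h1 h2]; exact: le_trans h2 h1.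
have ub n : ubound (range a) (b n).
  move=> _ [m _ <-]; apply: le_trans (a_mono _ _ (leq_maxl m n)) _.
  by apply: le_trans (hab _) (b_mono _ _ (leq_maxr m n)).
exists (sup (range a)) => n; apply/andP; split.
  by apply: ub_le_sup; [exists (b 0) | exists n].
by apply: ge_sup => //; exists (a 0), 0.
Qed.

Lemma nested_squares (Qs : nat -> cell) : (forall n, 0 <= (Qs n).2) ->
  (forall n z, in_square (Qs n.+1).1 (Qs n.+1).2 z -> in_square (Qs n).1 (Qs n).2 z) ->
  exists z, forall n, in_square (Qs n).1 (Qs n).2 z.
Proof.
move=> r0 nest.
have corner n s : `|s| <= 1 ->
    in_square (Qs n).1 (Qs n).2 ((Qs n).1 + ((s * (Qs n).2) +i* (s * (Qs n).2))).
  move=> s1; rewrite /in_square ReD ImD /= ![_ + s * _ - _]addrAC !subrr !add0r.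
  by rewrite normrM (ger0_norm (r0 n)) ler_piMl.
have Nm1 : `|-1 : R| <= 1 by rewrite normrN1.
have N1 : `|1 : R| <= 1 by rewrite normr1.
have le n := conj (nest n _ (corner n.+1 _ Nm1)) (nest n _ (corner n.+1 _ N1)).
rewrite /in_square in le.
have [x hx] : exists x, forall n,
    complex.Re (Qs n).1 - (Qs n).2 <= x <= complex.Re (Qs n).1 + (Qs n).2.
  apply: nested_intervals => n; last by have := r0 n; lra.
  - by have [/andP[+ _] _] := le n; rewrite ReD /= ler_norml => /andP[]; lra.
  - by have [_ /andP[+ _]] := le n; rewrite ReD /= ler_norml => /andP[]; lra.
have [y hy] : exists y, forall n,
    complex.Im (Qs n).1 - (Qs n).2 <= y <= complex.Im (Qs n).1 + (Qs n).2.
  apply: nested_intervals => n; last by have := r0 n; lra.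
  - by have [/andP[_ +] _] := le n; rewrite ImD /= ler_norml => /andP[]; lra.
  - by have [_ /andP[_ +]] := le n; rewrite ImD /= ler_norml => /andP[]; lra.
exists (x +i* y) => n; have /andP[x1 x2] := hx n; have /andP[y1 y2] := hy n.
by apply/andP; split; rewrite /= ler_norml; apply/andP; split; lra.
Qed.

Lemma compact_square (c : R[i]) (r : R) : compact ([set z : C | in_square c r z] : set C).
Proof.
pose f (p : R * R) : C := (p.1 +i* p.2).
pose A := `[complex.Re c - r, complex.Re c + r]%classic : set R.
pose B := `[complex.Im c - r, complex.Im c + r]%classic : set R.
have -> : [set z : C | in_square c r z] = f @` (A `*` B).
  apply/seteqP; split => [z /= /andP[]|_ [[x y] [/= + +] <-]].
    rewrite !ler_norml => /andP[h1 h2] /andP[h3 h4]; exists (complex.Re z, complex.Im z).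
      by split; rewrite /A /B /= in_itv /=; apply/andP; split; lra.
    by case: z {h1 h2 h3 h4}.
  rewrite /A /B /= !in_itv /= => /andP[h1 h2] /andP[h3 h4].
  by rewrite /in_square !ler_norml /=; do 2!(apply/andP; split); lra.
apply: continuous_compact; last by apply: compact_setX; exact: segment_compact.
apply: continuous_subspaceT => p V /nbhs_cplaneP[e e0 hV].
have e20 : 0 < e / 2 by rewrite divr_gt0.
exists (ball p.1 (e / 2), ball p.2 (e / 2)); first by split; exact: nbhsx_ballx.
move=> [x y] [/= hx hy]; apply: hV.
apply: le_lt_trans (normc_leD _) _; rewrite /f ReB ImB /=.
by move: hx hy; rewrite -!ball_normE /= !(distrC p.1) !(distrC p.2); lra.
Qed.

Variables (lam : R[i]) (d eps : R) (Y : nat -> R).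
Local Notation E := (cE lam).
Hypothesis Y_ge2 : forall n, 2 <= Y n.
Hypothesis Y_unbounded : forall A, exists N, forall n, (N <= n)%N -> A <= Y n.

(** A finite limit contradicts the escape of z itself; uniform divergence on a small square about z
    contradicts the points of the cells that return to modulus at most |lam|. *)
Lemma escaping_branch_julia (Qs : nat -> cell) (z : R[i]) :
  (forall n, escaping_cell lam d eps Y n (Qs n)) ->
  (forall n, exists2 w, in_square (Qs n).1 (Qs n).2 w & normc (iter n.+3 E w) <= normc lam) ->
  (forall n, in_square (Qs n).1 (Qs n).2 z) -> julia (Eexp lam) z.
Proof.
move=> hQ bounded hz [U [Uopen Uz] nU].
have zY n : (0 < n)%N -> Y n <= normc (iter n E z).
  by move=> n0; have [_ h _ _ _] := hQ n; apply: h => //; rewrite n0 leqnSn.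
have [s [s_incr]] := nU (fun n => iter n (Eexp lam)) (fun n => ex_intro2 _ _ n I erefl).
have s_ge n : (n <= s n)%N.
  by elim: n => // n IH; apply: leq_ltn_trans IH _; exact: s_incr.
case=> [[g hg]|hesc].
  have K1 : [set z : C] `<=` U by move=> _ ->.
  have [N hN] := uniform_cvg_point (hg _ (@compact_set1 _ _) K1) ltr01.
  have [N' hN'] := Y_unbounded (normc (g z) + 1).
  pose n := maxn N (maxn N' 1).
  have nN : (N <= n)%N by rewrite leq_maxl.
  have sn : (maxn N' 1 <= s n)%N by apply: leq_trans (s_ge n); rewrite leq_maxr.
  move: sn; rewrite geq_max => /andP[sN' s1].
  have := hN n nN; have := hN' _ sN'; have := zY _ s1.
  have := ler_normcB (iter (s n) E z) (g z : R[i]); rewrite normc_distC => h1 h2 h3.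
  rewrite /= -[iter (s n) (Eexp lam) z]/(iter (s n) E z) => h4.
  lra.
have /nbhs_cplaneP[e e0 hU] : nbhs (z : C) U by exact: open_nbhs_nbhs.
pose K := [set w : C | in_square z (e / 4) w].
have KU : K `<=` U.
  move=> w hw; apply: hU; have := in_square_normc hw; lra.
have [N _ hN] := hesc K (@compact_square _ _) KU (normc lam).
have [N' hN'] := Y_unbounded (16 / e).
(* The cell of level n controls a return at time n + 3, so the extracted index s k is written as n +
   3. *)
pose k := (maxn N N').+3.
have kN : (N <= k)%N by apply: leq_trans (leq_maxl _ N') _; rewrite 3?leqW.
have sk : (k <= s k)%N := s_ge k.
have [n En] : exists n, s k = n.+3 by exists (s k - 3)%N; rewrite -addn3 subnK// (leq_trans _ sk).
have nN' : (N' <= n)%N.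
  by move: sk; rewrite En !ltnS => h; apply: leq_trans h; exact: leq_maxr.
have [w wQ hw] := bounded n.
have Kw : K w.
  apply: normc_in_square; apply: le_trans (in_square_dist wQ (hz n)) _.
  have [[r0 rY] _ _ _ _] := hQ n.
  have := hN' _ nN'; rewrite ler_pdivrMr// => h.
  have := Y_ge2 n; nra.
by have := hN k kN w Kw; rewrite En ltNge => /negP; apply.
Qed.

End EscapingLimit.

(** The gauge grows by q = b^s > 2 along one step of the real orbit, and the same q pays for keeping
    slightly less than half of the children. So the initial potential of a square of size t is at
    most a constant times t^2 Phi(1/t)^s. *)
Theorem julia_avoids_squares (R : realType) (l0 b s : R) (Phi : R -> R) (lam : R[i]) :
  0 < l0 -> 1 < b -> l0 * expR b = b ->
  (forall x, b <= x -> Phi (l0 * expR x) = b * Phi x) ->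
  (forall e, 0 < e -> exists2 d, 0 < d &
    forall x, b <= x -> x - b < d -> `|Phi x - (x - b)| <= e * (x - b)) ->
  ln 2 < s * ln b -> lam != 0 ->
  exists e tm, [/\ 0 < e, 0 < tm & forall (p : nat -> R[i]) (t : nat -> R),
    (forall i, 0 < t i < tm) ->
    (forall k, \sum_(0 <= i < k) t i ^+ 2 * koenigs_gauge Phi s (1 / t i) <= e) ->
    exists2 z, julia (Eexp lam) z & forall i, ~~ in_square (p i) (t i) z].
Proof.
move=> l0_gt0 b_gt1 fix_b PhiE Phi_germ hs lam0.
have lnb : 0 < ln b by rewrite ln_gt0.
have ln2 : 0 < ln 2 :> R by rewrite ln_gt0// ltr1n.
have s0 : 0 <= s by rewrite -(pmulr_lge0 _ lnb) ltW// (lt_trans ln2).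
pose q := expR (s * ln b).
have q2 : 2 < q by rewrite /q -[ltLHS]lnK ?posrE// ltr_expR.
have q0 : 0 < q by clear - q2; lra.
have [th _ lamE] := polar_form lam0.
have A0 : 0 < normc lam by rewrite normc_gt0.
set A := normc lam in A0.
pose d := Num.min (1 / 52) ((1 / 2 - 1 / q) / 13).
have q12 : 0 < 1 / 2 - 1 / q.
  by rewrite subr_gt0 ltr_pM2l// ltf_pV2 ?posrE.
have d0 : 0 < d by rewrite lt_min !divr_gt0.
have d1 : d <= 1 / 52 by rewrite ge_min lexx.
have d_range : 0 < d <= 1 / 52 by rewrite d0.
have d2 : 13 * d <= 1 / 2 - 1 / q.
  by rewrite mulrC -ler_pdivlMr// ge_min lexx orbT.
have q_large : 1 <= q * (1 / 2 - 13 * d).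
  have : q * (1 / q) <= q * (1 / 2 - 13 * d) by rewrite ler_pM2l//; clear - d2; lra.
  by rewrite mulrCA divff ?gt_eqF// mulr1.
have sd0 : 0 < sin d.
  by apply: lt_le_trans (sin_ge_half _); [rewrite divr_gt0|clear - d0 d1; lra].
have d20 : 0 < d / 2 by rewrite divr_gt0.
have two1 : 1 < 2 :> R by rewrite ltr1n.
have [eps0 eps00 dist] := distortion_le two1 d20.
pose eps := Num.min eps0 (sin d / 8).
have eps_gt0 : 0 < eps by rewrite lt_min eps00 divr_gt0.
have eps_range : 0 < eps <= sin d / 8 by rewrite eps_gt0 ge_min lexx orbT.
have distort (z0 : R[i]) (r : R) n : 0 <= r -> expanding_upto lam 2 z0 n ->
    normc (iter_deriv lam z0 n) * r <= eps ->
    forall j, (j <= n.+1)%N -> affine_on lam z0 r (d / 2) j.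
  by move=> r0 h hD; apply: dist => //; apply: le_trans hD _; rewrite ge_min lexx.
pose tau := Num.min (d / 2) (eps / 15).
have tau0 : 0 < tau by rewrite lt_min d20 divr_gt0.
have tau_range : [/\ 0 < tau, tau <= d / 2 & 15 * tau <= eps].
  by split => //; rewrite ?ge_min ?lexx// mulrC -ler_pdivlMr// ge_min lexx orbT.
(* With Y = X / kap one has (sin d / 2) Y = 2 X; one factor e^X is the next real orbit step and the
   other absorbs the constants. *)
pose kap := sin d / 4.
have kap0 : 0 < kap by rewrite divr_gt0.
have kap1 : kap <= 1 by have := sin_le1 d; rewrite /kap; clear; lra.
pose x0 := Num.max (b + 1) (Num.max 2 (Num.max (102 / (d * tau)) (l0 / (kap * A)))).
have [x01 x02 x03 x04] : [/\ b + 1 <= x0, 2 <= x0, 102 / (d * tau) <= x0 & l0 / (kap * A) <= x0].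
  by split; rewrite /x0 !le_max lexx ?orbT.
have bx0 : b < x0 by clear - x01; lra.
pose X n := iter n (fun x => l0 * expR x) x0.
have X_mono m n : (m <= n)%N -> X m <= X n by exact: (real_orbit_mono b_gt1 fix_b bx0).
have X_ge n : x0 <= X n by apply: (X_mono 0).
have X_gt n : b < X n by exact: lt_le_trans bx0 (X_ge n).
pose Y n := X n / kap.
have XY n : X n <= Y n.
  by rewrite /Y ler_pdivlMr// ler_piMr// ltW// (lt_trans _ (X_gt n))// (lt_trans ltr01).
have Y_mono m n : (m <= n)%N -> Y m <= Y n.
  by move=> mn; rewrite /Y ler_pM2r ?invr_gt0// X_mono.
have Y_ge2 n : 2 <= Y n by rewrite (le_trans x02)// (le_trans (X_ge n)).
have Y_gt0 n : 0 < Y n by rewrite (lt_le_trans _ (Y_ge2 n)).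
have Y_large n : 102 <= d * (tau * Y n).
  have : 102 / (d * tau) <= Y n by rewrite (le_trans x03)// (le_trans (X_ge n)).
  by rewrite ler_pdivrMr ?mulr_gt0// mulrC -mulrA.
have Y_step n : Y n.+1 <= A * expR (sin d / 2 * Y n).
  have -> : sin d / 2 * Y n = X n + X n by rewrite /Y /kap; field; rewrite gt_eqF.
  have -> : Y n.+1 = l0 / kap * expR (X n) by rewrite /Y /= mulrAC.
  rewrite expRD mulrA ler_pM2r ?expR_gt0//.
  have : l0 / (kap * A) <= expR (X n).
    apply: le_trans x04 (le_trans (X_ge n) _); apply: le_trans (expR_ge1Dx _).
    by rewrite lerDr.
  rewrite ler_pdivrMr ?mulr_gt0// ler_pdivrMr//.
  by rewrite (_ : expR (X n) * _ = A * expR (X n) * kap)//; ring.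
have Y_unbounded B : exists N, forall n, (N <= n)%N -> B <= Y n.
  have [N hN] := real_orbit_unbounded b_gt1 fix_b bx0 B; exists N => n Nn.
  by apply: le_trans (hN n Nn) (XY n).
pose r := Num.min (eps / 5) (1 / Y 0).
have invY0 : 0 < 1 / Y 0 by rewrite mul1r invr_gt0.
have r0 : 0 < r by rewrite lt_min invY0 divr_gt0.
have rY : r * Y 0 <= 1 by rewrite -ler_pdivlMr// ge_min lexx orbT.
have r_eps : 5 * r <= eps by rewrite mulrC -ler_pdivlMr// ge_min lexx.
have r1 : r <= 1 by have := Y_ge2 0; clear - rY r0; nra.
(* As a <= e^(a - 1), the first image of the square about a - i th, with r <= 1, has modulus at
   least A a; the imaginary part -th makes the image of the centre a positive real. *)
pose a := Num.max (Y 1) (17 / (d * r)) / A.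
have aA : A * a = Num.max (Y 1) (17 / (d * r)) by rewrite /a mulrC divfK// gt_eqF.
have ea : a <= expR (a - 1) by have := expR_ge1Dx (a - 1); clear; lra.
pose Q0 : R[i] * R := (a +i* - th, r).
have IQ0 : escaping_cell lam d eps Y 0 Q0.
  have N1 : Num.max (Y 1) (17 / (d * r)) <= A * expR (a - 1) by rewrite -aA ler_pM2l.
  split => /=.
  - by [].
  - move=> z /andP[+ _] [|[|j]]// _; rewrite /= => hz.
    rewrite normc_cE; apply: le_trans (_ : A * expR (a - 1) <= _).
      by apply: le_trans N1; rewrite le_max lexx.
    rewrite ler_pM2l// ler_expR; move: hz; rewrite ler_norml => /andP[hz _].
    by clear - hz r1; lra.
  - by rewrite iter_deriv0 normc1 mul1r.
  - rewrite normc_iter_derivS iter_deriv0 normc1 mul1r /= normc_cE /=.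
    have : 17 / (d * r) <= A * expR a.
      apply: le_trans (_ : A * expR (a - 1) <= _).
        by apply: le_trans N1; rewrite le_max lexx orbT.
      by rewrite ler_pM2l// ler_expR lerBlDr lerDl.
    by rewrite invfM mulrA ler_pdivrMr// (mulrC r).
  - by rewrite (Re_cE_polar _ lamE) /= addNr cos0 mulr1 ler_piMl ?normc_ge0 ?sin_le1.
have q_ge0 := ltW q0.
pose rho n := 1 / Y n.
pose Psi := koenigs_gauge Phi s.
have Phi_x0 : 0 < Phi x0 by exact: (koenigs_pos l0_gt0 b_gt1 fix_b PhiE Phi_germ).
have Phi_X n : Phi (X n) = b ^+ n * Phi x0 by exact: koenigs_iter.
have Psi_X n : Psi (X n) = q ^+ n * Psi x0.
  have b0 : 0 < b by exact: lt_trans ltr01 b_gt1.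
  rewrite /Psi /koenigs_gauge Phi_X lnM ?posrE ?exprn_gt0// lnXn// mulrDr expRD.
  by rewrite /q -expRM_natl; congr (expR _ * _); rewrite -mulr_natr; ring.
have Psi_x0 : 0 < Psi x0 by exact: expR_gt0.
have level t : 0 < t < 1 / Y 0 ->
    exists N, (forall n, (N < n)%N -> rho n <= t) /\ Y N <= 1 / t.
  move=> /andP[t0 tY].
  have tY0 : Y 0 < 1 / t by rewrite ltr_pdivlMr// mulrC -ltr_pdivlMr.
  have ex : exists n, 1 / t <= Y n by have [N hN] := Y_unbounded (1 / t); exists N; exact: hN.
  case: (ex_minnP ex) => [[|N] hN Nmin]; first by move: hN; rewrite leNgt tY0.
  exists N; split => [n Nn|].
    have := le_trans hN (Y_mono _ _ Nn).
    by rewrite /rho ler_pdivrMr// ler_pdivrMr// mulrC.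
  by rewrite leNgt; apply/negP => /ltW/Nmin; rewrite ltnn.
(* The 9 is (3 t)^2 / t^2 and q the extra level; q^N Psi x0 = Psi(X N) <= Psi(1/t) since X N <= Y N
   <= 1/t. *)
pose K := 9 * q / (r ^+ 2 * Psi x0).
have K0 : 0 < K by rewrite divr_gt0 ?mulr_gt0 ?exprn_gt0.
have term t N : 0 < t -> Y N <= 1 / t ->
    q ^+ N.+1 * ((3 * t) ^+ 2 / r ^+ 2) <= K * (t ^+ 2 * Psi (1 / t)).
  move=> t0 hN.
  have h : q ^+ N * Psi x0 <= Psi (1 / t).
    rewrite -Psi_X; apply: (koenigs_gauge_mono l0_gt0 b_gt1 fix_b PhiE Phi_germ s0) => //.
    exact: le_trans (XY N) hN.
  have -> : q ^+ N.+1 * ((3 * t) ^+ 2 / r ^+ 2) = K * t ^+ 2 * (q ^+ N * Psi x0).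
    by rewrite /K exprS; field; rewrite !gt_eqF.
  by rewrite [leRHS]mulrA ler_wpM2l// mulr_ge0 ?sqr_ge0// ltW.
exists (1 / (2 * K)), (1 / Y 0); split => [||p t ht hsum]; first by rewrite mul1r invr_gt0 pmulr_rgt0.
  exact: invY0.
have [N hN] := choice (fun i => level (t i) (ht i)).
have t0 i : 0 < t i by case/andP: (ht i).
have children n c r' : escaping_cell lam d eps Y n (c, r') ->
    exists M (G : nat -> nat -> bool),
  [/\ (0 < M)%N, M%:R ^+ 2 <= q * (count2 G M)%:R &
      forall i j, (i < M)%N -> (j < M)%N -> G i j ->
        escaping_cell lam d eps Y n.+1 (grid_center c r' M i j, r' / M%:R)].
  exact: (escaping_cell_children lamE d_range eps_range distort tau_range Y_ge2 Y_large Y_step q_large).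
have [||||||Qs [_ QsI QsN Qsp]] := @avoiding_branch R (escaping_cell lam d eps Y) q rho q_ge0
    _ _ children Q0 p t N (1 / 2) IQ0.
- by move=> n Q [[]].
- by move=> n Q [[Q20 QY] _ _ _ _]; rewrite /rho ler_pdivlMr.
- by clear; lra.
- by [].
- by move=> i n; have [h _] := hN i; exact: h.
- move=> k; apply: le_trans (_ : K * (1 / (2 * K)) <= _); last first.
    by rewrite le_eqVlt; apply/orP; left; apply/eqP; field; rewrite gt_eqF.
  apply: le_trans (ler_wpM2l (ltW K0) (hsum k)).
  by rewrite mulr_sumr; apply: ler_sum => i _; apply: term => //; have [] := hN i.
have Qs0 n : 0 < (Qs n).2 by have [[]] := QsI n.
have [z hz] := nested_squares (fun n => ltW (Qs0 n)) QsN.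
exists z.
  apply: (escaping_branch_julia Y_ge2 Y_unbounded QsI) => // n.
  exact: (escaping_cell_bounded_point lamE d_range distort tau_range Y_ge2) (QsI n).
move=> i; apply/negP => /andP[h1 h2].
(* A limit point in square i would bring the centre of its cell at level N i + 1 within t i plus the
   half side of that cell. *)
have /negP := Qsp i (N i).+1 (ltnSn _); apply; apply/andP.
have /andP[h3 h4] := hz (N i).+1.
split; [apply: le_trans (ler_distD (complex.Re z) _ _) _|
  apply: le_trans (ler_distD (complex.Im z) _ _) _]; by rewrite addrC lerD// distrC.
Qed.

(** * Sets of finite measure, sigma-finiteness and the conclusion *)

Section FiniteMeasureCovers.
Context {R : realType}.
Local Notation C := (cplane R).

Lemma hausdorff_content_le_measure (h : R -> R) (A : set C) (d : R) : 0 < d ->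
  (hausdorff_content h A d <= hausdorff_measure h A)%E.
Proof.
move=> d0; have d1 : d < d + 1 by rewrite ltrDl.
have cv : hausdorff_content h A x @[x --> 0^'+] -->
    ereal_sup [set hausdorff_content h A x | x in [set` Interval (BRight 0) (BLeft (d + 1))]].
  apply: nonincreasing_at_right_cvge => [|x y _ _ xy]; first by rewrite bnd_simp (lt_trans d0).
  exact: hausdorff_content_mono.
rewrite /hausdorff_measure (cvg_lim _ cv)//; apply: ereal_sup_ubound; exists d => //=.
by rewrite in_itv /= d0.
Qed.

Lemma diam_dist (A : set C) (d : R) (z w : R[i]) : (diam A < d%:E)%E -> A z -> A w ->
  normc (z - w) <= fine (diam A).
Proof.
move=> hd Az Aw; have fA : diam A \is a fin_num.
  by rewrite ge0_fin_numE ?diam_ge0// (lt_trans hd)// ltry.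
rewrite -lee_fin fineK//; apply: ereal_sup_ubound; right.
by exists z => //; exists w.
Qed.

Lemma sum_half_powers N : \sum_(0 <= i < N) 1 / (2 ^ i.+1)%:R <= 1 :> R.
Proof.
have -> : \sum_(0 <= i < N) 1 / (2 ^ i.+1)%:R = 1 - 1 / (2 ^ N)%:R :> R.
  elim: N => [|N IH]; first by rewrite big_geq// expn0 divr1 subrr.
  rewrite big_nat_recr//= IH expnS natrM; field.
  by rewrite pnatr_eq0 expn_eq0.
by rewrite gerBl divr_ge0.
Qed.

(* Squares of positive size replace the covering sets, some of which may have
   diameter 0. *)
Lemma finite_measure_null (h h' : R -> R) (A : set C) (dl e : R) : gauge_function h ->
  (forall eta, 0 < eta -> exists2 d, 0 < d & forall t, 0 < t < d -> 0 <= h' t <= eta * h t) ->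
  (hausdorff_measure h A < +oo)%E -> 0 < dl -> 0 < e ->
  exists (p : nat -> R[i]) (t : nat -> R), [/\ forall i, 0 < t i < dl,
    forall z, A z -> exists i, in_square (p i) (t i) z &
    forall N, \sum_(0 <= i < N) h' (t i) <= e].
Proof.
move=> [eps eps0 [h0 hpos hmono hcont]] hlittle hA dl0 e0.
have [V V0 hV] : exists2 V : R, 0 < V & (hausdorff_measure h A < V%:E)%E.
  case: (hausdorff_measure h A) hA => [v _|//|_].
    exists (Num.max 0 v + 1); first by rewrite ltr_wpDl// le_max lexx.
    by rewrite lte_fin ltr_pwDr// le_max lexx orbT.
  by exists 1 => //; rewrite ltNyr.
(* Half of e pays for eta times the sum of h, which is below V; the other half for the summands
   [kap i]. *)
pose eta := e / 2 / V.
have eta0 : 0 < eta by rewrite !divr_gt0.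
have [d1 d10 hd1] := hlittle eta eta0.
pose d := Num.min d1 (Num.min dl eps).
have d0 : 0 < d by rewrite !lt_min d10 dl0.
have [dd1 ddl deps] : [/\ d <= d1, d <= dl & d <= eps].
  by split; rewrite /d !ge_min lexx ?orbT.
have := le_lt_trans (hausdorff_content_le_measure h A d0) hV.
move=> /ereal_inf_lt[_ [D [AD hD] <-] hsum].
(* Right continuity of h at 0 supplies positive sizes of negligible weight for covering sets of
   diameter 0. *)
have small kap : 0 < kap -> exists2 t, 0 < t < d & h' t <= kap.
  move=> kap0; have /hcont : (0 : R) <= 0 < eps by rewrite lexx.
  move=> /cvgrPdist_lt /(_ (kap / eta)); rewrite divr_gt0// => /(_ isT) /at_right0P[d2 d20 hd2].
  have m0 : 0 < Num.min d d2 by rewrite lt_min d0.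
  have m2 : Num.min d d2 / 2 < Num.min d d2 by rewrite ltr_pdivrMr// ltr_pMr// ltr1n.
  exists (Num.min d d2 / 2); first by rewrite divr_gt0//= (lt_le_trans m2)// ge_min lexx.
  have /hd2 : 0 < Num.min d d2 / 2 < d2 by rewrite divr_gt0//= (lt_le_trans m2)// ge_min lexx orbT.
  rewrite h0 sub0r normrN => hk.
  have /hd1/andP[_ hle] : 0 < Num.min d d2 / 2 < d1.
    by rewrite divr_gt0//= (lt_le_trans m2)// ge_min dd1.
  apply: le_trans hle _; rewrite mulrC -ler_pdivlMr//.
  exact: le_trans (ler_norm _) (ltW hk).
pose kap i : R := e / 2 * (1 / (2 ^ i.+1)%:R).
have kap0 i : 0 < kap i by rewrite mulr_gt0 ?divr_gt0// ltr0n expn_gt0.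
pose dm i := fine (diam (D i)).
have dmP i : 0 <= dm i < d by exact: fine_diam_lt.
have hdm i : 0 <= h (dm i).
  by have /andP[a1 a2] := dmP i; rewrite hpos// a1 (lt_le_trans a2).
have tex i : exists t, [/\ 0 < t < d, dm i <= t & h' t <= eta * h (dm i) + kap i].
  have /andP[a1 a2] := dmP i; have := a1; rewrite le_eqVlt => /orP[/eqP <-|a3].
    have [t ht hk] := small _ (kap0 i); exists t; split => //; first by case/andP: ht => /ltW.
    by rewrite h0 mulr0 add0r.
  exists (dm i); split => //; first by rewrite a3.
  have /hd1/andP[_ /le_trans] : 0 < dm i < d1 by rewrite a3 (lt_le_trans a2).
  by apply; rewrite lerDl ltW.
have [t ht] := choice tex.
have pex i : exists p : R[i], forall z, D i z -> in_square p (t i) z.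
  have [[p Dp]|none] := pselect (exists p, D i p); last first.
    by exists 0 => z Dz; exfalso; apply: none; exists z.
  exists p => z Dz; apply: normc_in_square; have [_ hdt _] := ht i.
  exact: le_trans (diam_dist (hD i) Dz Dp) hdt.
have [p hp] := choice pex.
exists p, t; split => [i|z /AD[i _ Dz]|N].
- by have [/andP[-> h1] _ _] := ht i; exact: lt_le_trans h1 ddl.
- by exists i; exact: hp.
apply: le_trans (_ : \sum_(0 <= i < N) (eta * h (dm i) + kap i) <= _).
  by apply: ler_sum => i _; have [] := ht i.
rewrite big_split /= -2!mulr_sumr.
have hs : \sum_(0 <= i < N) h (dm i) <= V by apply: sum_le_of_nneseries => //; exact: ltW.
have := ler_wpM2l (ltW eta0) hs; rewrite /eta divfK ?gt_eqF//.
have e20 : 0 <= e / 2 by rewrite divr_ge0// ltW.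
have := ler_wpM2l e20 (sum_half_powers N); clear; lra.
Qed.

End FiniteMeasureCovers.

(** For s' strictly between ln 2 / ln beta and s, Phi(1/t)^(s' - s) tends to 0, so a set of finite
    h-measure is null for exponent s'. All pieces together are covered by one sequence of squares of
    small total weight, which [julia_avoids_squares] shows to miss a point of the Julia set. *)
Theorem julia_not_sigma_finite (R : realType) (lam0 beta s d : R) (Phi g h : R -> R)
    (lam : cplane R) :
  0 < lam0 -> 1 < beta -> lam0 * expR beta = beta -> koenigs lam0 beta Phi ->
  (forall t, h t = t ^+ 2 * g t) -> gauge_function h ->
  ln 2 < s * ln beta -> 0 < d ->
  (forall t, 0 < t < d -> koenigs_gauge Phi s (1 / t) <= g t) ->
  lam != 0 -> ~ hausdorff_sigma_finite h (julia (Eexp lam)).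
Proof.
move=> l0 b1 fb hK hg hh hs d0 hd lam_neq0 [F [JF HF]].
have germ := koenigs_germ hK; have PhiE := hK.2.
have lnb : 0 < ln beta by rewrite ln_gt0.
pose s' := (s + ln 2 / ln beta) / 2.
have hs' : ln 2 < s' * ln beta /\ s' < s.
  have : ln 2 / ln beta < s by rewrite ltr_pdivrMr.
  have : ln 2 = ln 2 / ln beta * ln beta by rewrite divfK// gt_eqF.
  by rewrite /s'; clear -lnb hs; split; nra.
have [hs1 ss'] := hs'.
have [e [tm [e0 tm0 avoid]]] := julia_avoids_squares l0 b1 fb PhiE germ hs1 lam_neq0.
pose h' t := t ^+ 2 * koenigs_gauge Phi s' (1 / t).
have h'0 t : 0 <= h' t by rewrite mulr_ge0 ?sqr_ge0 ?expR_ge0.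
have little eta : 0 < eta -> exists2 d, 0 < d & forall t, 0 < t < d -> 0 <= h' t <= eta * h t.
  move=> eta0.
  have [x1 x1b hx1] := koenigs_unbounded l0 b1 fb PhiE germ (expR (- ln eta / (s - s'))).
  have x10 : 0 < x1 by rewrite (lt_trans _ x1b)// (lt_trans ltr01).
  exists (Num.min d (1 / x1)); first by rewrite lt_min d0 divr_gt0.
  move=> t; rewrite lt_min => /and3P[t0 td tx]; rewrite h'0 /=.
  have tx1 : x1 <= 1 / t by rewrite ler_pdivlMr// mulrC -ler_pdivlMr// ltW.
  have hP := hx1 _ tx1.
  have P0 : 0 < Phi (1 / t) by apply: lt_le_trans hP; exact: expR_gt0.
  have lP : - ln eta / (s - s') <= ln (Phi (1 / t)).
    by rewrite -[leLHS]expRK ler_ln ?posrE ?expR_gt0.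
  rewrite hg /h' mulrCA ler_wpM2l ?sqr_ge0//.
  apply: le_trans (_ : eta * koenigs_gauge Phi s (1 / t) <= _); last first.
    by rewrite ler_pM2l// hd// t0.
  rewrite /koenigs_gauge -{1}(@lnK _ eta) ?posrE// -expRD ler_expR.
  by move: lP; rewrite ler_pdivrMr ?subr_gt0//; clear; lra.
have en n : 0 < e / (2 ^ n.+1)%:R by rewrite divr_gt0// ltr0n expn_gt0.
have covers n : exists pt : (nat -> R[i]) * (nat -> R), [/\ forall i, 0 < pt.2 i < tm,
    forall z, F n z -> exists i, in_square (pt.1 i) (pt.2 i) z &
    forall N, \sum_(0 <= i < N) h' (pt.2 i) <= e / (2 ^ n.+1)%:R].
  have [p [t hpt]] := finite_measure_null hh little (HF n) tm0 (en n).
  by exists (p, t).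
have [pt hpt] := choice covers.
have [n|f fsurj fsum] := @sum_pairs_le _ (fun n i => h' ((pt n).2 i)) e (ltW e0) (fun _ _ => h'0 _).
  apply: nneseries_le_of_sums => //; exists 0 => // N _.
  by have [_ _] := hpt n; apply.
have [k|N|z Jz hz] := avoid (fun k => (pt (f k).1).1 (f k).2) (fun k => (pt (f k).1).2 (f k).2).
- by have [h1 _ _] := hpt (f k).1.
- exact: (sum_le_of_nneseries _ (fun _ => h'0 _) fsum).
have [n _ Fz] := JF z Jz.
have [_ h2 _] := hpt n; have [i hi] := h2 z Fz.
have [k fk] := fsurj (n, i).
by have := hz k; rewrite fk hi.
Qed.

Theorem theorem1p1 (R : realType) (lam0 beta : R) (Phi g h : R -> R)
    (hlam0 : 0 < lam0 < (expR 1)^-1)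
    (hbeta : real_repelling_fixpoint (Eexp lam0%:C) beta)
    (hPhi : koenigs lam0 beta Phi)
    (hg : forall t : R, h t = t ^+ 2 * g t)
    (hh : gauge_function h) :
  (((ln 2 / ln beta)%:E < limf_einf (log_ratio g Phi) 0^'+)%E ->
    forall lam : cplane R, lam != 0 ->
      hausdorff_measure h (julia (Eexp lam)) = +oo%E /\
      ~ hausdorff_sigma_finite h (julia (Eexp lam))) /\
  ((limf_esup (log_ratio g Phi) 0^'+ < (ln 2 / ln beta)%:E)%E ->
    forall lam : R, 0 < lam < (expR 1)^-1 ->
      hausdorff_measure h (julia (Eexp lam%:C)) = 0%E).
Proof.
have /andP[l0 _] := hlam0.
have [fb b1] := repelling_fixpoint_real l0 hbeta.
have lnb : 0 < ln beta by rewrite ln_gt0.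
have Phi_large : exists2 d : R, 0 < d & forall t, 0 < t < d -> 1 < Phi (1 / t).
  have [x1 x1b hx1] := koenigs_unbounded l0 b1 fb hPhi.2 (koenigs_germ hPhi) 2.
  have x10 : 0 < x1 by rewrite (lt_trans _ x1b)// (lt_trans ltr01).
  exists (1 / x1); first by rewrite divr_gt0.
  move=> t /andP[t0 tx]; apply: (@lt_le_trans _ _ 2); first by rewrite ltr1n.
  by apply: hx1; rewrite ler_pdivlMr// mulrC -ler_pdivlMr// ltW.
split.
  move=> /(log_ratio_liminf Phi_large)[s [Ks [d d0 hd]]] lam lam_neq0.
  have hs : ln 2 < s * ln beta by rewrite -ltr_pdivrMr.
  have nsf := julia_not_sigma_finite l0 b1 fb hPhi hg hh hs d0 hd lam_neq0.
  (* Finite measure would make the constant sequence a sigma-finite decomposition. *)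
  split => //; apply/eqP; rewrite eq_le leey leNgt; apply/negP => finite.
  by apply: nsf; exists (fun=> julia (Eexp lam)); split => // z Jz; exists 0.
have K0 : 0 < ln 2 / ln beta by rewrite divr_gt0// ln_gt0// ltr1n.
move=> /(log_ratio_limsup Phi_large K0)[s [s0 sK [d d0 hd]]] lam hlam.
have hs : s * ln beta < ln 2 by rewrite -ltr_pdivlMr.
exact: (hausdorff_julia_eq0 l0 b1 fb hPhi hg hh s0 hs d0 hd hlam).
Qed.
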